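(* Consider the system $\dot{\mathbf{x}}=\mathbf{f}(\mathbf{x})=\mathbf{A}\mathbf{x}+\tilde{\mathbf{f}}(\mathbf{x})$, $\mathbf{x}\in\mathbb{R}^n$, with $\mathbf{f}(\mathbf{0})=\mathbf{0}$, $\mathbf{A}=D\mathbf{f}(\mathbf{0})$ and $\tilde{\mathbf{f}}(\mathbf{x})=o(|\mathbf{x}|)$, and let $\mathbf{F}^t$ denote its flow map. Assume the following. (A1) $\mathbf{x}=\mathbf{0}$ is a stable hyperbolic fixed point with a spectral gap, i.e. the eigenvalues $\lambda_1,\dots,\lambda_n$ of $\mathbf{A}$ satisfy $$\mathrm{Re}\,\lambda_n\le\dots\le\mathrm{Re}\,\lambda_{d+1}<\mathrm{Re}\,\lambda_d\le\dots\le\mathrm{Re}\,\lambda_1<0 .$$ (A2) $\mathbf{f}\in C^2$ in a neighborhood of the origin. (A3) For some integer $d\in[1,n]$ (the same $d$ as in (A1)), a $d$-dimensional observable function $\boldsymbol{\phi}\in C^2$ and the $d$-dimensional slow spectral subspace $E$ of the hyperbolic fixed point $\mathbf{x}=\mathbf{0}$ satisfy the non-degeneracy condition $\mathrm{rank}\,[D\boldsymbol{\phi}(\mathbf{0})|_E]=d$. (A4) The data matrices $\boldsymbol{\Phi}$ and $\hat{\boldsymbol{\Phi}}$ are non-degenerate and the initial conditions in $\mathbf{X}$ and $\hat{\mathbf{X}}$ have been selected after fast transients from the modes outside $E$ have largely died out, i.e. $$\mathrm{rank}_{\mathrm{row}}\,\boldsymbol{\Phi}=d,\qquad |\mathbf{P}_F\mathbf{X}|,\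 |\mathbf{P}_F\hat{\mathbf{X}}|\le|\mathbf{P}_E\mathbf{X}|^{1+\beta}$$ for some $\beta\in(0,1]$. Then the DMD computed from $\boldsymbol{\Phi}$ and $\hat{\boldsymbol{\Phi}}$ yields a matrix $\boldsymbol{\mathcal{D}}$ that is locally topologically conjugate, with order $\mathcal{O}(|\mathbf{P}_E\mathbf{X}|^{\beta})$ error, to the linearized dynamics on a $d$-dimensional, slow attracting spectral submanifold $\mathcal{W}(E)\in C^1$ tangent to $E$ at $\mathbf{x}=\mathbf{0}$. Specifically, $$\boldsymbol{\mathcal{D}}=D\boldsymbol{\phi}(\mathbf{0})\mathbf{T}_E\,e^{\boldsymbol{\Lambda}_E\Delta t}\left(D\boldsymbol{\phi}(\mathbf{0})\mathbf{T}_E\right)^{-1}+\mathcal{O}\left(|\mathbf{P}_E\mathbf{X}|^{\beta}\right).$$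
   Context: Notation. $\mathbf{e}_1,\dots,\mathbf{e}_n$ are the generalized eigenvectors of $\mathbf{A}$ corresponding to $\lambda_1,\dots,\lambda_n$. The slow and fast spectral subspaces are $$E=\mathrm{span}\{\mathrm{Re}\,\mathbf{e}_1,\mathrm{Im}\,\mathbf{e}_1,\dots,\mathrm{Re}\,\mathbf{e}_d,\mathrm{Im}\,\mathbf{e}_d\}\quad(\dim E=d),\qquad F=\mathrm{span}\{\mathrm{Re}\,\mathbf{e}_{d+1},\mathrm{Im}\,\mathbf{e}_{d+1},\dots,\mathrm{Re}\,\mathbf{e}_n,\mathrm{Im}\,\mathbf{e}_n\}.$$ $\mathbf{T}=[\mathbf{T}_E,\mathbf{T}_F]$, where the columns of $\mathbf{T}_E\in\mathbb{R}^{n\times d}$ (resp. $\mathbf{T}_F\in\mathbb{R}^{n\times(n-d)}$) are the real and imaginary parts of the generalized right eigenvectors of $\mathbf{A}|_E$ (resp. $\mathbf{A}|_F$), forming a basis of $E$ (resp. $F$). The rows of $\mathbf{P}_E\in\mathbb{R}^{d\times n}$ (resp. $\mathbf{P}_F\in\mathbb{R}^{(n-d)\times n}$) are the real and imaginary parts of the generalized left eigenvectors of $\mathbf{A}$ associated with $E$ (resp. $F$). $\boldsymbol{\Lambda}_E=(\mathbf{T}^{-1}\mathbf{A}\mathbf{T})|_E\in\mathbb{R}^{d\times d}$, i.e. $\mathbf{A}\mathbf{T}_E=\mathbf{T}_E\boldsymbol{\Lambda}_E$. Data. For a fixed time step $\Delta t>0$ and $m$ initial conditions $\mathbf{x}^1(t_0),\dots,\mathbf{x}^m(t_0)\in\mathbb{R}^n$,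 $$\mathbf{X}=[\mathbf{x}^1(t_0),\dots,\mathbf{x}^m(t_0)],\qquad \hat{\mathbf{X}}=[\mathbf{F}^{\Delta t}(\mathbf{x}^1(t_0)),\dots,\mathbf{F}^{\Delta t}(\mathbf{x}^m(t_0))],$$ and $\boldsymbol{\Phi}=\boldsymbol{\phi}(\mathbf{X})$, $\hat{\boldsymbol{\Phi}}=\boldsymbol{\phi}(\hat{\mathbf{X}})\in\mathbb{R}^{d\times m}$, with $\boldsymbol{\phi}:\mathbb{R}^n\to\mathbb{R}^d$ applied column by column. $|\cdot|$ is the Euclidean norm (for matrices, the Euclidean matrix norm), and $\mathrm{rank}_{\mathrm{row}}$ is the row rank. DMD. The matrix $\boldsymbol{\mathcal{D}}\in\mathbb{R}^{d\times d}$ computed by dynamic mode decomposition (DMD) is the minimizer of $|\hat{\boldsymbol{\Phi}}-\boldsymbol{\mathcal{D}}\boldsymbol{\Phi}|^2$ given by $\boldsymbol{\mathcal{D}}=(\hat{\boldsymbol{\Phi}}\boldsymbol{\Phi}^{\mathrm{T}})(\boldsymbol{\Phi}\boldsymbol{\Phi}^{\mathrm{T}})^{\dagger}$, with $\dagger$ the pseudo-inverse. A slow attracting spectral submanifold $\mathcal{W}(E)$ is a $d$-dimensional invariant manifold through the fixed point, tangent to $E$ there, to which nearby trajectories converge exponentially. The $\mathcal{O}$ terms refer to the limit $|\mathbf{P}_E\mathbf{X}|\to0$ (data approaching the fixed point), with $\mathbf{f}$, $\boldsymbol{\phi}$ and $\Delta t$ fixed.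
   Formalization: It is assumed in addition that φ(0)=0, and the constant in O(|P_E X|^β) may depend on an upper bound for the condition number |Φ||Φ†| of the data matrix; without either condition the stated estimate fails. *)

(* Defs.v *)
From HB Require Import structures.
From mathcomp Require Import all_boot all_order all_algebra.
From mathcomp Require Import complex.
From mathcomp Require Import all_classical all_reals all_analysis.

Set Implicit Arguments.
Unset Strict Implicit.
Unset Printing Implicit Defensive.

Import Order.TTheory GRing.Theory Num.Theory.
Import numFieldNormedType.Exports.

Local Open Scope classical_set_scope.
Local Open Scope ring_scope.

Section Matrices.
Variable R : realType.

(* Euclidean (Frobenius) norm. The library norm on matrices is the sup norm. *)
Definition enorm (p q : nat) (M : 'M[R]_(p, q)) : R :=
  Num.sqrt (\sum_i \sum_j M i j ^+ 2).

Definition moore_penrose (p q : nat) (M : 'M[R]_(p, q)) (Y : 'M[R]_(q, p)) :=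
  [/\ M *m Y *m M = M, Y *m M *m Y = Y,
      (M *m Y)^T = M *m Y & (Y *m M)^T = Y *m M].

(* The four Penrose conditions have exactly one solution, so the default value
   0 is never used. *)
Definition mp_inverse (p q : nat) (M : 'M[R]_(p, q)) : 'M[R]_(q, p) :=
  xget 0 [set Y | moore_penrose M Y].

Definition mexp (p : nat) (M : 'M[R]_p) : 'M[R]_p :=
  lim (series (fun j : nat => (j`!%:R)^-1 *: M ^+ j) @ \oo).

Definition map_cols (p q m : nat) (g : 'cV[R]_p -> 'cV[R]_q)
    (X : 'M[R]_(p, m)) : 'M[R]_(q, m) :=
  \matrix_(i, j) g (col j X) i 0.

Definition dmd (d m : nat) (Phi Phihat : 'M[R]_(d, m)) : 'M[R]_d :=
  (Phihat *m Phi^T) *m mp_inverse (Phi *m Phi^T).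

End Matrices.

Section Smoothness.
Variable R : realType.

(* The library's Jacobian acts on row vectors, from the right; this is the
   usual one, for maps between spaces of column vectors. *)
Definition cjacobian (p q : nat) (g : 'cV[R]_p -> 'cV[R]_q) (x : 'cV[R]_p) :
    'M[R]_(q, p) :=
  \matrix_(i, j) 'd g x (delta_mx j 0) i 0.

(* To be used with U open. *)
Definition C1_on (p q : nat) (U : set 'cV[R]_p) (g : 'cV[R]_p -> 'cV[R]_q) :=
  forall x, U x -> differentiable g x /\
    forall v, {for x, continuous (fun y => 'D_v g y)}.

Definition C2_on (p q : nat) (U : set 'cV[R]_p) (g : 'cV[R]_p -> 'cV[R]_q) :=
  C1_on U g /\ forall v, C1_on U (fun y => 'D_v g y).

End Smoothness.

Section Spectral.
Variable R : realType.

Definition Remx (p q : nat) (M : 'M[R[i]]_(p, q)) : 'M[R]_(p, q) :=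
  map_mx (@complex.Re R) M.
Definition Immx (p q : nat) (M : 'M[R[i]]_(p, q)) : 'M[R]_(p, q) :=
  map_mx (@complex.Im R) M.
Definition complexify (p q : nat) (M : 'M[R]_(p, q)) : 'M[R[i]]_(p, q) :=
  map_mx (real_complex R) M.

Definition gen_eigenvector (n : nat) (A : 'M[R]_n) (l : R[i])
    (v : 'cV[R[i]]_n) :=
  v != 0 /\ exists j : nat, (complexify A - l%:M) ^+ j *m v = 0.

Definition gen_left_eigenvector (n : nat) (A : 'M[R]_n) (l : R[i])
    (w : 'rV[R[i]]_n) :=
  w != 0 /\ exists j : nat, w *m (complexify A - l%:M) ^+ j = 0.

(* [lam] lists the eigenvalues with algebraic multiplicity. *)
Definition eigenvalues (n : nat) (A : 'M[R]_n) (lam : 'I_n -> R[i]) :=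
  char_poly (complexify A) = \prod_i ('X - (lam i)%:P).

(* [e] lists n linearly independent generalized eigenvectors, e i for lam i. *)
Definition gen_eigenbasis (n : nat) (A : 'M[R]_n) (lam : 'I_n -> R[i])
    (e : 'I_n -> 'cV[R[i]]_n) :=
  (forall i, gen_eigenvector A (lam i) (e i)) /\
  (\matrix_(i, j) e j i 0) \in unitmx.

(* Indices are 0-based: lam 0, ..., lam (d - 1) are the slow eigenvalues. *)
Definition stable_spectral_gap (n d : nat) (lam : 'I_n -> R[i]) :=
  [/\ forall i j : 'I_n, (i <= j)%N -> complex.Re (lam j) <= complex.Re (lam i),
      forall i j : 'I_n, (i < d)%N -> (d <= j)%N ->
        complex.Re (lam j) < complex.Re (lam i)
    & forall i : 'I_n, complex.Re (lam i) < 0].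

Definition re_im_span (n p : nat) (e : 'I_p -> 'cV[R[i]]_n) :
    {vspace 'cV[R]_n} :=
  <<[seq Remx (e i) | i <- enum 'I_p] ++ [seq Immx (e i) | i <- enum 'I_p]>>%VS.

Definition right_basis (n p : nat) (A : 'M[R]_n) (mu : 'I_p -> R[i])
    (S : {vspace 'cV[R]_n}) (T : 'M[R]_(n, p)) :=
  basis_of S [seq col j T | j <- enum 'I_p] /\
  forall j, exists i v, gen_eigenvector A (mu i) v /\
    (col j T = Remx v \/ col j T = Immx v).

Definition left_basis (n p : nat) (A : 'M[R]_n) (mu : 'I_p -> R[i])
    (P : 'M[R]_(p, n)) :=
  row_free P /\
  forall j, exists i w, gen_left_eigenvector A (mu i) w /\
    (row j P = Remx w \/ row j P = Immx w).

End Spectral.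

Section Dynamics.
Variable R : realType.

(* [F] is the (forward) flow map of x' = f x for initial conditions in N. *)
Definition flow_on (n : nat) (f : 'cV[R]_n -> 'cV[R]_n) (N : set 'cV[R]_n)
    (F : R -> 'cV[R]_n -> 'cV[R]_n) :=
  forall x, N x ->
    [/\ F 0 x = x, {within `[0, +oo[, continuous (fun t => F t x)}
      & forall t : R, 0 < t -> is_derive t 1 (fun s : R => F s x) (f (F t x))].

(* h : U -> R^n parametrizes a neighborhood of h 0 in W; g is its inverse. *)
Definition C1_param (n d : nat) (W : set 'cV[R]_n) (U : set 'cV[R]_d)
    (h : 'cV[R]_d -> 'cV[R]_n) :=
  [/\ open U, U 0, C1_on U h, forall u, U u -> \rank (cjacobian h u) = d
    & exists (V : set 'cV[R]_n) (g : 'cV[R]_n -> 'cV[R]_d),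
        [/\ open V, h @` U = W `&` V, forall u, U u -> g (h u) = u
          & {within W `&` V, continuous g}]].

Definition C1_submanifold (n d : nat) (W : set 'cV[R]_n) :=
  forall x, W x -> exists (U : set 'cV[R]_d) (h : 'cV[R]_d -> 'cV[R]_n),
    C1_param W U h /\ h 0 = x.

Definition tangent_at0 (n d : nat) (W : set 'cV[R]_n) (E : {vspace 'cV[R]_n}) :=
  exists (U : set 'cV[R]_d) (h : 'cV[R]_d -> 'cV[R]_n),
    [/\ C1_param W U h, h 0 = 0
      & forall v, v \in E <-> exists u, v = cjacobian h 0 *m u].

Definition euclidean_dist (n : nat) (x : 'cV[R]_n) (W : set 'cV[R]_n) : R :=
  inf [set enorm (x - y) | y in W].

Definition exp_attracting (n : nat) (F : R -> 'cV[R]_n -> 'cV[R]_n)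
    (N W : set 'cV[R]_n) :=
  exists V : set 'cV[R]_n, [/\ open V, W `<=` V, V `<=` N
    & exists C mu : R, [/\ 0 < C, 0 < mu
      & forall x t, V x -> 0 <= t ->
          euclidean_dist (F t x) W <= C * expR (- mu * t) * euclidean_dist x W]].

(* Positive invariance together with W being a boundaryless submanifold makes
   the vector field tangent to W, hence W locally invariant backwards too. *)
Definition attracting_SSM (n d : nat) (F : R -> 'cV[R]_n -> 'cV[R]_n)
    (N : set 'cV[R]_n) (E : {vspace 'cV[R]_n}) (W : set 'cV[R]_n) :=
  [/\ W 0 /\ W `<=` N, C1_submanifold d W, tangent_at0 d W E,
      forall x t, W x -> 0 <= t -> W (F t x)
    & exp_attracting F N W].

(* In some chart of W around 0, the map G restricted to W has the derivative L
   at its fixed point 0. *)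
Definition linearization_on (n d : nat) (W : set 'cV[R]_n)
    (G : 'cV[R]_n -> 'cV[R]_n) (L : 'M[R]_d) :=
  exists (U : set 'cV[R]_d) (h : 'cV[R]_d -> 'cV[R]_n) (g : 'cV[R]_d -> 'cV[R]_d),
    [/\ C1_param W U h /\ h 0 = 0,
        \forall u \near (0 : 'cV[R]_d), U (g u) /\ h (g u) = G (h u),
        differentiable g 0 & cjacobian g 0 = L].

Definition locally_conjugate (d : nat) (g1 g2 : 'cV[R]_d -> 'cV[R]_d) :=
  exists (U : set 'cV[R]_d) (psi psi' : 'cV[R]_d -> 'cV[R]_d),
    [/\ [/\ open U, U 0, psi 0 = 0 & open (psi @` U)],
        {within U, continuous psi}, {within psi @` U, continuous psi'},
        forall u, U u -> psi' (psi u) = u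
      & forall u, U u -> U (g1 u) -> psi (g1 u) = g2 (psi u)].

End Dynamics.

(* Main.v *)
(* Adapted norms |JE u| and |JF v| turn the spectral gap into dissipation
   inequalities with rates al < be on E and F. In the coordinates z = (u, v) of T,
   after a cutoff that makes the nonlinearity globally Lipschitz with a small
   constant, each u is the E-part at time 0 of exactly one solution on ]-oo, 0]
   that grows at most like exp (- ga t), al < ga < be (Lyapunov-Perron); let w u be
   its F-part at 0. The linearized problem, estimated at a weight slightly larger
   than ga, shows that w is C^1 with w 0 = 0 and w' 0 = 0. Since time shifts
   preserve the growth condition, the graph of w is invariant, and v - w u decays
   exponentially along small forward solutions; W(E) is the part of the graph over
   a disk in E.

   For the DMD matrix, u (dt) = exp (dt LambdaE) u (0) + O(|z (0)|^2) and hence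
   Phihat - D0 Phi = O(|PE X|^(1 + beta)), whereas |Phi| >= c |PE X|. As
   D - D0 = (Phihat - D0 Phi) Phi^+ and |Phi^+| <= kappa / |Phi|, the error is
   O(|PE X|^beta). *)

Require Import Defs.
From HB Require Import structures.
From mathcomp Require Import all_boot all_order all_algebra.
From mathcomp Require Import complex.
From mathcomp Require Import all_classical all_reals all_analysis.
From mathcomp Require Import ring lra.
Set Implicit Arguments.
Unset Strict Implicit.
Unset Printing Implicit Defensive.
Import Order.TTheory GRing.Theory Num.Theory.
Import numFieldNormedType.Exports.
Local Open Scope classical_set_scope.
Local Open Scope ring_scope.

(** * Euclidean norms and curves of matrices *)

(** Followed backwards, orbits on the slow manifold leave any small neighborhood of the stable
    point, so local information on [f] cannot single them out. This forces the global truncation,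
    and the manifold obtained depends on it. The forward flow, in contrast, is trapped in a region
    where the truncated and the true field agree, so statements about [F] use forward time only.
    Sizes are mostly measured by squared norms: their derivatives along curves are polynomial, and a
    linear estimate becomes a scalar Gronwall inequality closed by Young's inequality, without
    growth bounds for matrix exponentials. The price is a factor 2 at every triangle inequality,
    which explains most numerical constants; smallness constants such as [e] are squares of
    Lipschitz constants. Slow and fast directions are told apart only by the real parts of the roots
    of annihilating polynomials, so no Jordan form is used. Full row rank alone gives no uniform
    bound on the pseudo-inverse of [Phi], whence the constants depend on the condition bound
    [kappa]. *)

Section Euclid.
Variable R : realType.

Definition dot (n : nat) (x y : 'cV[R]_n) : R := \sum_i x i 0 * y i 0.
Definition nsq (n : nat) (x : 'cV[R]_n) : R := dot x x.

Lemma nsqE n (x : 'cV[R]_n) : nsq x = \sum_i x i 0 ^+ 2.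
Proof. by apply: eq_bigr => i _; rewrite expr2. Qed.

Lemma nsq_ge0 n (x : 'cV[R]_n) : 0 <= nsq x.
Proof. by rewrite nsqE sumr_ge0 // => i _; rewrite sqr_ge0. Qed.

Lemma dotC n (x y : 'cV[R]_n) : dot x y = dot y x.
Proof. by apply: eq_bigr => i _; rewrite mulrC. Qed.

Lemma dotDl n (x y z : 'cV[R]_n) : dot (x + y) z = dot x z + dot y z.
Proof. by rewrite -big_split; apply: eq_bigr => i _; rewrite mxE mulrDl. Qed.

Lemma dotDr n (x y z : 'cV[R]_n) : dot x (y + z) = dot x y + dot x z.
Proof. by rewrite dotC dotDl !(dotC x). Qed.

Lemma dotZl n (a : R) (x y : 'cV[R]_n) : dot (a *: x) y = a * dot x y.
Proof. by rewrite mulr_sumr; apply: eq_bigr => i _; rewrite mxE mulrA. Qed.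

Lemma dotZr n (a : R) (x y : 'cV[R]_n) : dot x (a *: y) = a * dot x y.
Proof. by rewrite dotC dotZl dotC. Qed.

Lemma dotNl n (x y : 'cV[R]_n) : dot (- x) y = - dot x y.
Proof. by rewrite -scaleN1r dotZl mulN1r. Qed.

Lemma dotNr n (x y : 'cV[R]_n) : dot x (- y) = - dot x y.
Proof. by rewrite dotC dotNl dotC. Qed.

Lemma nsq0 n : nsq (0 : 'cV[R]_n) = 0.
Proof. by rewrite /nsq -(scale0r 0) dotZl mul0r. Qed.

Lemma nsqN n (x : 'cV[R]_n) : nsq (- x) = nsq x.
Proof. by rewrite /nsq dotNl dotNr opprK. Qed.

Lemma nsqZ n (a : R) (x : 'cV[R]_n) : nsq (a *: x) = a ^+ 2 * nsq x.
Proof. by rewrite /nsq dotZl dotZr mulrA expr2. Qed.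

Lemma nsqD n (x y : 'cV[R]_n) : nsq (x + y) = nsq x + 2 * dot x y + nsq y.
Proof. by rewrite /nsq dotDl !dotDr (dotC y x); ring. Qed.

Lemma nsqB n (x y : 'cV[R]_n) : nsq (x - y) = nsq x - 2 * dot x y + nsq y.
Proof. by rewrite nsqD dotNr nsqN mulrN. Qed.

(** Expand [nsq (c *: x - y) >= 0]. Later [c] is the distance between a dissipation rate and a
    weight, or the rate itself, and the inequality absorbs a cross term into the dissipation. *)
Lemma young n (c : R) (x y : 'cV[R]_n) : 0 < c ->
  2 * dot x y <= c * nsq x + nsq y / c.
Proof.
move=> c0; have := nsq_ge0 (c *: x - y); rewrite nsqB nsqZ dotZl => H.
rewrite -(ler_pM2l c0).
have -> : c * (c * nsq x + nsq y / c) = c ^+ 2 * nsq x + nsq y.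
  by field; rewrite gt_eqF.
lra.
Qed.

Lemma youngN n (c : R) (x y : 'cV[R]_n) : 0 < c ->
  - (c * nsq x + nsq y / c) <= 2 * dot x y.
Proof. by move=> c0; have := young (- x) y c0; rewrite dotNl nsqN; lra. Qed.

Lemma nsqD_le n (x y : 'cV[R]_n) : nsq (x + y) <= 2 * nsq x + 2 * nsq y.
Proof. by have := young x y ltr01; rewrite nsqD divr1 mul1r; lra. Qed.

Lemma nsqB_le n (x y : 'cV[R]_n) : nsq (x - y) <= 2 * nsq x + 2 * nsq y.
Proof. by rewrite -(nsqN y) nsqD_le. Qed.

Lemma nsq_col_mx n m (x : 'cV[R]_n) (y : 'cV[R]_m) :
  nsq (col_mx x y) = nsq x + nsq y.
Proof.
rewrite !nsqE big_split_ord /=; congr (_ + _); apply: eq_bigr => i _.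
  by rewrite col_mxEu.
by rewrite col_mxEd.
Qed.

Lemma sqr_le_nsq n (x : 'cV[R]_n) i j : (x i j) ^+ 2 <= nsq x.
Proof.
rewrite nsqE (bigD1 i) //= (ord1 j) lerDl sumr_ge0 // => k _.
exact: sqr_ge0.
Qed.

Lemma norm_le_nsq n (x : 'cV[R]_n) : `|x| ^+ 2 <= nsq x.
Proof.
rewrite -(sqr_sqrtr (nsq_ge0 x)) lerXn2r ?nnegrE ?sqrtr_ge0 //.
rewrite [leLHS]/Num.Def.normr /= mx_normrE bigmax_le ?sqrtr_ge0 //= => -[i j] _.
by rewrite -sqrtr_sqr ler_wsqrtr // sqr_le_nsq.
Qed.

Lemma coord_le_norm n m (x : 'M[R]_(n, m)) i j : `|x i j| <= `|x|.
Proof.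
by rewrite [leRHS]/Num.Def.normr /= mx_normrE; exact: (le_bigmax _ _ (i, j)).
Qed.

Lemma nsq_le_norm n (x : 'cV[R]_n) : nsq x <= n%:R * `|x| ^+ 2.
Proof.
rewrite nsqE (le_trans (ler_sum _ (G := fun=> `|x| ^+ 2) _)) // => [i _|].
  by rewrite -real_normK ?num_real // lerXn2r ?nnegrE // coord_le_norm.
by rewrite sumr_const card_ord mulr_natl.
Qed.

Lemma nsq_eq0 n (x : 'cV[R]_n) : nsq x = 0 -> x = 0.
Proof.
move=> x0; apply/normr0_eq0/eqP; rewrite -sqrf_eq0 eq_le sqr_ge0 andbT -x0.
exact: norm_le_nsq.
Qed.

Lemma dot_sqr_le n (x y : 'cV[R]_n) : dot x y ^+ 2 <= nsq x * nsq y.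
Proof.
have [/nsq_eq0 ->|x0] := eqVneq (nsq x) 0.
  by rewrite nsq0 -(scale0r 0) dotZl !mul0r expr0n.
have xp : 0 < nsq x by rewrite lt_neqAle eq_sym x0 nsq_ge0.
have := nsq_ge0 (dot x y *: x - nsq x *: y).
rewrite nsqB !nsqZ dotZl dotZr => H.
have H2 : 0 <= nsq x * (nsq x * nsq y - dot x y ^+ 2) by nra.
by rewrite pmulr_rge0 // subr_ge0 in H2.
Qed.

Lemma nsq_mulmx n m (M : 'M[R]_(m, n)) (x : 'cV[R]_n) :
  nsq (M *m x) <= (\sum_i \sum_j M i j ^+ 2) * nsq x.
Proof.
rewrite nsqE mulr_suml; apply: ler_sum => i _.
have := dot_sqr_le (row i M)^T x.
have -> : dot (row i M)^T x = (M *m x) i 0.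
  by rewrite mxE; apply: eq_bigr => j _; rewrite !mxE.
by rewrite nsqE; under eq_bigr do rewrite !mxE.
Qed.

Lemma nsq_mulmx_bound n m (M : 'M[R]_(m, n)) :
  exists2 C : R, 0 < C & forall x, nsq (M *m x) <= C * nsq x.
Proof.
exists (\sum_i \sum_j M i j ^+ 2 + 1) => [|x].
  by rewrite ltr_wpDl // sumr_ge0 // => i _; rewrite sumr_ge0 // => j _;
     rewrite sqr_ge0.
apply: le_trans (nsq_mulmx M x) _.
by rewrite ler_wpM2r ?nsq_ge0 // lerDl.
Qed.

End Euclid.

Section Curves.
Variable R : realType.

Lemma is_derive_mxP m n (M : R -> 'M[R]_(m, n)) (t : R) (D : 'M[R]_(m, n)) :
  is_derive t 1 M D <-> forall i j, is_derive t 1 (fun s => M s i j) (D i j).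
Proof.
split=> [[dM MD] i j|H].
  have H := (derivable_mxP M t 1).1 dM.
  apply: DeriveDef => //; move: MD; rewrite derive_mx // => /matrixP /(_ i j).
  by rewrite mxE.
have dM : derivable M t 1 by apply/derivable_mxP => i j; case: (H i j).
apply: DeriveDef => //; rewrite derive_mx //; apply/matrixP => i j.
by rewrite mxE; case: (H i j).
Qed.

Lemma is_derive_fsum n (f : 'I_n -> R -> R) (t : R) (df : 'I_n -> R) :
  (forall i, is_derive t 1 (f i) (df i)) ->
  is_derive t 1 (fun s => \sum_i f i s) (\sum_i df i).
Proof.
move=> H; rewrite (_ : (fun s => _) = \sum_i f i); first exact: is_derive_sum.
by apply/funext => s; rewrite fct_sumE.
Qed.

Lemma is_derive_mulmx p m n (M : R -> 'M[R]_(p, m)) (N : R -> 'M[R]_(m, n))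
  (t : R) dM dN : is_derive t 1 M dM -> is_derive t 1 N dN ->
  is_derive t 1 (fun s => M s *m N s) (dM *m N t + M t *m dN).
Proof.
move=> /is_derive_mxP HM /is_derive_mxP HN; apply/is_derive_mxP => i j.
rewrite (_ : (fun s => _) = (fun s => \sum_k M s i k * N s k j)); last first.
  by apply/funext => s; rewrite mxE.
rewrite !mxE -big_split /=; apply: is_derive_fsum => k.
have H1 := HM i k; have H2 := HN k j.
by apply: is_derive_eq; rewrite /GRing.scale /=; ring.
Qed.

Lemma is_derive_mulmxr p m n (A : 'M[R]_(p, m)) (N : R -> 'M[R]_(m, n))
  (t : R) dN : is_derive t 1 N dN ->
  is_derive t 1 (fun s => A *m N s) (A *m dN).
Proof.
move=> H; rewrite -[X in is_derive _ _ _ X]add0r -(mul0mx _ (N t)).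
exact: is_derive_mulmx.
Qed.

Lemma is_derive_usubmx (d k : nat) (z : R -> 'cV[R]_(d + k)) (t : R) dz :
  is_derive t 1 z dz -> is_derive t 1 (fun s => usubmx (z s)) (usubmx dz).
Proof.
move=> /is_derive_mxP H; apply/is_derive_mxP => i j.
rewrite mxE (_ : (fun s => _) = (fun s => z s (lshift k i) j)) //.
by apply/funext => s; rewrite mxE.
Qed.

Lemma is_derive_dsubmx (d k : nat) (z : R -> 'cV[R]_(d + k)) (t : R) dz :
  is_derive t 1 z dz -> is_derive t 1 (fun s => dsubmx (z s)) (dsubmx dz).
Proof.
move=> /is_derive_mxP H; apply/is_derive_mxP => i j.
rewrite mxE (_ : (fun s => _) = (fun s => z s (rshift d i) j)) //.
by apply/funext => s; rewrite mxE.
Qed.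

Lemma is_derive_nsq n (z : R -> 'cV[R]_n) (t : R) dz :
  is_derive t 1 z dz -> is_derive t 1 (fun s => nsq (z s)) (2 * dot (z t) dz).
Proof.
move=> /is_derive_mxP H; rewrite /nsq /dot mulr_sumr.
apply: is_derive_fsum => i; have H1 := H i 0.
by apply: is_derive_eq; rewrite /GRing.scale /=; ring.
Qed.

Lemma is_derive_nsqJ m n (J : 'M[R]_(m, n)) (z : R -> 'cV[R]_n) (t : R) dz :
  is_derive t 1 z dz ->
  is_derive t 1 (fun s => nsq (J *m z s)) (2 * dot (J *m z t) (J *m dz)).
Proof. by move=> H; apply: is_derive_nsq; apply: is_derive_mulmxr. Qed.

Lemma is_derive_cont (V : normedModType R) (z : R -> V) (t : R) (dz : V) :
  is_derive t 1 z dz -> {for t, continuous z}.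
Proof.
by case=> dzt _; apply: differentiable_continuous; apply/derivable1_diffP.
Qed.

Lemma is_derive_continuous (V : normedModType R) (z dz : R -> V) :
  (forall t : R, is_derive t 1 z (dz t)) -> continuous z.
Proof. by move=> H t; exact: is_derive_cont (H t). Qed.

Lemma cvg_fsum (T : Type) (F : set_system T) (FF : Filter F) n
  (f : 'I_n -> T -> R) (l : 'I_n -> R) :
  (forall i, f i @ F --> l i) -> (fun x => \sum_i f i x) @ F --> \sum_i l i.
Proof.
move=> H; rewrite (_ : (fun x => _) = \sum_i f i).
  elim/big_ind2 : _ => //; first exact: cvg_cst.
  by move=> ? ? ? ? ? ?; exact: cvgD.
by apply/funext => s; rewrite fct_sumE.
Qed.

Lemma nsq_continuous n : continuous (@nsq R n).
Proof.
move=> x; rewrite /continuous_at /nsq /dot; apply: (@cvg_fsum _ (nbhs x) _) => i.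
by apply: cvgM; exact: coord_continuous.
Qed.

Lemma cvg_mxP (T : Type) (F : set_system T) (FF : Filter F) m n
  (f : T -> 'M[R]_(m, n)) (l : 'M[R]_(m, n)) :
  f @ F --> l <-> forall i j, (fun x => f x i j) @ F --> l i j.
Proof.
split=> [fl i j|H].
  exact: (@continuous_cvg _ _ _ F FF f (fun M : 'M[R]_(m, n) => M i j) l (@coord_continuous _ _ _ i j l) fl).
apply/cvgrPdist_le => e e0; near=> x.
rewrite [leLHS]/Num.Def.normr/= mx_normrE (bigmax_le _ (ltW e0))//= => ij _.
rewrite !mxE; move: ij; near: x; apply: filter_forall => /= ij.
exact: ((cvgrPdist_le _ _).1 (H ij.1 ij.2)).
Unshelve. all: by end_near. Qed.

Lemma cvg_mulmx (T : Type) (F : set_system T) (FF : Filter F) m n p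
  (f : T -> 'M[R]_(m, n)) (g : T -> 'M[R]_(n, p)) (a : 'M[R]_(m, n)) (b : 'M[R]_(n, p)) :
  f @ F --> a -> g @ F --> b -> (fun x => f x *m g x) @ F --> a *m b.
Proof.
move=> /cvg_mxP fa /cvg_mxP gb; apply/cvg_mxP => i j.
rewrite mxE (_ : (fun x => _) = (fun x => \sum_k f x i k * g x k j)); last first.
  by apply/funext => x; rewrite mxE.
by apply: cvg_fsum => k; apply: cvgM.
Qed.

Lemma mulmx_continuous m n p (M : 'M[R]_(m, n)) :
  continuous (fun x : 'M[R]_(n, p) => M *m x).
Proof. by move=> x; apply: (@cvg_mulmx _ (nbhs x) _ _ _ _ (fun=> M) id M x); [exact: cvg_cst|exact: cvg_id]. Qed.

Lemma usubmx_continuous m n p :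
  continuous (fun x : 'M[R]_(m + n, p) => usubmx x).
Proof.
move=> x; apply/(@cvg_mxP _ (nbhs x) _) => i j; rewrite mxE.
rewrite (_ : (fun y => _) = (fun y : 'M[R]_(m + n, p) => y (lshift n i) j)).
  exact: coord_continuous.
by apply/funext => y; rewrite mxE.
Qed.

Lemma dsubmx_continuous m n p :
  continuous (fun x : 'M[R]_(m + n, p) => dsubmx x).
Proof.
move=> x; apply/(@cvg_mxP _ (nbhs x) _) => i j; rewrite mxE.
rewrite (_ : (fun y => _) = (fun y : 'M[R]_(m + n, p) => y (rshift m i) j)).
  exact: coord_continuous.
by apply/funext => y; rewrite mxE.
Qed.

(** The function [expR (c * t) * y t] is nonincreasing, for either sign of [c]. Derivatives are
    required only inside the interval because a forward flow has merely a one-sided meaning at time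
    0. *)
Lemma gronwall (c : R) (y dy : R -> R) (a b : R) : a <= b ->
  {within `[a, b], continuous y} ->
  (forall t, t \in `]a, b[ -> is_derive t 1 y (dy t)) ->
  (forall t, t \in `]a, b[ -> dy t <= - c * y t) ->
  y b <= expR (- c * (b - a)) * y a.
Proof.
move=> ab yc yd H.
pose w t := expR (c * t) * y t.
have ed (t : R) : is_derive t 1 (fun s => expR (c * s)) (c * expR (c * t)).
  have h : is_derive t (1 : R) (fun s : R => c * s) c.
    by apply: is_derive_eq; rewrite /GRing.scale /=; ring.
  have := is_derive1_comp (is_derive_expR (c * t)) h.
  by rewrite mulrC.
have wd t : t \in `]a, b[ -> is_derive t 1 w (expR (c * t) * (dy t + c * y t)).
  move=> /yd ydt; have edt := ed t.
  by apply: is_derive_eq; rewrite /GRing.scale /=; ring.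
have wc : {within `[a, b], continuous w}.
  move=> t; apply: cvgM; last exact: yc.
  by move: t; apply: continuous_subspaceT => t; exact: is_derive_cont (ed t).
have wba : w b <= w a.
  apply: (ler0_derive1_le_cc _ _ wc); rewrite ?in_itv /= ?lexx ?ab //.
    by move=> t /wd[].
  move=> t tab; rewrite derive1E; have [_ ->] := wd _ tab.
  by rewrite pmulr_rle0 ?expR_gt0 // -subr_ge0; have := H _ tab; lra.
rewrite -(ler_pM2l (expR_gt0 (c * b))) mulrA -expRD.
by rewrite (_ : c * b + - c * (b - a) = c * a) //; ring.
Qed.

Lemma gronwall_cont (c : R) (y dy : R -> R) (a b : R) : a <= b ->
  (forall t : R, is_derive t 1 y (dy t)) ->
  (forall t, t \in `]a, b[ -> dy t <= - c * y t) ->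
  y b <= expR (- c * (b - a)) * y a.
Proof.
move=> ab yd; apply: gronwall => // ; apply: continuous_subspaceT.
exact: is_derive_continuous yd.
Qed.

End Curves.

(** * Linear differential equations *)

Section Antiderivative.
Variable R : realType.

Lemma is_derive0_cst_itv (f : R -> R) (a b x y : R) :
  (forall t : R, t \in `]a, b[ -> is_derive t 1 f 0) ->
  x \in `]a, b[ -> y \in `]a, b[ -> f x = f y.
Proof.
wlog xy : x y / x <= y => [H fd xab yab|fd].
  have [?|?] := leP x y; first exact: H.
  by apply/esym; apply: H => //; exact: ltW.
rewrite !in_itv /= => /andP[ax xb] /andP[ay yb].
have sub t : t \in `[x, y] -> t \in `]a, b[.
  rewrite !in_itv /= => /andP[xt ty].
  by rewrite (lt_le_trans ax xt) (le_lt_trans ty yb).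
have fc : {within `[x, y], continuous f}.
  apply: derivable_within_continuous => t /sub /fd fdt.
  by case: fdt.
have [c cxy] := MVT_segment xy (df := fun=> 0) (fun t ht => fd t (sub t (subset_itv_oo_cc ht))) fc.
by rewrite mul0r => /eqP; rewrite subr_eq0 eq_sym => /eqP.
Qed.

(** The integral from [- n%:R] is a primitive only to the right of its starting point. Normalizing
    these primitives to vanish at 0 makes any two agree on their common range, and they are glued by
    choosing [n] above the absolute value of [t]. *)
Lemma antiderivative (g : R -> R) : continuous g ->
  exists G : R -> R, forall t : R, is_derive t 1 G (g t).
Proof.
move=> gc.
have ig n (u : R) : (@lebesgue_measure R).-integrable `[- n%:R, u] (EFin \o g).
  apply: continuous_compact_integrable; first exact: segment_compact.
  exact: continuous_subspaceT.
have H0 n : exists I : R -> R, forall t : R, - n%:R < t -> is_derive t 1 I (g t).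
  eexists => t nt; have tt1 : t < t + 1 by rewrite ltrDl.
  have := @continuous_FTC1_closed R g (- n%:R) t (t + 1) tt1 (ig _ _) nt (gc t).
  by case=> h1 h2; split; [exact: h1|rewrite -derive1E; exact: h2].
pose I n := projT1 (cid (H0 n)).
have Id n (t : R) : - n%:R < t -> is_derive t 1 (I n) (g t).
  exact: (projT2 (cid (H0 n))).
pose J n t := I n t - I n 0.
have Jd n (t : R) : - n%:R < t -> is_derive t 1 (J n) (g t).
  move=> /Id h; rewrite -[X in is_derive _ _ _ X]subr0.
  exact: is_deriveB.
have JJ n m (t : R) : - n%:R < t -> - m%:R < t -> (0 < n)%N -> (0 < m)%N ->
    J n t = J m t.
  move=> nt mt n0 m0; apply/eqP; rewrite -subr_eq0; apply/eqP.
  pose a := Num.max (- n%:R) (- m%:R) : R.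
  have E := @is_derive0_cst_itv (fun s => J n s - J m s) a (`|t| + 1) t 0.
  rewrite (_ : J n t - J m t = J n 0 - J m 0); first by rewrite /J !subrr.
  apply: E.
  - move=> s; rewrite in_itv /= gt_max => /andP[/andP[h1 h2] _].
    rewrite -(subrr (g s)); apply: is_deriveB; exact: Jd.
  - by rewrite in_itv /= gt_max nt mt /= ltr_pwDr // ler_norm.
  - by rewrite in_itv /= gt_max !oppr_lt0 !ltr0n n0 m0 /= ltr_wpDl.
pose N (t : R) := (Num.truncn `|t|).+1.
have NP t : - (N t)%:R < t.
  by rewrite ltrNl (le_lt_trans (ler_norm _)) // normrN truncnS_gt.
exists (fun t => J (N t) t) => t.
have tN2 : - (N t).+1%:R < t.
  by rewrite (lt_trans _ (NP t)) // ltrN2 ltr_nat.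
apply: (@near_eq_is_derive _ _ _ (J (N t).+1)); last exact: Jd.
near=> s; apply: JJ => //.
near: s; exact: lt_nbhsr.
Unshelve. all: by end_near. Qed.

Lemma antiderivative_mx m n (g : R -> 'M[R]_(m, n)) : continuous g ->
  exists G : R -> 'M[R]_(m, n), forall t : R, is_derive t 1 G (g t).
Proof.
move=> gc.
have H i j : exists G : R -> R, forall t : R, is_derive t 1 G (g t i j).
  apply: antiderivative => t.
  by have /(@cvg_mxP _ _ (nbhs t) _) /(_ i j) := gc t.
exists (fun t => \matrix_(i, j) projT1 (cid (H i j)) t) => t.
apply/is_derive_mxP => i j; have h := projT2 (cid (H i j)) t.
rewrite (_ : (fun s => _) = projT1 (cid (H i j))) //.
by apply/funext => s; rewrite mxE.
Qed.

End Antiderivative.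

(** * The matrix exponential *)

Section MatrixExponential.
Variables (R : realType) (p : nat).
Implicit Types (M : 'M[R]_p) (t s : R).

Let coef M (i j : 'I_p) (k : nat) : R := (M ^+ k) i j / k`!%:R.

Lemma norm_mulmx_le m n q (A : 'M[R]_(m, n)) (B : 'M[R]_(n, q)) :
  `|A *m B| <= n%:R * `|A| * `|B|.
Proof.
rewrite [leLHS]/Num.Def.normr /= mx_normrE bigmax_le ?mulr_ge0 // => -[i j] _ /=.
rewrite mxE; apply: le_trans (ler_norm_sum _ _ _) _.
apply: (@le_trans _ _ (\sum_(k < n) `|A| * `|B|)).
  apply: ler_sum => k _; by rewrite normrM ler_pM // coord_le_norm.
by rewrite sumr_const card_ord -mulrA mulr_natl.
Qed.

Lemma norm_expmx_le M k : `|M ^+ k| <= (1 + p%:R * `|M|) ^+ k.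
Proof.
elim: k => [|k IH].
  rewrite !expr0 [leLHS]/Num.Def.normr /= mx_normrE bigmax_le // => -[i j] _ /=.
  by rewrite mxE; case: (i == j); rewrite ?normr1 ?normr0.
rewrite !exprS (le_trans (norm_mulmx_le _ _)) // ler_pM ?mulr_ge0 //.
by rewrite lerDr.
Qed.

(** Comparison with the exponential series at [K] times the absolute value of [x]. Bounds of this
    shape survive formal differentiation, with [B] replaced by [B * K]. *)
Lemma cvg_pseries_fact (c : nat -> R) (B K x : R) : 0 <= B -> 0 <= K ->
  (forall k, `|c k| <= B * K ^+ k / k`!%:R) -> cvgn (pseries c x).
Proof.
move=> B0 K0 Hc; apply: normed_cvg.
apply: (@series_le_cvg _ _ (fun k => B * exp_coeff (K * `|x|) k)).
- by move=> k; exact: normr_ge0.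
- by move=> k /=; rewrite mulr_ge0 ?exp_coeff_ge0 ?mulr_ge0.
- move=> k; rewrite [leLHS](_ : _ = `|c k * x ^+ k|) // normrM normrX /exp_coeff /= exprMn.
  rewrite (le_trans (ler_wpM2r _ (Hc k))) ?exprn_ge0 //.
  by rewrite le_eqVlt; apply/orP; left; apply/eqP; ring.
- apply: (@is_cvg_seriesZ _ (exp_coeff (K * `|x|)) B).
  exact: is_cvg_series_exp_coeff.
Qed.

Lemma pseries_diffs_fact (c : nat -> R) (B K : R) :
  (forall k, `|c k| <= B * K ^+ k / k`!%:R) ->
  (forall k, `|pseries_diffs c k| <= (B * K) * K ^+ k / k`!%:R).
Proof.
move=> Hc k; rewrite /pseries_diffs normrM ger0_norm //.
apply: le_trans (ler_wpM2l _ (Hc k.+1)) _ => //.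
rewrite exprS factS natrM le_eqVlt; apply/orP; left; apply/eqP; field.
by rewrite nat1r !pnatr_eq0 -lt0n fact_gt0.
Qed.

Let coef_le M i j k : `|coef M i j k| <= 1 * (1 + p%:R * `|M|) ^+ k / k`!%:R.
Proof.
rewrite mul1r normrM normfV [`|_%:R|]ger0_norm // ler_wpM2r ?invr_ge0 //.
exact: le_trans (coord_le_norm _ _ _) (norm_expmx_le _ _).
Qed.

Let K_ge0 M : 0 <= 1 + p%:R * `|M|.
Proof. by rewrite addr_ge0 // mulr_ge0. Qed.

Let S M t i j := limn (pseries (coef M i j) t).

Let cvg_coef M i j t : cvgn (pseries (coef M i j) t).
Proof. exact: cvg_pseries_fact (K_ge0 M) (coef_le M i j). Qed.

Lemma expmxZ t M k : (t *: M) ^+ k = t ^+ k *: M ^+ k.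
Proof.
elim: k => [|k IH]; first by rewrite !expr0 scale1r.
by rewrite !exprS IH -!mulmxE -scalemxAl -scalemxAr scalerA.
Qed.

Let cvg_f M i j t : (fun n => series (fun j : nat => (j`!%:R)^-1 *: (t *: M) ^+ j) n i j)
  @ \oo --> S M t i j.
Proof.
rewrite (_ : (fun x => _) = pseries (coef M i j) t); first exact: cvg_coef.
apply/funext => n; rewrite /series /= summxE; apply: eq_bigr => k _.
rewrite expmxZ !mxE /coef /=; ring.
Qed.

(** Entry by entry the exponential is a scalar power series in [t], which reduces its derivative to
    termwise differentiation. *)
Lemma mexp_scaleE M t : mexp (t *: M) = \matrix_(i, j) S M t i j.
Proof.
by apply/cvg_lim => //; apply/cvg_mxP => i j; rewrite mxE; exact: cvg_f.
Qed.

Lemma is_derive_mexp M t :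
  is_derive t 1 (fun s => mexp (s *: M)) (M *m mexp (t *: M)).
Proof.
rewrite (_ : (fun s => _) = (fun s => \matrix_(i, j) S M s i j)); last first.
  by apply/funext => s; exact: mexp_scaleE.
apply/is_derive_mxP => i j.
rewrite (_ : (fun s => _) = (fun s => limn (pseries (coef M i j) s))); last first.
  by apply/funext => s; rewrite mxE.
(* Termwise differentiation asks that the series and its first two formal derivatives converge at a
   point of larger modulus than [t]; the modulus of [t] plus 1 is taken. *)
have H1 := pseries_diffs_fact (coef_le M i j).
have H2 := pseries_diffs_fact H1.
have K1 : 0 <= 1 * (1 + p%:R * `|M|) by rewrite mul1r.
have K2 := mulr_ge0 K1 (K_ge0 M).
have := @pseries_snd_diffs R (coef M i j) (`|t| + 1) t (@cvg_coef M i j _)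
  (@cvg_pseries_fact _ _ _ _ K1 (K_ge0 M) H1)
  (@cvg_pseries_fact _ _ _ _ K2 (K_ge0 M) H2).
have -> : `|t| < `| `|t| + 1 |.
  by rewrite [`|_ + 1|]ger0_norm ?addr_ge0 // ltrDl.
move=> /(_ isT); set L := limn _; rewrite (_ : (M *m _) i j = L) //.
apply/esym/cvg_lim => //; rewrite mexp_scaleE mxE.
rewrite (_ : pseries _ t = (fun n => \sum_l M i l * pseries (coef M l j) t n)).
  apply: cvg_fsum => l; rewrite mxE; apply: cvgM; first exact: cvg_cst.
  exact: cvg_coef.
apply/funext => n; rewrite /pseries /series /=.
under eq_bigr => k _.
  rewrite /pseries_diffs /coef exprS mxE !mulr_suml mulr_sumr mulr_suml.
  over.
rewrite exchange_big /=; apply: eq_bigr => l _; rewrite mulr_sumr.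
apply: eq_bigr => k _; rewrite /coef factS natrM; field.
by rewrite nat1r !pnatr_eq0 -lt0n fact_gt0.
Qed.

Lemma mexp0 : mexp (0 : 'M[R]_p) = 1%:M.
Proof.
rewrite -(scale0r 0); apply/cvg_lim => //; apply/cvg_mxP => i j.
apply: cvg_near_cst.
near=> n; rewrite /series /=.
have n0 : (0 < n)%N by near: n; exact: nbhs_infty_gt.
rewrite -(prednK n0) big_nat_recl // expr0 fact0 invr1 scale1r big1 ?addr0 ?add0r//.
by move=> k _; rewrite scale0r exprS mul0r scaler0.
Unshelve. all: by end_near. Qed.

Lemma mexp_comm M t : M *m mexp (t *: M) = mexp (t *: M) *m M.
Proof.
pose f n := series (fun j : nat => (j`!%:R)^-1 *: (t *: M) ^+ j) n.
have fc : f @ \oo --> mexp (t *: M).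
  rewrite mexp_scaleE; apply/cvg_mxP => i j; rewrite mxE; exact: cvg_f.
have h1 := @cvg_mulmx R _ _ _ _ _ _ (fun=> M) f M _ (cvg_cst _) fc.
have h2 := @cvg_mulmx R _ _ _ _ _ _ f (fun=> M) _ M fc (cvg_cst _).
have E : (fun n => M *m f n) = (fun n => f n *m M); last first.
  by rewrite -(cvg_lim _ (h1 _ _)) // -(cvg_lim _ (h2 _ _)) // E.
apply/funext => n.
rewrite /f /series /= mulmx_sumr mulmx_suml; apply: eq_bigr => k _.
by rewrite expmxZ -!scalemxAl -!scalemxAr !mulmxE -exprS -exprSr.
Qed.

(** The product has derivative 0 because [M] commutes with its exponential, and it equals the
    identity at time 0. *)
Lemma mexpNK M t : mexp (- t *: M) *m mexp (t *: M) = 1%:M.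
Proof.
have d1 (s : R) : is_derive s 1 (fun s => mexp (- s *: M)) (- (M *m mexp (- s *: M))).
  rewrite (_ : (fun s => _) = (fun s => mexp (s *: - M))); last first.
    by apply/funext => x; rewrite scalerN scaleNr.
  rewrite -mulNmx scaleNr -scalerN; exact: is_derive_mexp.
have d (s : R) : is_derive s 1
    (fun s => mexp (- s *: M) *m mexp (s *: M)) 0.
  have d2 := is_derive_mexp M s.
  have := is_derive_mulmx (d1 s) d2.
  by rewrite mulmxA -(mexp_comm M (- s)) mulNmx addNr.
apply/matrixP => i j.
have := @is_derive0_cst_itv R (fun s => (mexp (- s *: M) *m mexp (s *: M)) i j)
   (- `|t| - 1) (`|t| + 1) t 0.
rewrite oppr0 !scale0r mexp0 mul1mx; apply.
- by move=> s _; have /is_derive_mxP /(_ i j) := d s; rewrite mxE.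
- have := ler_norm t; have := ler_norm (- t); rewrite normrN in_itv /=; lra.
- have := normr_ge0 t; rewrite in_itv /=; lra.
Qed.

End MatrixExponential.

Section CauchySequences.
Variable R : realType.

Lemma cvg_geometric_expr (B q : R) : 0 <= q -> q < 1 ->
  (fun n => B * q ^+ n) @ \oo --> (0 : R).
Proof.
move=> q0 q1; rewrite -(mulr0 B); apply: cvgM; first exact: cvg_cst.
by apply: cvg_expr; rewrite ger0_norm.
Qed.

Lemma nsq_cauchy n (c : nat -> 'cV[R]_n) (B q : R) : 0 <= q -> q < 1 ->
  (forall i j, (i <= j)%N -> nsq (c i - c j) <= B * q ^+ i) ->
  exists l : 'cV[R]_n, c @ \oo --> l /\ forall i, nsq (c i - l) <= B * q ^+ i.
Proof.
move=> q0 q1 H.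
have cc : cvg (c @ \oo).
  apply/cauchy_cvgP/cauchy_exP => e e0.
  have e2 : 0 < e ^+ 2 by rewrite exprn_gt0.
  have [N _ HN] := (cvgr_lt _ (cvg_geometric_expr B q0 q1) _ e2).
  exists (c N), N => // j /= Nj.
  rewrite -ball_normE /=.
  have h : `|c N - c j| ^+ 2 < e ^+ 2.
    apply: le_lt_trans (norm_le_nsq _) _.
    apply: le_lt_trans (H _ _ Nj) _; exact: (HN N (leqnn N)).
  by move: h; rewrite ltr_pXn2r ?nnegrE ?normr_ge0 // ltW.
pose l : 'cV[R]_n := lim (c @ \oo).
have cl : c @ \oo --> l by exact: cc.
exists l; split=> // i.
have h : (fun j => nsq (c i - c j)) @ \oo --> nsq (c i - l).
  apply: (@continuous_cvg _ _ _ _ _ (fun j => c i - c j) (@nsq R n)).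
    exact: nsq_continuous.
  by apply: cvgB => //; exact: cvg_cst.
apply: (ler_cvg_to h (cvg_cst (B * q ^+ i))).
by exists i => // j /= ij; exact: H.
Qed.

Lemma left_inverse_bound m n (J : 'M[R]_(m, n)) (J' : 'M[R]_(n, m)) :
  J' *m J = 1%:M ->
  exists2 C : R, 0 < C & forall x : 'cV[R]_n, nsq x <= C * nsq (J *m x).
Proof.
move=> J'J; have [C C0 HC] := nsq_mulmx_bound J'.
by exists C => // x; rewrite -[x in leLHS]mul1mx -J'J -mulmxA.
Qed.

End CauchySequences.

(** * Weighted energy estimates for linear equations *)

Section Energy.
Variables (R : realType) (m p : nat) (J : 'M[R]_(m, p)) (L : 'M[R]_p).
Implicit Types (v g : R -> 'cV[R]_p).

Let Y v t := nsq (J *m v t).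

Lemma is_derive_expRM (c t : R) :
  is_derive t 1 (fun s => expR (c * s)) (c * expR (c * t)).
Proof.
have h : is_derive t (1 : R) (fun s : R => c * s) c.
  by apply: is_derive_eq; rewrite /GRing.scale /=; ring.
have := is_derive1_comp (is_derive_expR (c * t)) h.
by rewrite mulrC.
Qed.

(** [K / (be - ga) ^+ 2] times the weight is a stationary profile: Young's inequality with
    [c := be - ga] bounds the derivative of the excess over it by [- (be + ga)] times the excess,
    since [(be - ga) + 2 * ga = be + ga]. *)
Lemma energy_forward (be ga K s t : R) v g :
  (forall x, dot (J *m x) (J *m (L *m x)) <= - be * nsq (J *m x)) ->
  ga < be -> s <= t ->
  (forall u : R, is_derive u 1 v (L *m v u + g u)) ->
  (forall u, u \in `]s, t[ -> nsq (J *m g u) <= K * expR (- 2 * ga * u)) ->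
  nsq (J *m v t) <= K / (be - ga) ^+ 2 * expR (- 2 * ga * t)
    + expR (- (be + ga) * (t - s)) *
      (nsq (J *m v s) - K / (be - ga) ^+ 2 * expR (- 2 * ga * s)).
Proof.
move=> hL gabe st vd gK.
set B := K / (be - ga) ^+ 2.
have bg : 0 < be - ga by rewrite subr_gt0.
pose D u := nsq (J *m v u) - B * expR (- 2 * ga * u).
pose dD u := 2 * dot (J *m v u) (J *m (L *m v u + g u))
  + B * (2 * ga) * expR (- 2 * ga * u).
have Dd (u : R) : is_derive u 1 D (dD u).
  have h1 := is_derive_nsqJ J (vd u).
  have h2 := is_derive_expRM (- 2 * ga) u.
  by apply: is_derive_eq; rewrite /dD /GRing.scale /=; ring.
have := @gronwall_cont R (be + ga) D dD s t st Dd.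
rewrite /D => H; suff : forall u, u \in `]s, t[ -> dD u <= - (be + ga) * D u.
  by move=> /H; rewrite lerBlDl.
move=> u ust; rewrite /dD /D mulmxDr dotDr.
have h1 := hL (v u).
have h2 := young (J *m v u) (J *m g u) bg.
have h3 := gK _ ust.
have h4 : nsq (J *m g u) / (be - ga) <= (be - ga) * B * expR (- 2 * ga * u).
  rewrite ler_pdivrMr // (le_trans h3) // le_eqVlt; apply/orP; left; apply/eqP.
  by rewrite /B; field; rewrite gt_eqF.
have := expR_gt0 (- 2 * ga * u).
set e := expR _ in h4 *; set Q := nsq _ in h1 h2 *.
nra.
Qed.

(** Mirror image of [energy_forward]: the lower bound [- al] limits how fast a solution can decay
    forwards, hence grow backwards. Gronwall is applied to the profile minus the energy, so that the
    inequality from [t] to [s] bounds the earlier value by the later one. *)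
Lemma energy_backward (al ga K s t : R) v g :
  (forall x, - al * nsq (J *m x) <= dot (J *m x) (J *m (L *m x))) ->
  al < ga -> t <= s ->
  (forall u : R, is_derive u 1 v (L *m v u + g u)) ->
  (forall u, u \in `]t, s[ -> nsq (J *m g u) <= K * expR (- 2 * ga * u)) ->
  nsq (J *m v t) <= K / (ga - al) ^+ 2 * expR (- 2 * ga * t)
    + expR ((al + ga) * (s - t)) *
      (nsq (J *m v s) - K / (ga - al) ^+ 2 * expR (- 2 * ga * s)).
Proof.
move=> hL gabe st vd gK.
set B := K / (ga - al) ^+ 2.
have bg : 0 < ga - al by rewrite subr_gt0.
pose D u := B * expR (- 2 * ga * u) - nsq (J *m v u).
pose dD u := - (2 * dot (J *m v u) (J *m (L *m v u + g u))
  + B * (2 * ga) * expR (- 2 * ga * u)).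
have Dd (u : R) : is_derive u 1 D (dD u).
  have h1 := is_derive_nsqJ J (vd u).
  have h2 := is_derive_expRM (- 2 * ga) u.
  by apply: is_derive_eq; rewrite /dD /GRing.scale /=; ring.
have := @gronwall_cont R (al + ga) D dD t s st Dd.
rewrite /D => H; suff : forall u, u \in `]t, s[ -> dD u <= - (al + ga) * D u.
  move=> /H.
  rewrite [- (al + ga) * _]mulNr expRN [X in _ <= X]mulrC ler_pdivlMr ?expR_gt0 // => h; lra.
move=> u ust; rewrite /dD /D mulmxDr dotDr.
have h1 := hL (v u).
have h2 := youngN (J *m v u) (J *m g u) bg.
have h3 := gK _ ust.
have h4 : nsq (J *m g u) / (ga - al) <= (ga - al) * B * expR (- 2 * ga * u).
  rewrite ler_pdivrMr // (le_trans h3) // le_eqVlt; apply/orP; left; apply/eqP.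
  by rewrite /B; field; rewrite gt_eqF.
have := expR_gt0 (- 2 * ga * u).
set e := expR _ in h4 *; set Q := nsq _ in h1 h2 *.
nra.
Qed.

End Energy.

Section LinearODE.
Variables (R : realType) (p : nat) (L : 'M[R]_p) (g : R -> 'cV[R]_p).
Hypothesis gc : continuous g.

(** Variation of constants. The last clause, a solution vanishing at a prescribed time, supplies the
    approximations used in [bounded_solution]. *)
Lemma linear_ode : exists Z : 'cV[R]_p -> R -> 'cV[R]_p,
  [/\ forall c (t : R), is_derive t 1 (Z c) (L *m Z c t + g t),
      forall c c' t, Z c t - Z c' t = mexp (t *: L) *m (c - c'),
      forall c, Z c 0 = c
    & forall t, exists c, Z c t = 0].
Proof.
have mc : continuous (fun t : R => mexp (- t *: L) *m g t).
  move=> t; apply: cvg_mulmx; last exact: gc.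
  have d (s : R) : is_derive s 1 (fun s => mexp (s *: - L)) (- L *m mexp (s *: - L)).
    exact: is_derive_mexp.
  rewrite (_ : (fun t : R => mexp (- t *: L)) = (fun s => mexp (s *: - L))).
    rewrite (_ : mexp (- t *: L) = mexp (t *: - L)); last by rewrite scalerN scaleNr.
    exact: is_derive_cont (d t).
  by apply/funext => x; rewrite scalerN scaleNr.
have [G Gd] := antiderivative_mx mc.
pose G0 t := G t - G 0.
exists (fun c t => mexp (t *: L) *m (c + G0 t)); split.
- move=> c t.
  have h1 := is_derive_mexp L t.
  have h2 : is_derive t (1 : R) (fun s => c + G0 s) (mexp (- t *: L) *m g t).
    have h := Gd t; rewrite (_ : (fun s => _) = (fun s => G s - (G 0 - c))).
      rewrite -[X in is_derive _ _ _ X]subr0; exact: is_deriveB.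
    by apply/funext => s; rewrite /G0 opprB addrCA addrC.
  have := is_derive_mulmx h1 h2.
  rewrite !mulmxA; have := mexpNK L (- t); rewrite opprK => ->.
  by rewrite mul1mx.
- by move=> c c' t; rewrite -mulmxBr; congr (_ *m _); rewrite opprD addrACA subrr addr0.
- by move=> c; rewrite scale0r mexp0 mul1mx /G0 subrr addr0.
- by move=> t; exists (- G0 t); rewrite addNr mulmx0.
Qed.

End LinearODE.

Section BoundedSolutions.
Variables (R : realType) (m p : nat) (J : 'M[R]_(m, p)) (J' : 'M[R]_(p, m)).
Variables (L : 'M[R]_p) (be ga : R).
Hypothesis J'J : J' *m J = 1%:M.
Hypothesis hL : forall x, dot (J *m x) (J *m (L *m x)) <= - be * nsq (J *m x).
Hypothesis gabe : ga < be.

(* v is the limit of the solutions that vanish at the times - n. *)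
Lemma bounded_solution (g : R -> 'cV[R]_p) (K : R) : 0 <= K ->
  continuous g ->
  (forall t, t <= 0 -> nsq (J *m g t) <= K * expR (- 2 * ga * t)) ->
  exists v : R -> 'cV[R]_p,
    (forall t : R, is_derive t 1 v (L *m v t + g t)) /\
    (forall t, t <= 0 ->
       nsq (J *m v t) <= K / (be - ga) ^+ 2 * expR (- 2 * ga * t)).
Proof.
move=> K0 gc gK.
have [Z [Zd ZB Z0 Zc]] := linear_ode L gc.
set B := K / (be - ga) ^+ 2.
have bg : 0 < be - ga by rewrite subr_gt0.
have B0 : 0 <= B by rewrite divr_ge0 // exprn_ge0 // ltW.
pose c n := projT1 (cid (Zc (- n%:R))).
have cP n : Z (c n) (- n%:R) = 0 := projT2 (cid (Zc (- n%:R))).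
have bnd n t : - n%:R <= t -> t <= 0 ->
    nsq (J *m Z (c n) t) <= B * expR (- 2 * ga * t).
  move=> nt t0.
  have := energy_forward hL gabe nt (Zd (c n)) (K := K).
  rewrite cP mulmx0 nsq0 sub0r mulrN -/B => H.
  have h : 0 <= expR (- (be + ga) * (t - - n%:R)) * (B * expR (- 2 * ga * - n%:R)).
    apply: mulr_ge0; first exact: expR_ge0.
    by apply: mulr_ge0 => //; exact: expR_ge0.
  apply: le_trans (H _) _; last by lra.
  move=> u; rewrite in_itv /= => /andP[_ ut]; apply: gK; lra.
have [C C0 HC] := left_inverse_bound J'J.
pose q := expR (- (be - ga)).
have q1 : q < 1 by rewrite expR_lt1; lra.
(* At time [- i%:R] the two solutions differ by at most [B] times the weight, one of them being 0
   there. Contraction at rate [be + ga] up to time 0, against a weight of rate [2 * ga], leaves the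
   rate [be - ga]. *)
have cauchy i j : (i <= j)%N -> nsq (c i - c j) <= (C * B) * q ^+ i.
  move=> ij; apply: le_trans (HC _) _; rewrite -mulrA ler_pM2l //.
  have wd t : is_derive t (1 : R) (fun t => Z (c i) t - Z (c j) t)
      (L *m (Z (c i) t - Z (c j) t) + 0).
    rewrite (_ : _ + 0 = (L *m Z (c i) t + g t) - (L *m Z (c j) t + g t)).
      exact: is_deriveB.
    by rewrite addr0 mulmxBr opprD addrACA subrr addr0.
  have i0 : - i%:R <= 0 :> R by rewrite oppr_le0.
  have := energy_forward hL gabe i0 wd (K := 0).
  have -> : Z (c i) (- i%:R) - Z (c j) (- i%:R) = - Z (c j) (- i%:R).
    by rewrite cP sub0r.
  rewrite !mul0r add0r subr0 !Z0 mulmxN nsqN => H.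
  apply: le_trans (H _) _ => [u _|]; first by rewrite mulmx0 nsq0 mul0r.
  rewrite opprK [0 + _]add0r.
  apply: le_trans (ler_wpM2l (expR_ge0 _) (bnd j _ _ _)) _ => //.
    by rewrite lerN2 ler_nat.
  rewrite mulrCA -expRD /q -expRM_natl ler_wpM2l // ler_expR.
  by rewrite -mulr_natl; lra.
have [l [cl Hl]] := nsq_cauchy (expR_ge0 _) q1 cauchy.
exists (Z l); split=> [t|t t0]; first exact: Zd.
have cv : (fun n => nsq (J *m Z (c n) t)) @ \oo --> nsq (J *m Z l t).
  have E n : J *m Z (c n) t = J *m (Z l t + mexp (t *: L) *m (c n - l)).
    by congr (_ *m _); rewrite -ZB addrC subrK.
  under eq_fun do rewrite E.
  apply: (@continuous_cvg _ _ _ _ _ _ (@nsq R m)); first exact: nsq_continuous.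
  rewrite -[X in _ --> J *m X]addr0.
  apply: (@cvg_mulmx _ _ \oo _ _ _ _ (fun=> J)); first exact: cvg_cst.
  apply: cvgD; first exact: cvg_cst.
  rewrite -(mulmx0 _ (mexp (t *: L))).
  apply: (@cvg_mulmx _ _ \oo _ _ _ _ (fun=> mexp (t *: L))); first exact: cvg_cst.
  rewrite -(subrr l); apply: cvgB => //; exact: cvg_cst.
apply: (ler_cvg_to cv (cvg_cst (B * expR (- 2 * ga * t)))).
exists (Num.truncn `|t|).+1 => // n /= nt; apply: bnd => //.
rewrite lerNl (le_trans (ler_norm _)) // normrN.
by rewrite (le_trans (ltW (truncnS_gt _))) // ler_nat.
Qed.

End BoundedSolutions.

Section GeometricLimits.
Variable R : realType.

Lemma le_geometric (x a B q : R) : 0 <= q -> q < 1 ->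
  (forall n, x <= a + B * q ^+ n) -> x <= a.
Proof.
move=> q0 q1 H.
have h : (fun n => a + B * q ^+ n) @ \oo --> a + 0.
  by apply: cvgD; [exact: cvg_cst|exact: cvg_geometric_expr].
rewrite -[a]addr0; apply: (ler_cvg_to (cvg_cst x) h).
by exists 0%N => // n _; exact: H.
Qed.

(** [B] may be unbounded on the line; its continuity makes the convergence locally uniform, which is
    all that continuity of the limit needs. *)
Lemma uniform_limit_cV n (f : nat -> R -> 'cV[R]_n) (l : R -> 'cV[R]_n)
  (B : R -> R) (q : R) : 0 <= q -> q < 1 -> (forall i, continuous (f i)) ->
  continuous B -> (forall i t, nsq (f i t - l t) <= B t * q ^+ i) ->
  continuous l.
Proof.
move=> q0 q1 fc Bc H t; apply/cvgrPdist_lt => e e0.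
pose b := `|B t| + 1.
have b0 : 0 < b by rewrite /b ltr_wpDl.
have e3 : 0 < (e / 3) ^+ 2 by rewrite exprn_gt0 // divr_gt0.
have [N _ HN] := (cvgr_lt _ (cvg_geometric_expr b q0 q1) _ e3).
have small s : B s < b -> `|f N s - l s| < e / 3.
  move=> Bs; have h : `|f N s - l s| ^+ 2 < (e / 3) ^+ 2.
    apply: le_lt_trans (norm_le_nsq _) _; apply: le_lt_trans (H _ _) _.
    apply: le_lt_trans (HN N (leqnn N)).
    by rewrite ler_wpM2r ?exprn_ge0 // ltW.
  by move: h; rewrite ltr_pXn2r ?nnegrE ?normr_ge0 // ltW // divr_gt0.
have fN := fc N t.
near=> s.
have -> : l t - l s = (f N s - l s) - (f N t - l t) + (f N t - f N s).
  by apply/matrixP => i j; rewrite !mxE; ring.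
have h1 : `|f N s - l s| < e / 3.
  apply: small; near: s; apply: (cvgr_lt (B t)); first exact: Bc.
  by rewrite /b (le_lt_trans (ler_norm _)) // ltrDl.
have h2 : `|f N t - l t| < e / 3.
  by apply: small; rewrite /b (le_lt_trans (ler_norm _)) // ltrDl.
have h3 : `|f N t - f N s| < e / 3.
  near: s; move/cvgrPdist_lt : fN; apply; exact: divr_gt0.
apply: le_lt_trans (ler_normD _ _) _.
have h4 := ler_normB (f N s - l s) (f N t - l t).
lra.
Unshelve. all: by end_near. Qed.

Lemma is_derive_col_mx d k (u : R -> 'cV[R]_d) (v : R -> 'cV[R]_k) (t : R) du dv :
  is_derive t 1 u du -> is_derive t 1 v dv ->
  is_derive t 1 (fun s => col_mx (u s) (v s)) (col_mx du dv).
Proof.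
move=> /is_derive_mxP hu /is_derive_mxP hv; apply/is_derive_mxP => i j.
case: (split_ordP i) => l ->.
  rewrite col_mxEu (_ : (fun s => _) = fun s => u s l j); first exact: hu.
  by apply/funext => s; rewrite col_mxEu.
rewrite col_mxEd (_ : (fun s => _) = fun s => v s l j); first exact: hv.
by apply/funext => s; rewrite col_mxEd.
Qed.

(* Makes functions on ]-oo, 0] total, so that all derivatives are two-sided. *)
Definition clamp (t : R) : R := (t - `|t|) / 2.

Lemma clamp_le0 t : clamp t <= 0.
Proof. by have := ler_norm t; rewrite /clamp; lra. Qed.

Lemma clamp_id t : t <= 0 -> clamp t = t.
Proof. by move=> t0; rewrite /clamp ler0_norm // opprK; field. Qed.

Lemma clamp_continuous : continuous clamp.
Proof.
move=> t; apply: cvgM; last exact: cvg_cst.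
by apply: cvgB; [exact: cvg_id|apply: cvg_norm; exact: cvg_id].
Qed.

End GeometricLimits.

(** * The Lyapunov-Perron method *)

Section LyapunovPerron.
Variables (R : realType) (d k mE mF : nat).
Variables (JE : 'M[R]_(mE, d)) (JE' : 'M[R]_(d, mE)).
Variables (JF : 'M[R]_(mF, k)) (JF' : 'M[R]_(k, mF)).
Variables (LE : 'M[R]_d) (LF : 'M[R]_k) (al be : R).
Hypotheses (JE'J : JE' *m JE = 1%:M) (JF'J : JF' *m JF = 1%:M).
Hypothesis hE : forall x, - al * nsq (JE *m x) <= dot (JE *m x) (JE *m (LE *m x)).
Hypothesis hF : forall x, dot (JF *m x) (JF *m (LF *m x)) <= - be * nsq (JF *m x).
Local Notation V := 'cV[R]_(d + k).
Implicit Types (z g : R -> V).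

Definition adapted (x : V) : R := nsq (JE *m usubmx x) + nsq (JF *m dsubmx x).
Definition block_lin (x : V) : V := col_mx (LE *m usubmx x) (LF *m dsubmx x).
Local Notation q := adapted.
Local Notation Lam := block_lin.

Lemma adapted_ge0 x : 0 <= q x.
Proof. by rewrite addr_ge0 ?nsq_ge0. Qed.

Lemma nsqE_le_adapted x : nsq (JE *m usubmx x) <= q x.
Proof. by rewrite lerDl nsq_ge0. Qed.

Lemma nsqF_le_adapted x : nsq (JF *m dsubmx x) <= q x.
Proof. by rewrite lerDr nsq_ge0. Qed.

Lemma adaptedD_le x y : q (x + y) <= 2 * q x + 2 * q y.
Proof.
rewrite /adapted !linearD /=.
have h1 := nsqD_le (JE *m usubmx x) (JE *m usubmx y).
have h2 := nsqD_le (JF *m dsubmx x) (JF *m dsubmx y).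
lra.
Qed.

Lemma adaptedZ a x : q (a *: x) = a ^+ 2 * q x.
Proof. by rewrite /adapted !linearZ /= !nsqZ mulrDr. Qed.

Lemma adaptedN x : q (- x) = q x.
Proof. by rewrite -scaleN1r adaptedZ sqrrN expr1n mul1r. Qed.

Lemma adaptedB_le x y : q (x - y) <= 2 * q x + 2 * q y.
Proof. by rewrite -(adaptedN y) adaptedD_le. Qed.

Lemma adapted0 : q 0 = 0.
Proof. by rewrite -(scale0r 0) adaptedZ expr0n mul0r. Qed.

Lemma nsq_le_adapted : exists2 C : R, 0 < C & forall x, nsq x <= C * q x.
Proof.
have [C1 C10 H1] := left_inverse_bound JE'J.
have [C2 C20 H2] := left_inverse_bound JF'J.
exists (C1 + C2) => [|x]; first exact: addr_gt0.
rewrite -[x in leLHS]vsubmxK nsq_col_mx /adapted.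
have := H1 (usubmx x); have := H2 (dsubmx x).
have := nsq_ge0 (JE *m usubmx x); have := nsq_ge0 (JF *m dsubmx x).
nra.
Qed.

Lemma adapted_le_nsq : exists2 C : R, 0 < C & forall x, q x <= C * nsq x.
Proof.
have [C1 C10 H1] := nsq_mulmx_bound JE.
have [C2 C20 H2] := nsq_mulmx_bound JF.
exists (C1 + C2) => [|x]; first exact: addr_gt0.
rewrite -[x in leRHS]vsubmxK nsq_col_mx /adapted.
have := H1 (usubmx x); have := H2 (dsubmx x).
have := nsq_ge0 (usubmx x); have := nsq_ge0 (dsubmx x).
nra.
Qed.

Lemma adapted_eq0 x : q x <= 0 -> x = 0.
Proof.
move=> x0; have [C C0 H] := nsq_le_adapted; apply: nsq_eq0.
apply/eqP; rewrite eq_le nsq_ge0 andbT (le_trans (H x)) //.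
by rewrite pmulr_rle0.
Qed.

Lemma block_linB x y : Lam (x - y) = Lam x - Lam y.
Proof. by rewrite /block_lin opp_col_mx add_col_mx -!mulmxBr -!linearB. Qed.

(* Bounds the squared norm of g |-> z solving z' = Lam z + g, z = O(exp (- ga t)). *)
Definition lp_const (ga : R) : R := (ga - al) ^- 2 + (be - ga) ^- 2.

Lemma split_ode z g (t : R) : is_derive t 1 z (Lam (z t) + g t) ->
  is_derive t 1 (fun s => usubmx (z s)) (LE *m usubmx (z t) + usubmx (g t)) /\
  is_derive t 1 (fun s => dsubmx (z s)) (LF *m dsubmx (z t) + dsubmx (g t)).
Proof.
move=> zd; have := is_derive_usubmx zd; have := is_derive_dsubmx zd.
by rewrite !linearD /= /block_lin col_mxKu col_mxKd.
Qed.

Section Weight.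
Variable ga : R.
Hypotheses (alga : al < ga) (gabe : ga < be).
Local Notation c := (lp_const ga).
Local Notation wt t := (expR (- 2 * ga * t)).

Let ga0 : 0 < ga - al. Proof. by rewrite subr_gt0. Qed.
Let be0 : 0 < be - ga. Proof. by rewrite subr_gt0. Qed.

Lemma lp_const_gt0 : 0 < c.
Proof. by rewrite addr_gt0 // invr_gt0 exprn_gt0. Qed.

Lemma backward_bound (K X t : R) (u : R -> 'cV[R]_d) (g : R -> 'cV[R]_d) :
  0 <= K -> t <= 0 ->
  (forall s : R, is_derive s 1 u (LE *m u s + g s)) ->
  (forall s, s <= 0 -> nsq (JE *m g s) <= K * wt s) ->
  nsq (JE *m u t) <= (nsq (JE *m u 0) + K / (ga - al) ^+ 2) * wt t.
Proof.
move=> K0 t0 ud gK.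
have := energy_backward hE alga t0 ud (K := K).
set B := K / _; rewrite mulr0 expR0 mulr1 sub0r => H.
have B0 : 0 <= B by rewrite divr_ge0 // exprn_ge0 // ltW.
apply: le_trans (H _) _.
  by move=> s; rewrite in_itv /= => /andP[_ st]; apply: gK; exact: ltW.
(* Here [al < ga] enters: for [t <= 0] the free backward growth stays below the weight. *)
have h1 : expR ((al + ga) * - t) <= wt t.
  have t0' : 0 <= - t by rewrite oppr_ge0.
  by rewrite ler_expR; have := mulr_ge0 (ltW ga0) t0'; lra.
have h2 := expR_ge0 ((al + ga) * - t); have h3 := expR_ge0 (- 2 * ga * t).
have h4 := nsq_ge0 (JE *m u 0).
nra.
Qed.

Lemma bounded_lin g (K : R) (u0 : 'cV[R]_d) : 0 <= K -> continuous g ->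
  (forall t, t <= 0 -> q (g t) <= K * wt t) ->
  exists z, [/\ forall t : R, is_derive t 1 z (Lam (z t) + g t),
    usubmx (z 0) = u0 &
    forall t, t <= 0 -> q (z t) <= (nsq (JE *m u0) + c * K) * wt t].
Proof.
move=> K0 gc gK.
have guc : continuous (fun t => usubmx (g t)).
  by move=> t; apply: continuous_cvg; [exact: usubmx_continuous|exact: gc].
have gdc : continuous (fun t => dsubmx (g t)).
  by move=> t; apply: continuous_cvg; [exact: dsubmx_continuous|exact: gc].
have guK t : t <= 0 -> nsq (JE *m usubmx (g t)) <= K * wt t.
  by move=> /gK; apply: le_trans; rewrite lerDl nsq_ge0.
have gdK t : t <= 0 -> nsq (JF *m dsubmx (g t)) <= K * wt t.
  by move=> /gK; apply: le_trans; rewrite lerDr nsq_ge0.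
have [v [vd vK]] := bounded_solution JF'J hF gabe K0 gdc gdK.
have [Z [Zd _ Z0 _]] := linear_ode LE guc.
exists (fun t => col_mx (Z u0 t) (v t)); split.
- move=> t; rewrite /block_lin col_mxKu col_mxKd.
  rewrite -[g t]vsubmxK add_col_mx; exact: is_derive_col_mx.
- by rewrite col_mxKu.
- move=> t t0; rewrite /adapted col_mxKu col_mxKd.
  have := backward_bound 0 K0 t0 (Zd u0) guK; have := vK _ t0.
  rewrite Z0 /lp_const; set e := expR _; set a := nsq _; set b := nsq _.
  set x := nsq _ => h1 h2.
  apply: le_trans (lerD h2 h1) _; rewrite le_eqVlt; apply/orP; left; apply/eqP.
  by field; rewrite !gt_eqF.
Qed.

(** Start the forward estimate at [t - n%:R] and let [n] grow: the contraction [be + ga] beats the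
    growth [2 * ga] of the weight, so the unknown constant [C] disappears. *)
Lemma a_priori_F z g (K C : R) : 0 <= K ->
  (forall t : R, is_derive t 1 z (Lam (z t) + g t)) ->
  (forall t, t <= 0 -> q (g t) <= K * wt t) ->
  (forall t, t <= 0 -> q (z t) <= C * wt t) ->
  forall t, t <= 0 -> nsq (JF *m dsubmx (z t)) <= K / (be - ga) ^+ 2 * wt t.
Proof.
move=> K0 zd gK zC t t0.
have vd (s : R) := (split_ode (zd s)).2.
have q1 : expR (- (be - ga)) < 1 by rewrite expR_lt1 oppr_lt0.
apply: (le_geometric (expR_ge0 _) q1 (B := C * wt t)) => n.
have tn : t - n%:R <= t by rewrite lerBlDr lerDl.
have := energy_forward hF gabe tn vd (K := K); set B := K / _ => H.
have B0 : 0 <= B by rewrite divr_ge0 // exprn_ge0 // ltW.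
apply: le_trans (H _) _.
  move=> s; rewrite in_itv /= => /andP[_ st].
  by apply: le_trans (nsqF_le_adapted _) (gK s _); lra.
rewrite lerD2l opprB addrCA subrr addr0.
have h1 : nsq (JF *m dsubmx (z (t - n%:R))) <= C * wt (t - n%:R).
  by apply: le_trans (nsqF_le_adapted _) (zC (t - n%:R) _); lra.
have h2 : 0 <= B * wt (t - n%:R) by rewrite mulr_ge0 ?expR_ge0.
apply: (@le_trans _ _ (expR (- (be + ga) * n%:R) * (C * wt (t - n%:R)))).
  by rewrite ler_wpM2l ?expR_ge0 //; lra.
rewrite -expRM_natl [leLHS]mulrCA -expRD -[leRHS]mulrA -expRD le_eqVlt.
by apply/orP; left; apply/eqP; congr (_ * expR _); ring.
Qed.

Lemma a_priori_bound z g (K C : R) : 0 <= K ->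
  (forall t : R, is_derive t 1 z (Lam (z t) + g t)) ->
  (forall t, t <= 0 -> q (g t) <= K * wt t) ->
  (forall t, t <= 0 -> q (z t) <= C * wt t) ->
  forall t, t <= 0 -> q (z t) <= (nsq (JE *m usubmx (z 0)) + c * K) * wt t.
Proof.
move=> K0 zd gK zC t t0.
have h1 := a_priori_F K0 zd gK zC t0.
have ud (s : R) := (split_ode (zd s)).1.
have h2 : nsq (JE *m usubmx (z t)) <=
    (nsq (JE *m usubmx (z 0)) + K / (ga - al) ^+ 2) * wt t.
  apply: (backward_bound 0 K0 t0 ud) => s s0.
  by apply: le_trans (gK s s0); rewrite lerDl nsq_ge0.
rewrite /adapted; apply: le_trans (lerD h2 h1) _.
rewrite /lp_const le_eqVlt; apply/orP; left; apply/eqP.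
by field; rewrite !gt_eqF.
Qed.

(** The term [e * q (z t)] in the forcing cannot be moved to the left pointwise, since only bounds
    over the whole half-line are available. Iterating [a_priori_bound] replaces a bound [C] by
    [A + C / 2], whose fixed point is [2 * A]. *)
Lemma a_priori_absorb z g (K C e : R) : 0 <= K -> 0 <= e -> c * e <= 1 / 2 ->
  (forall t : R, is_derive t 1 z (Lam (z t) + g t)) ->
  (forall t, t <= 0 -> q (g t) <= e * q (z t) + K * wt t) ->
  (forall t, t <= 0 -> q (z t) <= C * wt t) ->
  forall t, t <= 0 -> q (z t) <= 2 * (nsq (JE *m usubmx (z 0)) + c * K) * wt t.
Proof.
move=> K0 e0 ce zd gK zC t t0.
set A := nsq _ + _.
have A0 : 0 <= A by rewrite addr_ge0 ?nsq_ge0 ?mulr_ge0 // ltW // lp_const_gt0.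
have C0 : 0 <= C.
  have := zC 0 (lexx _); rewrite mulr0 expR0 mulr1.
  by apply: le_trans; exact: adapted_ge0.
have H n s : s <= 0 -> q (z s) <= (2 * A + C * (1 / 2) ^+ n) * wt s.
  elim: n s => [|n IH] s s0.
    rewrite expr0 mulr1 mulrDl (le_trans (zC s s0)) // lerDr.
    by rewrite !mulr_ge0 ?expR_ge0.
  set Cn := 2 * A + C * (1 / 2) ^+ n in IH *.
  have Cn0 : 0 <= Cn by rewrite addr_ge0 ?mulr_ge0 // exprn_ge0.
  have K1 : 0 <= e * Cn + K by rewrite addr_ge0 // mulr_ge0.
  apply: le_trans (a_priori_bound K1 zd _ IH s0) _ => [r r0|].
    apply: le_trans (gK r r0) _; rewrite mulrDl lerD2r -mulrA.
    by rewrite ler_wpM2l // IH.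
  rewrite ler_wpM2r ?expR_ge0 //.
  have -> : 2 * A + C * (1 / 2) ^+ n.+1 = A + 1 / 2 * Cn.
    by rewrite /Cn exprS; field.
  by rewrite mulrDr [c * (e * Cn)]mulrA /A; have := ler_wpM2r Cn0 ce; lra.
have h0 : 0 <= 1 / 2 :> R by lra.
have h1 : 1 / 2 < 1 :> R by lra.
apply: (le_geometric h0 h1 (B := C * wt t)) => n.
apply: le_trans (H n t t0) _; rewrite le_eqVlt; apply/orP; left; apply/eqP.
by ring.
Qed.

End Weight.
End LyapunovPerron.

Section LyapunovPerronExistence.
Variables (R : realType) (d k mE mF : nat).
Variables (JE : 'M[R]_(mE, d)) (JE' : 'M[R]_(d, mE)).
Variables (JF : 'M[R]_(mF, k)) (JF' : 'M[R]_(k, mF)).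
Variables (LE : 'M[R]_d) (LF : 'M[R]_k) (al be : R).
Hypotheses (JE'J : JE' *m JE = 1%:M) (JF'J : JF' *m JF = 1%:M).
Hypothesis hE : forall x, - al * nsq (JE *m x) <= dot (JE *m x) (JE *m (LE *m x)).
Hypothesis hF : forall x, dot (JF *m x) (JF *m (LF *m x)) <= - be * nsq (JF *m x).
Local Notation V := 'cV[R]_(d + k).
Local Notation q := (adapted JE JF).
Local Notation Lam := (block_lin LE LF).
Implicit Types (z g y : R -> V).

Variable ga : R.
Hypotheses (alga : al < ga) (gabe : ga < be).
Local Notation c := (lp_const al be ga).
Local Notation wt t := (expR (- 2 * ga * t)).

Variables (N : R -> V -> V) (e K : R) (u0 : 'cV[R]_d).
Hypotheses (e0 : 0 <= e) (K0 : 0 <= K) (ce : c * e <= 1 / 4).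
Hypothesis Nc : forall y, continuous y ->
  continuous (fun t => N (clamp t) (y (clamp t))).
Hypothesis Nlip : forall t (x y : V), t <= 0 -> q (N t x - N t y) <= e * q (x - y).
Hypothesis N0 : forall t, t <= 0 -> q (N t 0) <= K * wt t.

Let wbounded y := exists2 C, 0 <= C & forall t, t <= 0 -> q (y t) <= C * wt t.
Let admissible y := continuous y /\ wbounded y.
Let picard y z := [/\ admissible z, usubmx (z 0) = u0 &
  forall t : R, is_derive t 1 z (Lam (z t) + N (clamp t) (y (clamp t)))].

Let c0 : 0 < c. Proof. exact: lp_const_gt0. Qed.

Let picardP y : continuous (fun t => y (clamp t)) -> wbounded y ->
  exists z, picard y z.
Proof.
move=> yc [C C0 yC].
have gc : continuous (fun t => N (clamp t) (y (clamp t))).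
  have := Nc yc; rewrite (_ : (fun t => N _ (y (clamp (clamp t)))) =
    (fun t => N (clamp t) (y (clamp t)))) //.
  by apply/funext => t; rewrite (clamp_id (clamp_le0 t)).
have K1 : 0 <= 2 * (e * C) + 2 * K by rewrite addr_ge0 ?mulr_ge0.
have gK t : t <= 0 -> q (N (clamp t) (y (clamp t))) <= (2 * (e * C) + 2 * K) * wt t.
  move=> t0; rewrite clamp_id // -[N t (y t)](subrK (N t 0)).
  apply: le_trans (adaptedD_le _ _ _ _) _.
  have h1 := Nlip (y t) 0 t0; have h2 := N0 t0.
  by have := ler_wpM2l e0 (yC t t0); rewrite subr0 in h1; lra.
have [z [zd zu zK]] := bounded_lin JF'J hE hF alga gabe u0 K1 gc gK.
exists z; split => //; split; first exact: is_derive_continuous zd.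
exists (nsq (JE *m u0) + c * (2 * (e * C) + 2 * K)) => //.
by rewrite addr_ge0 ?nsq_ge0 // mulr_ge0 // ltW.
Qed.

Let picard_diff y1 y2 z1 z2 M : 0 <= M -> picard y1 z1 -> picard y2 z2 ->
  (forall t, t <= 0 -> q (y1 t - y2 t) <= M * wt t) ->
  forall t, t <= 0 -> q (z1 t - z2 t) <= M / 4 * wt t.
Proof.
move=> M0 [[_ [C1 C10 B1]] zu1 zd1] [[_ [C2 C20 B2]] zu2 zd2] yM t t0.
have zd (s : R) : is_derive s 1 (fun s => z1 s - z2 s) (Lam (z1 s - z2 s) +
    (N (clamp s) (y1 (clamp s)) - N (clamp s) (y2 (clamp s)))).
  rewrite block_linB addrACA -opprD; exact: is_deriveB.
have K1 : 0 <= e * M by rewrite mulr_ge0.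
have gK s : s <= 0 -> q (N (clamp s) (y1 (clamp s)) - N (clamp s) (y2 (clamp s)))
    <= e * M * wt s.
  move=> s0; rewrite clamp_id // -mulrA.
  by apply: le_trans (Nlip _ _ s0) _; rewrite ler_wpM2l // yM.
have zB s : s <= 0 -> q (z1 s - z2 s) <= (2 * C1 + 2 * C2) * wt s.
  move=> s0; apply: le_trans (adaptedB_le _ _ _ _) _.
  by have := B1 _ s0; have := B2 _ s0; lra.
have := a_priori_bound hE hF alga gabe K1 zd gK zB t0.
rewrite linearB /= zu1 zu2 subrr mulmx0 nsq0 add0r.
move=> /le_trans; apply; rewrite ler_wpM2r ?expR_ge0 // mulrA.
by have := ler_wpM2r M0 ce; lra.
Qed.

(** Picard iteration in the weighted norm. The nonlinearity may depend on time, so the same lemma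
    solves both the truncated system and its linearization along a solution. *)
Lemma lyapunov_perron : exists z C,
  [/\ forall t : R, is_derive t 1 z (Lam (z t) + N (clamp t) (z (clamp t))),
      usubmx (z 0) = u0 & forall t, t <= 0 -> q (z t) <= C * wt t].
Proof.
have step y : exists z, admissible y -> picard y z.
  have [[yc yB]|nay] := pselect (admissible y); last by exists y.
  have [|z yz] := @picardP y _ yB; last by exists z.
  move=> t; exact: (@continuous_comp _ _ _ (@clamp R) y t (@clamp_continuous _ t) (yc _)).
pose T y := projT1 (cid (step y)).
have TP y : admissible y -> picard y (T y) := projT2 (cid (step y)).
have adm0 : admissible (fun=> 0).
  split; first by move=> t; exact: cvg_cst.
  by exists 0 => // t _; rewrite adapted0 mul0r.
pose Z n := iter n T (fun=> 0).
have Zadm n : admissible (Z n).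
  by elim: n => [//|n IH]; have [] := TP _ IH.
have ZP n : picard (Z n) (Z n.+1) by exact: TP.
have [C1 C10 HC1] := (Zadm 1).2.
pose M := C1.
have M0 : 0 <= M by [].
have D n t : t <= 0 -> q (Z n.+1 t - Z n t) <= M * (1 / 4) ^+ n * wt t.
  elim: n t => [|n IH] t t0.
    by rewrite expr0 mulr1 /= subr0; exact: HC1.
  have MM : 0 <= M * (1 / 4) ^+ n by rewrite mulr_ge0 // exprn_ge0 //; lra.
  have := picard_diff MM (ZP n.+1) (ZP n) IH t0.
  by rewrite exprS; congr (_ <= _); field.
have h14 : 0 <= 1 / 4 :> R by lra.
have h41 : 1 / 4 < 1 :> R by lra.
(* Each use of [adaptedD_le] doubles, so the telescoping sum relies on the ratio 1/4: the constant 4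
   reproduces itself as [2 + 2 * 4 / 4]. *)
have DD i j t : t <= 0 -> q (Z i t - Z (i + j)%N t) <= 4 * M * (1 / 4) ^+ i * wt t.
  move=> t0; elim: j i => [|j IH] i.
    rewrite addn0 subrr adapted0 !mulr_ge0 ?expR_ge0 // exprn_ge0 //.
  have -> : Z i t - Z (i + j.+1)%N t = (Z i t - Z i.+1 t) + (Z i.+1 t - Z (i.+1 + j)%N t).
    by rewrite subrKA addnS addSn.
  apply: le_trans (adaptedD_le _ _ _ _) _.
  have h1 := D i t t0; have h2 := IH i.+1.
  rewrite -opprB adaptedN exprS in h1 h2 *.
  have := expR_ge0 (- 2 * ga * t); set w := expR _ in h1 h2 *.
  by set p := (1 / 4) ^+ i in h1 h2 *; lra.
have [Cq Cq0 HCq] := nsq_le_adapted JE'J JF'J.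
have [Cn Cn0 HCn] := adapted_le_nsq JE JF.
have lim t : t <= 0 -> exists l : V, forall i,
    nsq (Z i t - l) <= Cq * (4 * M * wt t) * (1 / 4) ^+ i.
  move=> t0; have [i j ij|l [_ Hl]] := @nsq_cauchy R _ (fun n => Z n t)
    (Cq * (4 * M * wt t)) (1 / 4) h14 h41; last by exists l.
  apply: le_trans (HCq _) _; rewrite -mulrA ler_pM2l // -(subnKC ij).
  by apply: le_trans (DD _ _ _ t0) _; rewrite mulrAC.
have lim' t : exists l : V, t <= 0 -> forall i,
    nsq (Z i t - l) <= Cq * (4 * M * wt t) * (1 / 4) ^+ i.
  by have [/lim[l Hl]|_] := leP t 0; [exists l|exists 0].
pose l t := projT1 (cid (lim' t)).
have lP t : t <= 0 -> forall i, nsq (Z i t - l t) <= Cq * (4 * M * wt t) * (1 / 4) ^+ i.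
  exact: (projT2 (cid (lim' t))).
pose M' := Cn * (Cq * (4 * M)).
have M'0 : 0 <= M' by rewrite /M' !mulr_ge0 // ltW.
have lQ i t : t <= 0 -> q (Z i t - l t) <= M' * (1 / 4) ^+ i * wt t.
  move=> t0; apply: le_trans (HCn _) _.
  apply: le_trans (ler_wpM2l (ltW Cn0) (lP t t0 i)) _.
  by rewrite le_eqVlt; apply/orP; left; apply/eqP; rewrite /M'; ring.
have lc : continuous (fun t => l (clamp t)).
  apply: (@uniform_limit_cV R _ (fun i t => Z i (clamp t)) _
    (fun t => Cq * (4 * M * wt (clamp t))) (1 / 4)) => //.
  - move=> i t; exact: (@continuous_comp _ _ _ (@clamp R) (Z i) t (@clamp_continuous _ t) ((Zadm i).1 _)).
  - move=> t; apply: cvgM; first exact: cvg_cst.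
    apply: cvgM; first exact: cvg_cst.
    apply: continuous_cvg; first exact: continuous_expR.
    by apply: cvgM; [exact: cvg_cst|exact: clamp_continuous].
  - by move=> i t; apply: lP; exact: clamp_le0.
have lB : wbounded l.
  exists (2 * M' + 2 * 0) => [|t t0]; first by rewrite mulr0 addr0 mulr_ge0.
  have := lQ 0%N t t0; rewrite /= sub0r adaptedN expr0 mulr1 mulr0 addr0.
  by have := expR_ge0 (- 2 * ga * t); nra.
(* The limit [l] is only known to be continuous on the half-line. One more Picard step [z] is
   differentiable on the whole line, and the contraction estimate shows that it equals [l] for
   [t <= 0]. *)
have [z zP] := picardP lc lB.
have zl t : t <= 0 -> z t = l t.
  move=> t0; apply/eqP; rewrite -subr_eq0; apply/eqP/(adapted_eq0 JE'J JF'J).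
  apply: (@le_geometric R _ _ (4 * M' * wt t) (1 / 4)) => // i.
  have MM : 0 <= M' * (1 / 4) ^+ i by rewrite mulr_ge0 // exprn_ge0 //; lra.
  have ll s : s <= 0 -> q (l s - Z i s) <= M' * (1 / 4) ^+ i * wt s.
    by move=> s0; rewrite -opprB adaptedN lQ.
  have h1 := picard_diff MM zP (ZP i) ll t0.
  have h2 := lQ i.+1 t t0.
  rewrite add0r -(subrKA (Z i.+1 t)); apply: le_trans (adaptedD_le _ _ _ _) _.
  have h3 := mulr_ge0 MM (expR_ge0 (- 2 * ga * t)).
  rewrite exprS in h2.
  by set w := expR _ in h1 h2 h3 *; set p := (1 / 4) ^+ i in h1 h2 h3 *; lra.
have [[_ [C CO zC]] zu zd] := zP.
exists z, C; split => // t.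
rewrite (zl (clamp t) (clamp_le0 t)).
exact: zd.
Qed.

End LyapunovPerronExistence.

(** * The slow manifold as a graph *)

Lemma linear_cV (R : realType) p m (f : 'cV[R]_p -> 'cV[R]_m) :
  (forall a x y, f (a *: x + y) = a *: f x + f y) ->
  exists M : 'M[R]_(m, p), forall x, f x = M *m x.
Proof.
move=> fl; exists (\matrix_(i, j) f (delta_mx j 0) i 0) => x.
have f0 : f 0 = 0.
  have := fl 1 0 0; rewrite !scale1r addr0 => /eqP.
  by rewrite eq_sym -subr_eq0 addrK => /eqP.
rewrite [in LHS](matrix_sum_delta x).
under eq_bigr do rewrite big_ord1.
have -> : f (\sum_i x i 0 *: delta_mx i 0) = \sum_i x i 0 *: f (delta_mx i 0).
  elim/big_rec2 : _ => [//|i y1 y2 _ <-]; exact: fl.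
apply/matrixP => i j; rewrite (ord1 j) summxE mxE; apply: eq_bigr => l _.
by rewrite !mxE mulrC.
Qed.

Lemma is_derive_translate (R : realType) m n (z : R -> 'M[R]_(m, n)) (t s : R) D :
  is_derive (t + s) 1 z D -> is_derive t 1 (fun t => z (t + s)) D.
Proof.
move=> /is_derive_mxP zd; apply/is_derive_mxP => i j.
have h : is_derive t (1 : R) (fun t : R => t + s) 1.
  by apply: is_derive_eq; rewrite addr0.
have := is_derive1_comp (g := fun t => t + s) (zd i j) h.
by rewrite mulr1.
Qed.

(* Interpolates between the Lipschitz and the quadratic bound on a Taylor remainder. *)
Lemma min_powR (R : realType) (a b s th : R) : 0 <= a -> 0 <= b -> 0 <= s ->
  0 <= th -> th <= 1 -> Num.min (a * s) (b * s ^+ 2) <= (a + b) * s `^ (1 + th).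
Proof.
move=> a0 b0 s0 th0 th1; have p0 := powR_ge0 s (1 + th).
have [s1|s1] := leP s 1.
  rewrite ge_min; apply/orP; right.
  have h : s ^+ 2 <= s `^ (1 + th).
    have [->|sn] := eqVneq s 0; first by rewrite expr0n powR_ge0.
    rewrite -powR_mulrn // ger_powR //; last lra.
    by rewrite lt_neqAle eq_sym sn s0.
  have := ler_wpM2l b0 h; have := mulr_ge0 a0 p0; lra.
rewrite ge_min; apply/orP; left.
have h : s <= s `^ (1 + th) by apply: le1r_powR; [exact: ltW|lra].
have := ler_wpM2l a0 h; have := mulr_ge0 b0 p0; lra.
Qed.

Section SlowGraph.
Variables (R : realType) (d k mE mF : nat).
Variables (JE : 'M[R]_(mE, d)) (JE' : 'M[R]_(d, mE)).
Variables (JF : 'M[R]_(mF, k)) (JF' : 'M[R]_(k, mF)).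
Variables (LE : 'M[R]_d) (LF : 'M[R]_k) (al be : R).
Hypotheses (JE'J : JE' *m JE = 1%:M) (JF'J : JF' *m JF = 1%:M).
Hypothesis hE : forall x, - al * nsq (JE *m x) <= dot (JE *m x) (JE *m (LE *m x)).
Hypothesis hF : forall x, dot (JF *m x) (JF *m (LF *m x)) <= - be * nsq (JF *m x).
Local Notation V := 'cV[R]_(d + k).
Local Notation q := (adapted JE JF).
Local Notation Lam := (block_lin LE LF).
Implicit Types (z : R -> V).

Variables (ga th : R).
Hypotheses (ga0 : 0 < ga) (th0 : 0 < th) (th1 : th <= 1).
Local Notation ga' := ((1 + th) * ga).
Hypotheses (alga : al < ga) (ga'be : ga' < be).
Local Notation c g := (lp_const al be g).
Local Notation wt t := (expR (- 2 * ga * t)).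

Variables (N : V -> V) (N' : V -> 'M[R]_(d + k)) (e B : R).
Hypotheses (e0 : 0 <= e) (B0 : 0 <= B).
Hypotheses (ce : c ga * e <= 1 / 4) (ce' : c ga' * e <= 1 / 4).
Hypothesis N_0 : N 0 = 0.
Hypothesis Nlip : forall x y, q (N x - N y) <= e * q (x - y).
Hypothesis Ntaylor : forall x h, q (N (x + h) - N x - N' x *m h) <= B * q h ^+ 2.
Hypothesis N'lip : forall x h, q (N' x *m h) <= e * q h.
Hypothesis N'0 : N' 0 = 0.
Hypothesis N'c : continuous N'.

Let gaga' : ga < ga'. Proof. by rewrite mulrDl mul1r ltrDl mulr_gt0. Qed.
Let gabe : ga < be. Proof. exact: lt_trans gaga' ga'be. Qed.
Let alga' : al < ga'. Proof. exact: lt_trans alga gaga'. Qed.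

Let N_continuous : continuous N.
Proof.
have [C1 C10 H1] := nsq_le_adapted JE'J JF'J.
have [C2 C20 H2] := adapted_le_nsq JE JF.
move=> x; apply/(@cvgrPdist_lt _ _ _ (nbhs x)) => r r0.
pose D := C1 * (e * C2) * (d + k)%:R + 1.
have D0 : 0 < D by rewrite ltr_wpDl // !mulr_ge0 // ltW.
have small : \forall y \near x, `|x - y| < r / D.
  by apply: (@cvgr_dist_lt _ _ _ (nbhs x) _ id x); [exact: cvg_id|exact: divr_gt0].
have D1 : 1 <= D by rewrite lerDr !mulr_ge0 // ltW.
near=> y; have h : `|N x - N y| ^+ 2 < r ^+ 2.
  have xy : `|x - y| ^+ 2 < (r / D) ^+ 2.
    rewrite ltr_pXn2r ?nnegrE ?normr_ge0 ?divr_ge0 // ?ltW //.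
    by near: y.
  apply: le_lt_trans (norm_le_nsq _) _; apply: le_lt_trans (H1 _) _.
  have h1 := Nlip x y; have h2 := H2 (x - y); have h3 := nsq_le_norm (x - y).
  apply: (@le_lt_trans _ _ (D * `|x - y| ^+ 2)).
    rewrite /D mulrDl; apply: (@le_trans _ _ (C1 * (e * C2) * (d + k)%:R * `|x - y| ^+ 2)); last first.
      by rewrite lerDl mul1r exprn_ge0.
    rewrite -!mulrA ler_pM2l // (le_trans h1) // ler_wpM2l // (le_trans h2) //.
    by rewrite ler_pM2l.
  apply: lt_le_trans (_ : D * (r / D) ^+ 2 <= _); first by rewrite ltr_pM2l.
  have -> : D * (r / D) ^+ 2 = r ^+ 2 / D by field; rewrite gt_eqF.
  by rewrite ler_pdivrMr // ler_peMr // exprn_ge0 // ltW.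
by move: h; rewrite ltr_pXn2r ?nnegrE ?normr_ge0 // ltW.
Unshelve. all: by end_near. Qed.

(** Stating the equation for all times, with a forcing prescribed only for [t <= 0], keeps
    derivatives two-sided while the continuation beyond 0 stays arbitrary. *)
Let sol (u0 : 'cV[R]_d) (z : R -> V) := exists g C,
  [/\ forall t : R, is_derive t 1 z (Lam (z t) + g t),
      forall t, t <= 0 -> g t = N (z t), usubmx (z 0) = u0
    & forall t, t <= 0 -> q (z t) <= C * wt t].

Let sol_exists u0 : exists z, sol u0 z.
Proof.
have Nc (y : R -> V) : continuous y -> continuous (fun t => N (y (clamp t))).
  move=> yc t.
  have h := @continuous_comp _ _ _ (@clamp R) y t (@clamp_continuous _ t) (yc _).
  by apply: (@cvg_comp _ _ _ (y \o @clamp R) N _ _ _ h); exact: N_continuous.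
have N00 (t : R) : t <= 0 -> q (N 0) <= 0 * wt t.
  by rewrite N_0 adapted0 mul0r.
have [z [C [zd zu zC]]] := lyapunov_perron JE'J JF'J hE hF alga gabe u0 e0
  (lexx 0) ce Nc (fun t x y _ => Nlip x y) N00.
exists z, (fun t => N (z (clamp t))), C; split => // t t0.
by rewrite clamp_id.
Qed.

Let X (h : 'cV[R]_d) := nsq (JE *m h).

(** With [u1 = u2] this is uniqueness. The second bound keeps the factor [e], which makes the slope
    of the graph small with the truncation. *)
Let sol_diff u1 u2 z1 z2 : sol u1 z1 -> sol u2 z2 -> forall t, t <= 0 ->
  q (z1 t - z2 t) <= 2 * X (u1 - u2) * wt t /\
  nsq (JF *m dsubmx (z1 t - z2 t)) <=
    e * (2 * X (u1 - u2)) / (be - ga) ^+ 2 * wt t.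
Proof.
move=> [g1 [C1 [d1 E1 i1 b1]]] [g2 [C2 [d2 E2 i2 b2]]].
have dd (t : R) : is_derive t 1 (fun t => z1 t - z2 t)
    (Lam (z1 t - z2 t) + (g1 t - g2 t)).
  rewrite block_linB addrACA -opprD; exact: is_deriveB.
have bb t : t <= 0 -> q (z1 t - z2 t) <= (2 * C1 + 2 * C2) * wt t.
  move=> t0; apply: le_trans (adaptedB_le _ _ _ _) _.
  by have := b1 _ t0; have := b2 _ t0; lra.
have gK t : t <= 0 -> q (g1 t - g2 t) <= e * q (z1 t - z2 t) + 0 * wt t.
  by move=> t0; rewrite E1 // E2 // mul0r addr0.
have ce2 : c ga * e <= 1 / 2 by have := ce; lra.
have H t : t <= 0 -> q (z1 t - z2 t) <= 2 * X (u1 - u2) * wt t.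
  move=> t0; have := a_priori_absorb hE hF alga gabe (lexx 0) e0 ce2 dd gK bb t0.
  by rewrite mulr0 addr0 linearB /= i1 i2.
have K0 : 0 <= e * (2 * X (u1 - u2)) by rewrite !mulr_ge0 // nsq_ge0.
have gK2 t : t <= 0 -> q (g1 t - g2 t) <= e * (2 * X (u1 - u2)) * wt t.
  move=> t0; apply: le_trans (gK t t0) _; rewrite mul0r addr0 -mulrA.
  by rewrite ler_wpM2l // H.
move=> t t0; split; first exact: H.
exact: (a_priori_F hF gabe K0 dd gK2 bb t0).
Qed.

Let Z u0 := projT1 (cid (sol_exists u0)).
Let ZP u0 : sol u0 (Z u0) := projT2 (cid (sol_exists u0)).

Definition slow_graph u0 := dsubmx (Z u0 0).
Local Notation w := slow_graph.

Let Z0 u0 : Z u0 0 = col_mx u0 (w u0).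
Proof.
have [g [C [_ _ zu _]]] := ZP u0.
by rewrite -{1}(vsubmxK (Z u0 0)) zu.
Qed.

Lemma slow_graph0 : w 0 = 0.
Proof.
have s0 : sol 0 (fun=> 0).
  exists (fun=> 0), 0; split=> [t|||t _] //.
  - rewrite /block_lin !linear0 addr0 col_mx0; exact: is_derive_cst.
  - by rewrite linear0.
  - by rewrite adapted0 mul0r.
have [H _] := sol_diff (ZP 0) s0 (lexx 0).
rewrite subr0 /X subr0 mulmx0 nsq0 mulr0 mul0r in H.
by rewrite /slow_graph (adapted_eq0 JE'J JF'J H) linear0.
Qed.

Lemma slow_graph_lip u1 u2 : nsq (JF *m (w u1 - w u2)) <=
  e * 2 / (be - ga) ^+ 2 * nsq (JE *m (u1 - u2)).
Proof.
have [_] := sol_diff (ZP u1) (ZP u2) (lexx 0).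
rewrite mulr0 expR0 mulr1 !Z0 opp_col_mx add_col_mx col_mxKd /X.
by move=> /le_trans; apply; rewrite le_eqVlt; apply/orP; left; apply/eqP; ring.
Qed.

Lemma slow_graph_backward u0 : exists z,
  [/\ is_derive (0 : R) 1 z (Lam (z 0) + N (z 0)), z 0 = col_mx u0 (w u0)
    & forall s, s <= 0 -> dsubmx (z s) = w (usubmx (z s))].
Proof.
exists (Z u0); have [g [C [zd E zu zC]]] := ZP u0.
split; [by rewrite -E //; exact: zd|exact: Z0|] => s s0.
have sh : sol (usubmx (Z u0 s)) (fun t => Z u0 (t + s)).
  exists (fun t => g (t + s)), (C * wt s); split => [t|t t0||t t0].
  - by apply: is_derive_translate; exact: zd.
  - by rewrite E //; lra.
  - by rewrite add0r.
  - by rewrite -mulrA -expRD -mulrDr [s + t]addrC; apply: zC; lra.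
have [H _] := sol_diff sh (ZP (usubmx (Z u0 s))) (lexx 0).
rewrite /X subrr mulmx0 nsq0 mulr0 mul0r add0r in H.
by move/eqP: (adapted_eq0 JE'J JF'J H); rewrite subr_eq0 /slow_graph => /eqP <-.
Qed.

Let lsol u0 (h : 'cV[R]_d) (y : R -> V) := exists g C,
  [/\ forall t : R, is_derive t 1 y (Lam (y t) + g t),
      forall t, t <= 0 -> g t = N' (Z u0 t) *m y t, usubmx (y 0) = h
    & forall t, t <= 0 -> q (y t) <= C * wt t].

Let lsol_exists u0 h : exists y, lsol u0 h y.
Proof.
have [g0 [C0 [zd _ _ _]]] := ZP u0.
have zc : continuous (Z u0) by exact: is_derive_continuous zd.
have Nc (y : R -> V) : continuous y ->
    continuous (fun t => N' (Z u0 (clamp t)) *m y (clamp t)).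
  move=> yc t; apply: (@cvg_mulmx _ _ (nbhs t) _ _ _ _ (fun t => N' (Z u0 (clamp t)))).
    have hc := @continuous_comp _ _ _ (@clamp R) (Z u0) t (@clamp_continuous _ t) (zc _).
    by apply: (@cvg_comp _ _ _ (Z u0 \o @clamp R) N' _ _ _ hc); exact: N'c.
  exact: (@continuous_comp _ _ _ (@clamp R) y t (@clamp_continuous _ t) (yc _)).
have N00 (t : R) : t <= 0 -> q (N' (Z u0 t) *m 0) <= 0 * wt t.
  by rewrite mulmx0 adapted0 mul0r.
have Nl (t : R) x y : t <= 0 ->
    q (N' (Z u0 t) *m x - N' (Z u0 t) *m y) <= e * q (x - y).
  by move=> _; rewrite -mulmxBr.
have [y [C [yd yu yC]]] := lyapunov_perron JE'J JF'J hE hF alga gabe h e0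
  (lexx 0) ce Nc Nl N00.
exists y, (fun t => N' (Z u0 (clamp t)) *m y (clamp t)), C; split => // t t0.
by rewrite clamp_id.
Qed.

Let lsol_lin u0 a h1 h2 y1 y2 : lsol u0 h1 y1 -> lsol u0 h2 y2 ->
  lsol u0 (a *: h1 + h2) (fun t => a *: y1 t + y2 t).
Proof.
move=> [g1 [C1 [d1 E1 i1 b1]]] [g2 [C2 [d2 E2 i2 b2]]].
exists (fun t => a *: g1 t + g2 t), (2 * (a ^+ 2 * C1) + 2 * C2); split.
- move=> t; have d3 : is_derive t (1 : R) (fun t => a *: y1 t + y2 t)
      (a *: (Lam (y1 t) + g1 t) + (Lam (y2 t) + g2 t)).
    by apply: is_deriveD; apply: is_deriveZ.
  rewrite (_ : Lam (a *: y1 t + y2 t) + (a *: g1 t + g2 t) =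
      (a *: (Lam (y1 t) + g1 t) + (Lam (y2 t) + g2 t))) //.
  have -> : Lam (a *: y1 t + y2 t) = a *: Lam (y1 t) + Lam (y2 t).
    by rewrite /block_lin scale_col_mx add_col_mx !linearP.
  by apply/matrixP => i j; rewrite !mxE; ring.
- by move=> t t0; rewrite E1 // E2 // mulmxDr -scalemxAr.
- by rewrite linearP /= i1 i2.
- move=> t t0; apply: le_trans (adaptedD_le _ _ _ _) _; rewrite adaptedZ.
  have := ler_wpM2l (sqr_ge0 a) (b1 _ t0); have := b2 _ t0; lra.
Qed.

Let lsol_bound u0 h y : lsol u0 h y -> q (y 0) <= 2 * X h.
Proof.
move=> [g [C [yd E yu yC]]].
have gK t : t <= 0 -> q (g t) <= e * q (y t) + 0 * wt t.
  by move=> t0; rewrite E // mul0r addr0.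
have ce2 : c ga * e <= 1 / 2 by have := ce; lra.
have := a_priori_absorb hE hF alga gabe (lexx 0) e0 ce2 yd gK yC (lexx 0).
by rewrite mulr0 addr0 yu mulr0 expR0 mulr1.
Qed.

Let lsol_unique u0 h y1 y2 : lsol u0 h y1 -> lsol u0 h y2 -> y1 0 = y2 0.
Proof.
move=> l1 l2; have := lsol_bound (lsol_lin (-1) l1 l2).
rewrite !scaleN1r (addNr h) /X mulmx0 nsq0 mulr0 => H.
by move/eqP: (adapted_eq0 JE'J JF'J H); rewrite addrC subr_eq0 => /eqP.
Qed.

Let Y u0 h := projT1 (cid (lsol_exists u0 h)).
Let YP u0 h : lsol u0 h (Y u0 h) := projT2 (cid (lsol_exists u0 h)).

(** The solution of the linearized problem is unique, hence linear in [h]; its F-part at time 0 is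
    the candidate for the derivative of the graph. *)
Let L_exists u0 : exists M : 'M[R]_(k, d), forall h, dsubmx (Y u0 h 0) = M *m h.
Proof.
apply: linear_cV => a x y.
rewrite (lsol_unique (YP u0 (a *: x + y)) (lsol_lin a (YP u0 x) (YP u0 y))).
by rewrite linearP.
Qed.

Definition slow_graph_deriv u0 := projT1 (cid (L_exists u0)).
Local Notation L := slow_graph_deriv.
Let LP u0 h : dsubmx (Y u0 h 0) = L u0 *m h := projT2 (cid (L_exists u0)) h.

(** Along the zero orbit [N'] vanishes, so the F-part solves the unforced equation within the growth
    bound, and such a solution is 0. *)
Lemma slow_graph_deriv0 : L 0 = 0.
Proof.
have Z00 t : t <= 0 -> Z 0 t = 0.
  move=> t0; have s0 : sol 0 (fun=> 0).
    exists (fun=> 0), 0; split=> [s|||s _] //.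
    - rewrite /block_lin !linear0 addr0 col_mx0; exact: is_derive_cst.
    - by rewrite linear0.
    - by rewrite adapted0 mul0r.
  have [H _] := sol_diff (ZP 0) s0 t0.
  rewrite subr0 /X subr0 mulmx0 nsq0 mulr0 mul0r in H.
  exact: (adapted_eq0 JE'J JF'J H).
have L0 (h : 'cV[R]_d) : L 0 *m h = 0.
  have [g [C [yd E yu yC]]] := YP 0 h.
  have gK t : t <= 0 -> q (g t) <= 0 * wt t.
    by move=> t0; rewrite E // Z00 // N'0 mul0mx adapted0 mul0r.
  have := a_priori_F hF gabe (lexx 0) yd gK yC (lexx 0).
  rewrite !mul0r => H; rewrite -LP.
  have [C' C'0 HC'] := left_inverse_bound JF'J.
  apply: nsq_eq0; apply/eqP; rewrite eq_le nsq_ge0 andbT (le_trans (HC' _)) //.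
  by rewrite pmulr_rle0.
apply/matrixP => i j; have := L0 (delta_mx j 0) => /matrixP /(_ i 0).
by rewrite -colE !mxE.
Qed.

Lemma slow_graph_deriv_le u h :
  nsq (JF *m (L u *m h)) <= 2 * nsq (JE *m h).
Proof.
rewrite -LP; apply: le_trans (nsqF_le_adapted _ _ _) _.
exact: (lsol_bound (YP u h)).
Qed.

(* The remainder solves the linearized equation up to an inhomogeneity of size
   |h|^(1+th) exp (- (1+th) ga t), which is admissible because (1+th) ga < be. *)
Lemma slow_graph_taylor : exists2 D, 0 <= D & forall u h,
  nsq (JF *m (w (u + h) - w u - L u *m h)) <= D * nsq (JE *m h) `^ (1 + th).
Proof.
pose B2 := 4 * e + B.
have B20 : 0 <= B2 by rewrite addr_ge0 // mulr_ge0.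
pose K h := 2 * (B2 * (2 * X h) `^ (1 + th)).
have X0 h : 0 <= X h by exact: nsq_ge0.
have K0 h : 0 <= K h by rewrite !mulr_ge0 // powR_ge0.
have c0 : 0 <= c ga' by apply/ltW/lp_const_gt0.
exists (2 * (c ga' * (2 * (B2 * 2 `^ (1 + th))))) => [|u h].
  by rewrite !mulr_ge0 // powR_ge0.
have sD := sol_diff (ZP (u + h)) (ZP u).
have [g1 [C1 [d1 E1 i1 b1]]] := ZP (u + h).
have [g2 [C2 [d2 E2 i2 b2]]] := ZP u.
have [g3 [C3 [d3 E3 i3 b3]]] := YP u h.
pose r t := Z (u + h) t - Z u t - Y u h t.
have rd (t : R) : is_derive t 1 r (Lam (r t) + (g1 t - g2 t - g3 t)).
  rewrite (_ : Lam (r t) + _ = (Lam (Z (u + h) t) + g1 t) - (Lam (Z u t) + g2 t)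
     - (Lam (Y u h t) + g3 t)).
    by apply: is_deriveB; apply: is_deriveB.
  by rewrite /r !block_linB; apply/matrixP => i j; rewrite !mxE; ring.
have rb0 t : t <= 0 -> q (r t) <= (2 * (2 * C1 + 2 * C2) + 2 * C3) * wt t.
  move=> t0; apply: le_trans (adaptedB_le _ _ _ _) _.
  have := adaptedB_le JE JF (Z (u + h) t) (Z u t).
  have := b1 _ t0; have := b2 _ t0; have := b3 _ t0; lra.
(* Since [ga < ga'], a bound with the smaller weight is also one with the larger weight on [t <= 0];
   this makes [a_priori_absorb] applicable at [ga']. *)
have rb t : t <= 0 -> q (r t) <= (2 * (2 * C1 + 2 * C2) + 2 * C3) * expR (- 2 * ga' * t).
  move=> t0; apply: le_trans (rb0 t t0) _.
  have r0 : 0 <= 2 * (2 * C1 + 2 * C2) + 2 * C3.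
    have := rb0 0 (lexx 0); rewrite mulr0 expR0 mulr1.
    by apply: le_trans; exact: adapted_ge0.
  rewrite ler_wpM2l // ler_expR.
  have t0' : 0 <= - t by rewrite oppr_ge0.
  have : 0 <= ga' - ga by rewrite subr_ge0 ltW.
  by move=> /mulr_ge0 /(_ t0'); lra.
have gK t : t <= 0 -> q (g1 t - g2 t - g3 t) <=
    (2 * e) * q (r t) + K h * expR (- 2 * ga' * t).
  move=> t0; rewrite E1 // E2 // E3 //.
  pose D := Z (u + h) t - Z u t.
  have -> : Z (u + h) t = Z u t + D by rewrite /D [RHS]addrC subrK.
  have -> : N (Z u t + D) - N (Z u t) - N' (Z u t) *m Y u h t =
     N' (Z u t) *m r t + (N (Z u t + D) - N (Z u t) - N' (Z u t) *m D).
    rewrite (_ : r t = D - Y u h t) // mulmxBr.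
    by apply/matrixP => i j; rewrite !mxE; ring.
  apply: le_trans (adaptedD_le _ _ _ _) _; rewrite -!mulrA.
  apply: lerD; first by rewrite ler_pM2l // N'lip.
  rewrite ler_pM2l //.
  have qD0 := adapted_ge0 JE JF D.
  have h1 := Ntaylor (Z u t) D.
  have h2 : q (N (Z u t + D) - N (Z u t) - N' (Z u t) *m D) <= 4 * e * q D.
    apply: le_trans (adaptedB_le _ _ _ _) _.
    by have := Nlip (Z u t + D) (Z u t); have := N'lip (Z u t) D;
      rewrite [_ + D - _]addrAC subrr add0r; lra.
  have h3 := min_powR (mulr_ge0 (ler0n R 4) e0) B0 qD0 (ltW th0) th1.
  have h4 : q (N (Z u t + D) - N (Z u t) - N' (Z u t) *m D) <= B2 * q D `^ (1 + th).
    by apply: le_trans h3; rewrite le_min h2 h1.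
  apply: le_trans h4 _; rewrite ler_wpM2l //.
  have -> : expR (- 2 * ((1 + th) * (ga * t))) = wt t `^ (1 + th).
    by rewrite -expRM; congr expR; ring.
  rewrite -powRM ?mulr_ge0 ?expR_ge0 //.
  have [H _] := sD _ t0; rewrite addrAC subrr add0r in H.
  apply: ge0_ler_powR; rewrite ?nnegrE ?mulr_ge0 ?expR_ge0 //.
  by have := th0; lra.
(* The factor 2 comes from splitting the forcing by [adaptedD_le]; it is the reason why [ce'] asks
   for 1/4. *)
have ce2 : c ga' * (2 * e) <= 1 / 2 by have := ce'; lra.
have e20 : 0 <= 2 * e by rewrite mulr_ge0.
have := a_priori_absorb hE hF alga' ga'be (K0 h) e20 ce2 rd gK rb (lexx 0).
have -> : usubmx (r 0) = 0.
  by rewrite /r !linearB /= i1 i2 i3 -addrA -opprD subrr.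
rewrite mulmx0 nsq0 add0r mulr0 expR0 mulr1 => H.
have -> : w (u + h) - w u - L u *m h = dsubmx (r 0).
  by rewrite /r !linearB /= LP.
apply: le_trans (nsqF_le_adapted _ _ _) _; apply: le_trans H _.
rewrite /K powRM //; rewrite le_eqVlt; apply/orP; left; apply/eqP.
by rewrite /X; ring.
Qed.

End SlowGraph.

(** * Differentiability from Taylor bounds *)

Section TaylorC1.
Variable R : realType.

Lemma le_of_sqr (a b : R) : 0 <= b -> a ^+ 2 <= b ^+ 2 -> a <= b.
Proof.
move=> b0 ab; apply: le_trans (ler_norm a) _.
by rewrite -(ger0_norm b0) -!sqrtr_sqr ler_wsqrtr.
Qed.

Lemma powR_small (th C e : R) : 0 < th -> 0 <= C -> 0 < e ->
  exists2 eta : R, 0 < eta & forall s, 0 <= s -> s <= eta -> C * s `^ th <= e.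
Proof.
move=> th0 C0 e0; have C1 : 0 < C + 1 by lra.
have ec : 0 < e / (C + 1) by rewrite divr_gt0.
exists ((e / (C + 1)) `^ th^-1) => [|s s0 sle]; first exact: powR_gt0.
have h : s `^ th <= e / (C + 1).
  have -> : e / (C + 1) = ((e / (C + 1)) `^ th^-1) `^ th.
    by rewrite -powRrM mulVf ?gt_eqF // powRr1 ?ltW.
  by apply: ge0_ler_powR => //; rewrite ?nnegrE ?powR_ge0 // ltW.
have h2 := ler_wpM2l C0 h; apply: le_trans h2 _.
rewrite mulrA ler_pdivrMr // mulrC ler_pM2l //; lra.
Qed.

Lemma nsq_le_near0 n (eta : R) : 0 < eta ->
  \forall h \near (0 : 'cV[R]_n), nsq h <= eta.
Proof.
move=> e0; have := @nsq_continuous R n 0; rewrite /continuous_at nsq0 => H.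
exact: (cvgr_le _ H).
Qed.

Lemma powRS (s th : R) : 0 < th -> 0 <= s -> s `^ (1 + th) = s * s `^ th.
Proof.
move=> th0 s0; rewrite powRD ?powRr1 // gt_eqF //=.
by lra.
Qed.

(** Both sides are squared norms: the remainder has order [1 + th] in the norm of [h], hence is
    negligible against [h]. *)
Lemma near_taylor_differentiable p m (g : 'cV[R]_p -> 'cV[R]_m) x (M : 'M[R]_(m, p))
  (D th : R) : 0 <= D -> 0 < th ->
  (\forall h \near (0 : 'cV[R]_p),
    nsq (g (x + h) - g x - M *m h) <= D * nsq h `^ (1 + th)) ->
  differentiable g x /\ ('d g x : 'cV[R]_p -> 'cV[R]_m) = mulmx M.
Proof.
move=> D0 th0 Hg.
have lc : continuous (mulmx M : 'cV[R]_p -> 'cV[R]_m).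
  exact: mulmx_continuous.
have E : g \o shift x = cst (g x) + (mulmx M : 'cV[R]_p -> 'cV[R]_m) +o_ (0 : 'cV[R]_p) id.
  apply/eqaddoP => e e0.
  have DD0 : 0 <= D * p%:R by rewrite mulr_ge0.
  have e20 : 0 < e ^+ 2 by rewrite exprn_gt0.
  have [eta eta0 Heta] := powR_small th0 DD0 e20.
  near=> h.
  have -> : (g \o shift x - (cst (g x) + mulmx M)) h = g (x + h) - g x - M *m h.
    by rewrite /= [x + h]addrC -addrA -opprD.
  apply: le_of_sqr; first by rewrite mulr_ge0 // ltW.
  apply: le_trans (norm_le_nsq _) _.
  apply: (@le_trans _ _ (D * nsq h `^ (1 + th))); first by near: h.
  rewrite (powRS th0 (nsq_ge0 _)).
  have h1 := nsq_le_norm h; have h0 := nsq_ge0 h.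
  have h2 : D * p%:R * nsq h `^ th <= e ^+ 2.
    by apply: Heta => //; near: h; exact: nsq_le_near0.
  have h3 := powR_ge0 (nsq h) th.
  have n0 : 0 <= `|h| ^+ 2 by rewrite exprn_ge0.
  rewrite exprMn; apply: le_trans (ler_wpM2r n0 h2).
  have := ler_wpM2r (mulr_ge0 D0 h3) h1; lra.
have dE : ('d g x : 'cV[R]_p -> 'cV[R]_m) = mulmx M.
  exact: (diff_unique lc E).
split=> //; apply/diff_locallyP; rewrite dE; split => //.
Unshelve. all: by end_near. Qed.

Variables (p m : nat) (g : 'cV[R]_p -> 'cV[R]_m) (L : 'cV[R]_p -> 'M[R]_(m, p)).
Variables (D th : R).
Hypotheses (D0 : 0 <= D) (th0 : 0 < th).
Hypothesis Hg : forall x h,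
  nsq (g (x + h) - g x - L x *m h) <= D * nsq h `^ (1 + th).

Lemma taylor_differentiable x :
  differentiable g x /\ ('d g x : 'cV[R]_p -> 'cV[R]_m) = mulmx (L x).
Proof. by apply: (near_taylor_differentiable D0 th0); near=> h; exact: Hg.
Unshelve. all: by end_near. Qed.

(** A Taylor bound uniform in the base point forces a Hoelder derivative: the expansions at [x] for
    [k'] and [k' + h], and at [x + k'] for [h], combine to the action of [L (x + k') - L x] on
    [h]. *)
Lemma taylor_deriv_holder : exists2 C, 0 <= C & forall x y h,
  nsq ((L y - L x) *m h) <= C * nsq (y - x) `^ th * nsq h.
Proof.
pose C := (4 * 4 `^ (1 + th) + 6) * D.
have C0 : 0 <= C.
  by rewrite mulr_ge0 // addr_ge0 // mulr_ge0 // powR_ge0.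
have H1 x k' h : nsq h = nsq k' -> nsq ((L (x + k') - L x) *m h) <= C * nsq k' `^ (1 + th).
  move=> hk.
  have -> : (L (x + k') - L x) *m h = (g (x + (k' + h)) - g x - L x *m (k' + h))
    - (g (x + k' + h) - g (x + k') - L (x + k') *m h) - (g (x + k') - g x - L x *m k').
    rewrite mulmxDr mulmxBl addrA; apply/matrixP => i j; rewrite !mxE; ring.
  have h1 := Hg x (k' + h); have h2 := Hg (x + k') h; have h3 := Hg x k'.
  have h4 : nsq (k' + h) `^ (1 + th) <= 4 `^ (1 + th) * nsq k' `^ (1 + th).
    rewrite -powRM ?nsq_ge0 // ge0_ler_powR ?nnegrE ?mulr_ge0 ?nsq_ge0 //.
      by have := th0; lra.
    by have := nsqD_le k' h; rewrite hk; lra.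
  have h5 := ler_wpM2l D0 h4.
  set a := g _ - _ - _ in h1 *; set b := g _ - _ - _ in h2 *.
  set c := g _ - _ - _ in h3 *.
  have := nsqB_le (a - b) c; have := nsqB_le a b.
  rewrite hk in h2; rewrite /C; lra.
have H2 x y j : nsq ((L y - L x) *m delta_mx j (0 : 'I_1)) <= C * nsq (y - x) `^ th.
  have [/nsq_eq0 E|E] := eqVneq (nsq (y - x)) 0.
    move/eqP: (E); rewrite subr_eq0 => /eqP ->.
    by rewrite subrr mul0mx nsq0 mulr_ge0 // powR_ge0.
  pose s := Num.sqrt (nsq (y - x)).
  have s2 : s ^+ 2 = nsq (y - x) by rewrite sqr_sqrtr // nsq_ge0.
  have d1 : nsq (delta_mx j 0 : 'cV[R]_p) = 1.
    rewrite nsqE (bigD1 j) //= big1 => [|i ij]; rewrite !mxE.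
      by rewrite !eqxx expr1n addr0.
    by rewrite (negbTE ij) expr0n.
  (* The basis vector is scaled to the length of [y - x], as [H1] requires; the factor [nsq (y - x)]
     then cancels and leaves the exponent [th]. *)
  have := H1 x (y - x) (s *: delta_mx j 0).
  rewrite nsqZ s2 d1 mulr1 [x + _]addrC subrK => /(_ erefl).
  rewrite -scalemxAr nsqZ s2 powRS ?nsq_ge0 // mulrCA ler_pM2l //.
  by rewrite lt_neqAle eq_sym E nsq_ge0.
exists (C * p%:R) => [|x y h]; first by rewrite mulr_ge0.
apply: le_trans (nsq_mulmx _ _) _; rewrite ler_wpM2r ?nsq_ge0 //.
rewrite exchange_big /= (@le_trans _ _ (\sum_(j < p) C * nsq (y - x) `^ th)) //.
  apply: ler_sum => j _; apply: le_trans (H2 x y j).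
  by rewrite -colE nsqE; apply: ler_sum => i _; rewrite !mxE.
by rewrite sumr_const card_ord -mulr_natl; rewrite le_eqVlt; apply/orP; left; apply/eqP; ring.
Qed.

Lemma taylor_deriv_continuous : continuous L.
Proof.
have [C C0 HC] := taylor_deriv_holder.
move=> x; apply/(@cvg_mxP _ _ (nbhs x) _) => i j.
apply/cvgrPdist_le => e e0.
have e20 : 0 < e ^+ 2 by rewrite exprn_gt0.
have d0 : 0 <= nsq (delta_mx j 0 : 'cV[R]_p) by exact: nsq_ge0.
have [eta eta0 Heta] := powR_small th0 (mulr_ge0 C0 d0) e20.
near=> y; apply: le_of_sqr; first exact: ltW.
have h : nsq (y - x) <= eta.
  near: y.
  have hc : (fun y : 'cV[R]_p => nsq (y - x)) @ x --> (0 : R).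
    rewrite -(nsq0 R p) -(subrr x).
    have hs : (fun y : 'cV[R]_p => y - x) @ x --> x - x.
      by apply: (@cvgB _ _ _ (nbhs x)); [exact: cvg_id|exact: cvg_cst].
    by apply: (@cvg_comp _ _ _ (fun y : 'cV[R]_p => y - x) (@nsq R p) _ _ _ hs);
      exact: nsq_continuous.
  exact: (cvgr_le _ hc).
apply: le_trans (Heta _ (nsq_ge0 _) h).
have := HC x y (delta_mx j 0); rewrite -colE => /(le_trans (sqr_le_nsq _ i 0)).
rewrite !mxE => H; rewrite real_normK ?num_real // -sqrrN opprB.
by apply: le_trans H _; rewrite le_eqVlt; apply/orP; left; apply/eqP; ring.
Unshelve. all: by end_near. Qed.

Lemma taylor_C1_on (U : set 'cV[R]_p) : C1_on U g.
Proof.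
move=> x _; have [gd gE] := taylor_differentiable x; split; first exact: gd.
move=> v.
have E y : 'D_v g y = L y *m v.
  by have [gdy gEy] := taylor_differentiable y; rewrite deriveE // gEy.
rewrite (_ : (fun y => 'D_v g y) = fun y => L y *m v); last by apply/funext.
have h : (fun y => L y *m v) @ x --> L x *m v.
  apply: (@cvg_mulmx _ _ (nbhs x) _ _ _ _ L (fun=> v) (L x) v).
    exact: taylor_deriv_continuous.
  exact: cvg_cst.
exact: h.
Qed.

End TaylorC1.

Section ChainRule.
Variable R : realType.

Lemma is_derive_comp_diff p m (g : 'cV[R]_p -> 'cV[R]_m) (M : 'M[R]_(m, p))
  (u : R -> 'cV[R]_p) (t : R) du :
  differentiable g (u t) -> ('d g (u t) : 'cV[R]_p -> 'cV[R]_m) = mulmx M ->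
  is_derive t 1 u du -> is_derive t 1 (fun s => g (u s)) (M *m du).
Proof.
move=> gd gE [ud uE].
have ud' : differentiable u t by apply/derivable1_diffP.
have gu : differentiable (g \o u) t by exact: differentiable_comp.
apply: DeriveDef; first by apply/derivable1_diffP.
rewrite deriveE // diff_comp //= gE -uE deriveE //.
Qed.

(** Orbits are known to stay on the graph only for backward time; since the derivative exists on
    both sides, its value can be read off the left difference quotients. *)
Lemma derive_left0 m (F : R -> 'cV[R]_m) D :
  is_derive (0 : R) 1 F D -> (forall s, s <= 0 -> F s = 0) -> D = 0.
Proof.
move=> /is_derive_mxP FD F0; apply/matrixP => i j; rewrite mxE.
have /is_derive1_caratheodory [h [hE hc <-]] := FD i j.
have h1 := cvg_at_left_filter hc.
have h2 : h @ (0 : R)^'- --> (0 : R).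
  apply: cvg_near_cst; near=> s.
  have s0 : s < 0 by near: s; exact: nbhs_left_lt.
  have /= := hE s; rewrite (F0 s (ltW s0)) (F0 0 (lexx _)) subrr subr0 => /esym/eqP.
  by rewrite mulf_eq0 (lt_eqF s0) orbF => /eqP.
exact: (cvg_unique _ h1 h2).
Unshelve. all: by end_near. Qed.

End ChainRule.

Section SlowManifold.
Variables (R : realType) (d k mE mF : nat).
Variables (JE : 'M[R]_(mE, d)) (JE' : 'M[R]_(d, mE)).
Variables (JF : 'M[R]_(mF, k)) (JF' : 'M[R]_(k, mF)).
Variables (LE : 'M[R]_d) (LF : 'M[R]_k) (al be : R).
Hypotheses (JE'J : JE' *m JE = 1%:M) (JF'J : JF' *m JF = 1%:M).
Hypothesis hE : forall x, - al * nsq (JE *m x) <= dot (JE *m x) (JE *m (LE *m x)).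
Hypothesis hF : forall x, dot (JF *m x) (JF *m (LF *m x)) <= - be * nsq (JF *m x).
Local Notation V := 'cV[R]_(d + k).
Local Notation q := (adapted JE JF).
Local Notation Lam := (block_lin LE LF).

(** The threshold [e1] depends on the linear part alone, so the truncation radius can be chosen
    afterwards. Invariance is recorded infinitesimally, as tangency of the field to the graph, which
    is the form used along forward orbits that start off the graph. *)
Lemma slow_manifold : 0 < al -> al < be -> exists2 e1 : R, 0 < e1 &
  forall (N : V -> V) (N' : V -> 'M[R]_(d + k)) (e B : R),
  0 <= e -> e <= e1 -> 0 <= B -> N 0 = 0 ->
  (forall x y, q (N x - N y) <= e * q (x - y)) ->
  (forall x h, q (N (x + h) - N x - N' x *m h) <= B * q h ^+ 2) ->
  (forall x h, q (N' x *m h) <= e * q h) -> N' 0 = 0 -> continuous N' ->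
  exists (w : 'cV[R]_d -> 'cV[R]_k) (L : 'cV[R]_d -> 'M[R]_(k, d)),
  [/\ w 0 = 0 /\ L 0 = 0,
      forall u1 u2, nsq (JF *m (w u1 - w u2)) <= nsq (JE *m (u1 - u2)),
      (forall u h, nsq (JF *m (L u *m h)) <= 2 * nsq (JE *m h)) /\
      (forall U, C1_on U w),
      forall u, differentiable w u /\
        ('d w u : 'cV[R]_d -> 'cV[R]_k) = mulmx (L u)
    & forall u, let x := col_mx u (w u) in
        dsubmx (Lam x + N x) = L u *m usubmx (Lam x + N x)].
Proof.
move=> al0 albe.
(* A weight strictly between [al] and [be]. The choice of [th] gives
   [(1 + th) * ga <= (be + ga) / 2], which keeps the second weight below [be]. *)
pose ga := (2 * al + be) / 3.
have alga : al < ga by rewrite /ga; lra.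
have gabe : ga < be by rewrite /ga; lra.
have ga0 : 0 < ga by lra.
pose th := Num.min 1 ((be - ga) / (2 * ga)).
have bg0 : 0 < be - ga by lra.
have th0 : 0 < th.
  rewrite lt_min ltr01 /=; apply: divr_gt0 => //; exact: mulr_gt0.
have th1 : th <= 1 by rewrite ge_min lexx.
have ga'be : (1 + th) * ga < be.
  have : th <= (be - ga) / (2 * ga) by rewrite ge_min lexx orbT.
  by rewrite ler_pdivlMr ?mulr_gt0 //; lra.
have ga'0 : al < (1 + th) * ga by have := mulr_gt0 th0 ga0; lra.
have c1 := lp_const_gt0 alga gabe.
have c2 := lp_const_gt0 ga'0 ga'be.
have bg : 0 < (be - ga) ^+ 2 / 2 by apply: divr_gt0; [exact: exprn_gt0|].
pose m1 := (lp_const al be ga)^-1 / 4.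
pose m2 := (lp_const al be ((1 + th) * ga))^-1 / 4.
(* The first bound makes the graph 1-Lipschitz in the adapted norms; [m1] and [m2] are the
   contraction conditions at the two weights. *)
exists (Num.min ((be - ga) ^+ 2 / 2) (Num.min m1 m2)).
  by rewrite !lt_min bg !divr_gt0 ?invr_gt0.
move=> N N' e B e0; rewrite !le_min => /and3P[e1 e2 e3] B0 N0 Nlip Nt N'lip N'0 N'c.
have ce : lp_const al be ga * e <= 1 / 4.
  apply: le_trans (ler_wpM2l (ltW c1) e2) _.
  by rewrite /m1 mulrA divff ?gt_eqF.
have ce' : lp_const al be ((1 + th) * ga) * e <= 1 / 4.
  apply: le_trans (ler_wpM2l (ltW c2) e3) _.
  by rewrite /m2 mulrA divff ?gt_eqF.
pose w := slow_graph JE'J JF'J hE hF ga0 th0 alga ga'be e0 ce N0 Nlip.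
pose L := slow_graph_deriv JE'J JF'J hE hF ga0 th0 alga ga'be e0 ce N0 Nlip N'lip N'c.
have [D D0 HD] := @slow_graph_taylor R d k mE mF JE JE' JF JF' LE LF al be JE'J
  JF'J hE hF ga th ga0 th0 th1 alga ga'be N N' e B e0 B0 ce ce' N0 Nlip Nt N'lip N'c.
have [CE CE0 HCE] := nsq_mulmx_bound JE.
have [CF CF0 HCF] := left_inverse_bound JF'J.
have HT u h : nsq (w (u + h) - w u - L u *m h) <=
    (CF * (D * CE `^ (1 + th))) * nsq h `^ (1 + th).
  apply: le_trans (HCF _) _; rewrite -!mulrA ler_pM2l //.
  apply: le_trans (HD u h) _; rewrite ler_wpM2l //.
  rewrite -(powRM _ (ltW CE0) (nsq_ge0 h)); apply: ge0_ler_powR.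
  - lra.
  - by rewrite nnegrE nsq_ge0.
  - by rewrite nnegrE mulr_ge0 ?nsq_ge0 // ltW.
  - exact: HCE.
have C0 : 0 <= CF * (D * CE `^ (1 + th)) by rewrite !mulr_ge0 ?powR_ge0 // ltW.
have wd u := taylor_differentiable C0 th0 HT u.
exists w, L; split.
- by split; [exact: slow_graph0|exact: slow_graph_deriv0].
- move=> u1 u2; apply: le_trans (slow_graph_lip _ _ _ _ _ _ _ _ _ _ _ _ u1 u2) _.
  rewrite -[leRHS]mul1r ler_wpM2r ?nsq_ge0 // ler_pdivrMr; last lra.
  lra.
- split; last by move=> U; exact (@taylor_C1_on R d k w L _ th C0 th0 HT U).
  by move=> u h; exact: slow_graph_deriv_le.
- exact: wd.
- move=> u x.
  have [z [zd z0 zg]] := slow_graph_backward JE'J JF'J hE hF ga0 th0 alga ga'be e0 ce N0 Nlip u.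
  pose F s := w (usubmx (z s)) - dsubmx (z s).
  have ux : usubmx (z 0) = u by rewrite z0 col_mxKu.
  have Fd : is_derive (0 : R) 1 F
      (L u *m usubmx (Lam x + N x) - dsubmx (Lam x + N x)).
    rewrite z0 in zd; apply: is_deriveB; last exact: is_derive_dsubmx.
    have ud := is_derive_usubmx zd.
    have [wd1 wd2] := wd u.
    by apply: (is_derive_comp_diff _ _ ud); rewrite ux.
  have F0 s : s <= 0 -> F s = 0 by move=> s0; rewrite /F zg // subrr.
  by move/eqP: (derive_left0 Fd F0); rewrite subr_eq0 => /eqP ->.
Qed.

End SlowManifold.

(** * Forward dynamics near the fixed point *)

Section ForwardCurves.
Variable R : realType.

Lemma within_itv_le (T : topologicalType) (y : R -> T) (a : R) :
  {within `[0, +oo[, continuous y} -> {within `[0, a], continuous y}.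
Proof.
apply: continuous_subspaceW => t /=; rewrite !in_itv /= => /andP[-> _] //.
Qed.

Lemma within_comp (T U : topologicalType) (A : set R) (y : R -> T) (h : T -> U) :
  {within A, continuous y} -> continuous h ->
  {within A, continuous (fun t => h (y t))}.
Proof. by move=> yc hc t; apply: (@cvg_comp _ _ _ y h _ _ _ (yc t)); exact: hc. Qed.

Lemma exponential_decay (y dy : R -> R) (c : R) : {within `[0, +oo[, continuous y} ->
  (forall t : R, 0 < t -> is_derive t 1 y (dy t)) ->
  (forall t, 0 < t -> dy t <= - c * y t) ->
  forall t, 0 <= t -> y t <= expR (- c * t) * y 0.
Proof.
move=> yc yd H t t0; rewrite -[X in - c * X]subr0.
by apply: gronwall (within_itv_le (a := t) yc) _ _ => // s;
  rewrite in_itv /= => /andP[s0 _]; [exact: yd|exact: H].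
Qed.

(** Up to the infimum [s0] of the times where [y] is at least [r], the differential inequality is
    available and gives [y s0 <= y 0]; continuity then keeps [y] below [r] a little longer,
    contradicting the choice of [s0]. *)
Lemma trapped_below (y dy : R -> R) (c r : R) : 0 <= c ->
  {within `[0, +oo[, continuous y} ->
  (forall t, 0 <= t -> 0 <= y t) ->
  (forall t : R, 0 < t -> is_derive t 1 y (dy t)) ->
  (forall t, 0 < t -> y t < r -> dy t <= - c * y t) ->
  y 0 < r -> forall t, 0 <= t -> y t < r.
Proof.
move=> c0 yc y0 yd H yr t t0; rewrite ltNge; apply/negP => rt.
pose S := [set s | 0 <= s /\ r <= y s].
have St : S t by [].
have lbS : lbound S 0 by move=> s [].
have hS : has_inf S by split; [exists t|exists 0].
pose s0 := inf S.
have s00 : 0 <= s0 by apply: lb_le_inf => //; exists t.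
have before s : 0 <= s -> s < s0 -> y s < r.
  move=> s0' ss; rewrite ltNge; apply/negP => rs.
  have : s0 <= s by apply: ge_inf; [exact: hS.2|].
  by rewrite leNgt ss.
have ys0 : y s0 <= y 0.
  have := @gronwall R c y dy 0 s0 s00 (within_itv_le yc).
  have h1 s : s \in `]0, s0[ -> is_derive s 1 y (dy s).
    by rewrite in_itv /= => /andP[? _]; exact: yd.
  have h2 s : s \in `]0, s0[ -> dy s <= - c * y s.
    rewrite in_itv /= => /andP[sp ss]; apply: H => //; apply: before => //; exact: ltW.
  move=> /(_ h1 h2) /le_trans; apply.
  rewrite ler_piMl ?y0 // expR_le1 subr0 mulNr oppr_le0 mulr_ge0 //.
have ylt : y s0 < r by exact: le_lt_trans ys0 yr.
have := yc s0.
have s0in : s0 \in `[0, +oo[%classic by rewrite inE /= in_itv /= s00.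
move=> /(cvgr_lt _) /(_ _ ylt).
rewrite /nbhs /= /nbhs_subspace /= s0in => /nbhs_ballP [e /= e0 He].
have [s Ss ss] := inf_adherent e0 hS.
have s0s : s0 <= s by apply: ge_inf => //; exact: hS.2.
have : y s < r.
  apply: (He s); last by rewrite /= in_itv /= Ss.1.
  rewrite /ball /= distrC ger0_norm ?subr_ge0 //; rewrite -/s0 in ss; lra.
by rewrite ltNge Ss.2.
Qed.

Lemma cvg_nsqJ (T : Type) (F : set_system T) (FF : Filter F) m n
  (J : 'M[R]_(m, n)) (f : T -> 'cV[R]_n) (l : 'cV[R]_n) :
  f @ F --> l -> (fun x => nsq (J *m f x)) @ F --> nsq (J *m l).
Proof.
move=> fl; have /(@cvg_mxP R _ F FF) h : (fun x => J *m f x) @ F --> J *m l.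
  by apply: cvg_mulmx => //; exact: cvg_cst.
by apply: cvg_fsum => i; apply: cvgM; exact: h.
Qed.

End ForwardCurves.

Section Forward.
Variables (R : realType) (d k mE mF : nat).
Variables (JE : 'M[R]_(mE, d)) (JF : 'M[R]_(mF, k)).
Variables (LE : 'M[R]_d) (LF : 'M[R]_k) (mu : R).
Hypothesis mu0 : 0 < mu.
Hypothesis hE : forall x, dot (JE *m x) (JE *m (LE *m x)) <= - mu * nsq (JE *m x).
Hypothesis hF : forall x, dot (JF *m x) (JF *m (LF *m x)) <= - mu * nsq (JF *m x).
Local Notation V := 'cV[R]_(d + k).
Local Notation q := (adapted JE JF).
Local Notation Lam := (block_lin LE LF).
Variables (N : V -> V) (e : R).
Hypotheses (e0 : 0 <= e) (ele : e <= mu ^+ 2 / 12) (N0 : N 0 = 0).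
Hypothesis Nlip : forall x y, q (N x - N y) <= e * q (x - y).

Lemma adapted_continuous : continuous q.
Proof.
move=> x; apply: (@cvgD _ _ _ (nbhs x)); apply: (@cvg_nsqJ _ _ (nbhs x)).
  exact: usubmx_continuous.
exact: dsubmx_continuous.
Qed.

Let Nq x : q (N x) <= e * q x.
Proof. by have := Nlip x 0; rewrite N0 !subr0. Qed.

(** The constant 12 in [ele] serves three estimates. The most demanding is [graph_attracts], where
    the nonlinearity costs [4 * e / mu <= mu / 3] and a rate [mu / 2] must remain. *)
Let emu : e / mu <= mu / 12.
Proof.
rewrite ler_pdivrMr // (le_trans ele) // le_eqVlt; apply/orP; left; apply/eqP.
by field.
Qed.

Lemma is_derive_adapted (z : R -> V) (t : R) dz : is_derive t 1 z dz ->
  is_derive t 1 (fun s => q (z s))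
   (2 * dot (JE *m usubmx (z t)) (JE *m usubmx dz) +
    2 * dot (JF *m dsubmx (z t)) (JF *m dsubmx dz)).
Proof.
move=> zd; apply: is_deriveD.
  exact: is_derive_nsqJ (is_derive_usubmx zd).
exact: is_derive_nsqJ (is_derive_dsubmx zd).
Qed.

Lemma adapted_dissipation (x : V) :
  2 * dot (JE *m usubmx x) (JE *m usubmx (Lam x + N x)) +
  2 * dot (JF *m dsubmx x) (JF *m dsubmx (Lam x + N x)) <= - (mu / 2) * q x.
Proof.
rewrite !linearD /= /block_lin col_mxKu col_mxKd !dotDr.
have h1 := hE (usubmx x); have h2 := hF (dsubmx x).
have h3 := young (JE *m usubmx x) (JE *m usubmx (N x)) mu0.
have h4 := young (JF *m dsubmx x) (JF *m dsubmx (N x)) mu0.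
have h5 : (nsq (JE *m usubmx (N x)) + nsq (JF *m dsubmx (N x))) / mu <= mu / 12 * q x.
  rewrite -[nsq _ + nsq _]/(q (N x)).
  have i0 : 0 <= mu^-1 by rewrite invr_ge0 ltW.
  have := ler_wpM2r i0 (Nq x).
  have := ler_wpM2r (adapted_ge0 JE JF x) emu.
  lra.
rewrite mulrDl in h5.
have := mulr_ge0 (ltW mu0) (adapted_ge0 JE JF x).
rewrite {2 3}/adapted /adapted in h5 *; lra.
Qed.

Variable z : R -> V.
Hypothesis zc : {within `[0, +oo[, continuous z}.

(** [G] stands for the true field, known to equal the truncated one only where [q] is below [r].
    Dissipation keeps the orbit in this region, which later makes the truncated equation valid for
    the true flow. *)
Lemma adapted_trapped (r : R) (G : V -> V) :
  (forall t : R, 0 < t -> is_derive t 1 z (G (z t))) ->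
  (forall x, q x < r -> G x = Lam x + N x) ->
  q (z 0) < r -> forall t, 0 <= t -> q (z t) < r.
Proof.
move=> zd GN; apply: (@trapped_below R (fun t => q (z t)) (fun t =>
   2 * dot (JE *m usubmx (z t)) (JE *m usubmx (G (z t))) +
    2 * dot (JF *m dsubmx (z t)) (JF *m dsubmx (G (z t)))) (mu / 2)).
- by rewrite divr_ge0 // ltW.
- exact: within_comp zc adapted_continuous.
- by move=> t _; exact: adapted_ge0.
- by move=> t /zd; exact: is_derive_adapted.
- by move=> t t0 qr; rewrite GN //; exact: adapted_dissipation.
Qed.

Hypothesis zd : forall t : R, 0 < t -> is_derive t 1 z (Lam (z t) + N (z t)).

Lemma adapted_decay t : 0 <= t -> q (z t) <= q (z 0).
Proof.
move=> t0; have := @exponential_decay R (fun t => q (z t)) _ (mu / 2)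
  (within_comp zc adapted_continuous) (fun t t0 => is_derive_adapted (zd t0))
  (fun t _ => adapted_dissipation (z t)) t t0.
move=> /le_trans; apply; rewrite ler_piMl ?adapted_ge0 // expR_le1 mulNr oppr_le0.
by rewrite !mulr_ge0 // ltW.
Qed.

(* Where nsq (JE u) reaches r, q z < 2 r makes the E-part dominate, so that the
   dissipation beats the nonlinearity. *)
Lemma usub_trapped (r : R) : 0 < r -> nsq (JE *m usubmx (z 0)) < r ->
  q (z 0) < 2 * r -> forall t, 0 <= t -> nsq (JE *m usubmx (z t)) < r.
Proof.
move=> r0 ur qr t t0.
(* Above the level [r / 2] the dissipation dominates, so a positive excess [y] decays and the E-part
   stays below the larger of its initial size and [r / 2]. *)
pose y t := nsq (JE *m usubmx (z t)) - r / 2.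
pose dy t := 2 * dot (JE *m usubmx (z t)) (JE *m usubmx (Lam (z t) + N (z t))).
have yd (s : R) : 0 < s -> is_derive s 1 y (dy s).
  move=> s0; have h := is_derive_nsqJ JE (is_derive_usubmx (zd s0)).
  rewrite -[dy s]subr0; apply: is_deriveB.
have yc : {within `[0, +oo[, continuous y}.
  apply: (within_comp (h := fun x : V => nsq (JE *m usubmx x) - r / 2) zc) => x.
  apply: (@cvgB _ _ _ (nbhs x)); last exact: cvg_cst.
  apply: (@cvg_nsqJ _ _ (nbhs x)); exact: usubmx_continuous.
have H s : 0 < s -> dy s <= - mu * y s.
  move=> s0; rewrite /dy /y !linearD /= /block_lin col_mxKu !dotDr.
  have h1 := hE (usubmx (z s)).
  have h3 := young (JE *m usubmx (z s)) (JE *m usubmx (N (z s))) mu0.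
  have h5 : nsq (JE *m usubmx (N (z s))) / mu <= mu / 12 * (2 * r).
    have i0 : 0 <= mu^-1 by rewrite invr_ge0 ltW.
    have g1 := le_trans (nsqE_le_adapted JE JF (N (z s))) (Nq (z s)).
    have g2 := ler_wpM2r i0 g1.
    have g3 := ler_wpM2r (adapted_ge0 JE JF (z s)) emu.
    have g4 := le_lt_trans (adapted_decay (ltW s0)) qr.
    have m12 : 0 <= mu / 12 by rewrite divr_ge0 // ltW.
    have := ler_wpM2l m12 (ltW g4); lra.
  have := mulr_gt0 mu0 r0; lra.
have := exponential_decay yc yd H t0; rewrite /y => D.
have e1 : expR (- mu * t) <= 1 by rewrite expR_le1 mulNr oppr_le0 mulr_ge0 // ltW.
have e2 := expR_gt0 (- mu * t).
set E := expR _ in D e1 e2.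
have [h|h] := leP (nsq (JE *m usubmx (z 0)) - r / 2) 0.
  have := mulr_ge0_le0 (ltW e2) h; lra.
have := ler_wpM2r (ltW h) e1; lra.
Qed.

Section Graph.
Variables (w : 'cV[R]_d -> 'cV[R]_k) (L : 'cV[R]_d -> 'M[R]_(k, d)).
Hypothesis wd : forall u, differentiable w u /\
        ('d w u : 'cV[R]_d -> 'cV[R]_k) = mulmx (L u).
Hypothesis Lle : forall u h, nsq (JF *m (L u *m h)) <= 2 * nsq (JE *m h).
Hypothesis inv : forall u, let x := col_mx u (w u) in
        dsubmx (Lam x + N x) = L u *m usubmx (Lam x + N x).

(** Compare [z] with the point [x] of the graph over the same E-part. By tangency at [x] only the
    difference of the fields survives; [z - x] has no E-part, so the difference of [N] is small
    relative to the offset itself, and the decay rate of F wins. *)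
Lemma graph_attracts t : 0 <= t ->
  nsq (JF *m (dsubmx (z t) - w (usubmx (z t)))) <=
  expR (- (mu / 2) * t) * nsq (JF *m (dsubmx (z 0) - w (usubmx (z 0)))).
Proof.
move=> t0.
pose eta (x : V) := dsubmx x - w (usubmx x).
have etac : continuous eta.
  move=> x; apply: (@cvgB _ _ _ (nbhs x)); first exact: dsubmx_continuous.
  have h := @usubmx_continuous R d k 1 x.
  apply: (@cvg_comp _ _ _ _ w _ _ _ h).
  exact: differentiable_continuous (wd _).1.
pose deta s := dsubmx (Lam (z s) + N (z s)) - L (usubmx (z s)) *m usubmx (Lam (z s) + N (z s)).
have etad (s : R) : 0 < s -> is_derive s 1 (fun s => eta (z s)) (deta s).
  move=> s0; have h := zd s0; apply: is_deriveB; first exact: is_derive_dsubmx.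
  have [w1 w2] := wd (usubmx (z s)).
  exact: is_derive_comp_diff w1 w2 (is_derive_usubmx h).
apply: (@exponential_decay R (fun s => nsq (JF *m eta (z s)))
   (fun s => 2 * dot (JF *m eta (z s)) (JF *m deta s)) (mu / 2)) => //.
- apply: (within_comp (h := fun x : V => nsq (JF *m eta x)) zc) => x.
  by apply: (@cvg_nsqJ _ _ (nbhs x)); exact: etac.
- by move=> s s0; apply: is_derive_nsqJ; exact: etad.
move=> s s0.
pose u := usubmx (z s); pose x := col_mx u (w u); pose h := z s - x.
have zE : z s = x + h by rewrite addrC subrK.
have uh : usubmx h = 0 by rewrite /h linearB /= col_mxKu subrr.
have dh : dsubmx h = eta (z s) by rewrite /h linearB /= col_mxKd.
pose dN := N (z s) - N x.
have qdN : q dN <= e * nsq (JF *m eta (z s)).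
  apply: le_trans (Nlip _ _) _; rewrite -/h /adapted uh dh mulmx0 nsq0 add0r //.
have E : deta s = LF *m eta (z s) + (dsubmx dN - L u *m usubmx dN).
  have := inv u; rewrite /deta -/u /=; rewrite -/x => I.
  have -> : Lam (z s) + N (z s) = (Lam x + N x) + (Lam h + dN).
    have -> : Lam (z s) = Lam x + Lam h.
      by have := block_linB LE LF (z s) x; rewrite -/h => ->; rewrite addrC subrK.
    by rewrite /dN; apply/matrixP => i j; rewrite !mxE; ring.
  have -> : dsubmx (Lam x + N x + (Lam h + dN)) =
      dsubmx (Lam x + N x) + (LF *m dsubmx h + dsubmx dN).
    by rewrite [LHS]linearD /= [dsubmx (Lam h + dN)]linearD /= {2}/block_lin col_mxKd.
  have -> : usubmx (Lam x + N x + (Lam h + dN)) =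
      usubmx (Lam x + N x) + usubmx dN.
    rewrite [LHS]linearD /= [usubmx (Lam h + dN)]linearD /= {2}/block_lin col_mxKu.
    by rewrite uh mulmx0 add0r.
  rewrite I dh [L u *m (_ + _)]mulmxDr.
  by rewrite opprD addrACA subrr add0r addrA.
rewrite E [JF *m (LF *m _ + _)]mulmxDr [JF *m (dsubmx dN - _)]mulmxBr dotDr dotDr dotNr.
have h1 := hF (eta (z s)).
have h2 := young (JF *m eta (z s)) (JF *m dsubmx dN - JF *m (L u *m usubmx dN)) mu0.
rewrite dotDr dotNr in h2.
have h3 := nsqB_le (JF *m dsubmx dN) (JF *m (L u *m usubmx dN)).
have h4 := Lle u (usubmx dN).
have Q0 := nsq_ge0 (JF *m eta (z s)).
have h5 : nsq (JF *m dsubmx dN - JF *m (L u *m usubmx dN)) <= 4 * (e * nsq (JF *m eta (z s))).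
  have := nsq_ge0 (JF *m dsubmx dN); rewrite /adapted in qdN; lra.
have i0 : 0 <= mu^-1 by rewrite invr_ge0 ltW.
have h6 := ler_wpM2r i0 h5.
have h7 := ler_wpM2r Q0 emu.
have := mulr_ge0 (ltW mu0) Q0.
lra.
Qed.

End Graph.

(** The deviation from the linear flow starts at 0 and is forced by [N (z t)], which is quadratic in
    the initial size because [q] does not increase. The bound is uniform in time: [b] is a level at
    which dissipation balances this forcing. *)
Lemma usub_linearization (B : R) : 0 <= B ->
  (forall x, q (N x) <= B * q x ^+ 2) -> forall t, 0 <= t ->
  nsq (JE *m (usubmx (z t) - mexp (t *: LE) *m usubmx (z 0))) <=
  B / mu ^+ 2 * q (z 0) ^+ 2.
Proof.
move=> B0 NB t t0.
pose b := B * q (z 0) ^+ 2 / mu ^+ 2.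
have b0 : 0 <= b by rewrite !mulr_ge0 ?invr_ge0 ?exprn_ge0 ?adapted_ge0 // ltW.
pose u s := usubmx (z s) - mexp (s *: LE) *m usubmx (z 0).
pose du s := LE *m u s + usubmx (N (z s)).
have uc : {within `[0, +oo[, continuous u}.
  move=> s; apply: cvgB.
    exact: (within_comp zc (@usubmx_continuous R d k 1)).
  move: s; apply: continuous_subspaceT => s.
  apply: (@cvg_mulmx _ _ (nbhs s) _ _ _ _ (fun s => mexp (s *: LE))); last exact: cvg_cst.
  exact: is_derive_cont (is_derive_mexp LE s).
have ud (s : R) : 0 < s -> is_derive s 1 u (du s).
  move=> s0; have h := is_derive_usubmx (zd s0).
  have h1 := is_derive_mexp LE s.
  have h2 := is_derive_mulmx h1 (is_derive_cst (usubmx (z 0)) s (1 : R)).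
  rewrite (_ : du s = usubmx (Lam (z s) + N (z s)) -
     (LE *m mexp (s *: LE) *m usubmx (z 0) + mexp (s *: LE) *m 0)).
    exact: is_deriveB.
  rewrite /du /u mulmx0 addr0 [usubmx (Lam _ + _)]linearD /= {1}/block_lin col_mxKu mulmxBr mulmxA.
  by rewrite addrAC.
pose y s := nsq (JE *m u s) - b.
have yc : {within `[0, +oo[, continuous y}.
  apply: (within_comp (h := fun x => nsq (JE *m x) - b) uc) => x.
  apply: (@cvgB _ _ _ (nbhs x)); last exact: cvg_cst.
  by apply: (@cvg_nsqJ _ _ (nbhs x)); exact: cvg_id.
pose dy s := 2 * dot (JE *m u s) (JE *m du s).
have yd (s : R) : 0 < s -> is_derive s 1 y (dy s).
  move=> s0; have h := is_derive_nsqJ JE (ud s s0).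
  rewrite -[dy s]subr0; apply: is_deriveB.
have H s : 0 < s -> dy s <= - mu * y s.
  move=> s0; rewrite /dy /y /du mulmxDr dotDr.
  have h1 := hE (u s).
  have h3 := young (JE *m u s) (JE *m usubmx (N (z s))) mu0.
  have h5 : nsq (JE *m usubmx (N (z s))) / mu <= mu * b.
    rewrite ler_pdivrMr //.
    have -> : mu * b * mu = B * q (z 0) ^+ 2 by rewrite /b; field; rewrite gt_eqF.
    apply: le_trans (nsqE_le_adapted JE JF _) _; apply: le_trans (NB _) _.
    rewrite ler_wpM2l // lerXn2r ?nnegrE ?adapted_ge0 //.
    exact: adapted_decay (ltW s0).
  lra.
have := exponential_decay yc yd H t0.
rewrite /y {2}/u scale0r mexp0 mul1mx subrr mulmx0 nsq0 => D.
have : 0 <= expR (- mu * t) * b by rewrite mulr_ge0 ?expR_ge0.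
rewrite mulrAC -/b -/(u t); lra.
Qed.

End Forward.

(** * Cutting off the nonlinearity *)

Section ScalarCutoff.
Variable R : realType.
Implicit Types s a b : R.

Let pos s : R := Num.max s 0.

(* A C^{1,1} saturation: the primitive of a trapezoid equal to 1 on [-1, 1]. *)
Definition saturation s : R :=
  s - pos (s - 1) ^+ 2 / 2 + pos (s - 2) ^+ 2 / 2
    + pos (- s - 1) ^+ 2 / 2 - pos (- s - 2) ^+ 2 / 2.

Definition dsaturation s : R :=
  1 - pos (s - 1) + pos (s - 2) - pos (- s - 1) + pos (- s - 2).

Let posE s : (0 <= s /\ pos s = s) \/ (s <= 0 /\ pos s = 0).
Proof. by rewrite /pos; case: (leP s 0) => h; [right|left; split=> //; exact: ltW]. Qed.

Let saturationE s :
  [\/ [/\ s <= - 2, saturation s = - (3 / 2) & dsaturation s = 0],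
      [/\ - 2 <= s, s <= - 1, saturation s = s + (s + 1) ^+ 2 / 2 & dsaturation s = s + 2],
      [/\ - 1 <= s, s <= 1, saturation s = s & dsaturation s = 1] |
      [/\ 1 <= s, s <= 2, saturation s = s - (s - 1) ^+ 2 / 2 & dsaturation s = 2 - s] \/
      [/\ 2 <= s, saturation s = 3 / 2 & dsaturation s = 0]].
Proof.
rewrite /saturation /dsaturation.
case: (posE (s - 1)) => -[h1 ->]; case: (posE (s - 2)) => -[h2 ->];
case: (posE (- s - 1)) => -[h3 ->]; case: (posE (- s - 2)) => -[h4 ->]; try (exfalso; lra).
- by apply: Or44; right; split; [lra|field|ring].
- by apply: Or44; left; split; [lra|lra|field|ring].
- by apply: Or41; split; [lra|field|ring].
- by apply: Or42; split; [lra|lra|field|ring].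
- by apply: Or43; split; [lra|lra|field|ring].
Qed.

Lemma saturation_id s : `|s| <= 1 -> saturation s = s.
Proof.
rewrite ler_norml => /andP[h1 h2].
have [[h ->]|[h h' ->]|[h h' ->]|[[h h' ->]|[h ->]]] := saturationE s; nra.
Qed.

Lemma saturation_le s : `|saturation s| <= 2.
Proof.
rewrite ler_norml; apply/andP.
have [[h ->]|[h h' ->]|[h h' ->]|[[h h' ->]|[h ->]]] := saturationE s; split; nra.
Qed.

Lemma dsaturation_le s : `|dsaturation s| <= 1.
Proof.
rewrite ler_norml; apply/andP.
have [[h _ ->]|[h h' _ ->]|[h h' _ ->]|[[h h' _ ->]|[h _ ->]]] := saturationE s; split; lra.
Qed.

Lemma saturation_lip a b : `|saturation a - saturation b| <= `|a - b|.
Proof.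
wlog ab : a b / b <= a => [H|].
  by have [|/ltW] := leP b a => /H //; rewrite distrC [X in _ <= X]distrC.
rewrite [X in _ <= X]ger0_norm ?subr_ge0 // ler_norml; apply/andP.
have [[h1 ->]|[h1 h1' ->]|[h1 h1' ->]|[[h1 h1' ->]|[h1 ->]]] := saturationE a;
have [[h2 ->]|[h2 h2' ->]|[h2 h2' ->]|[[h2 h2' ->]|[h2 ->]]] := saturationE b;
 split; nra.
Qed.

Lemma saturation_taylor s h :
  `|saturation (s + h) - saturation s - dsaturation s * h| <= 2 * h ^+ 2.
Proof.
(* Each of the four truncated parabolas has a derivative with Lipschitz constant 1 and contributes
   at most [h ^+ 2 / 2]; [Q] is the mirrored case. *)
have P c : `|pos (c + h) ^+ 2 / 2 - pos c ^+ 2 / 2 - pos c * h| <= h ^+ 2 / 2.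
  rewrite ler_norml; apply/andP.
  by case: (posE (c + h)) => -[h1 ->]; case: (posE c) => -[h2 ->]; split; nra.
have Q c : `|pos (c - h) ^+ 2 / 2 - pos c ^+ 2 / 2 + pos c * h| <= h ^+ 2 / 2.
  rewrite ler_norml; apply/andP.
  by case: (posE (c - h)) => -[h1 ->]; case: (posE c) => -[h2 ->]; split; nra.
have := P (s - 1); have := P (s - 2); have := Q (- s - 1); have := Q (- s - 2).
rewrite /saturation /dsaturation.
have -> : s + h - 1 = s - 1 + h by ring.
have -> : s + h - 2 = s - 2 + h by ring.
have -> : - (s + h) - 1 = - s - 1 - h by ring.
have -> : - (s + h) - 2 = - s - 2 - h by ring.
rewrite !ler_norml => /andP[? ?] /andP[? ?] /andP[? ?] /andP[? ?].
by apply/andP; split; lra.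
Qed.

End ScalarCutoff.

Section Cutoff.
Variables (R : realType) (n : nat) (G : 'cV[R]_n -> 'cV[R]_n) (G' : 'cV[R]_n -> 'M[R]_n).
Variables (r0 M : R).
Hypotheses (r00 : 0 < r0) (M0 : 0 <= M) (G0 : G 0 = 0) (G'0 : G' 0 = 0).
Hypothesis Gtaylor : forall x y, `|x| <= r0 -> `|y| <= r0 ->
  nsq (G x - G y - G' y *m (x - y)) <= M * nsq (x - y) ^+ 2.
Hypothesis G'lip : forall x y h, `|x| <= r0 -> `|y| <= r0 ->
  nsq ((G' x - G' y) *m h) <= M * nsq (x - y) * nsq h.

Lemma norm_le_coord m (x : 'cV[R]_m) (b : R) : 0 <= b ->
  (forall i, `|x i 0| <= b) -> `|x| <= b.
Proof.
move=> b0 H; rewrite [leLHS]/Num.Def.normr /= mx_normrE bigmax_le //= => -[i j] _ /=.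
by rewrite (ord1 j).
Qed.

(** The argument of [G], not its value, is truncated: [rho] saturates every coordinate at scale [r].
    It does not increase distances, and on its image [G'] is of order [r], so the squared Lipschitz
    constant of the composition is of order [r ^+ 2]. *)
Lemma cutoff (e : R) : 0 < e ->
  exists (r : R) (N : 'cV[R]_n -> 'cV[R]_n) (N' : 'cV[R]_n -> 'M[R]_n) (B : R),
  [/\ 0 < r /\ (forall x, `|x| <= r -> N x = G x), 0 <= B,
      forall x y, nsq (N x - N y) <= e * nsq (x - y),
      forall x h, nsq (N (x + h) - N x - N' x *m h) <= B * nsq h ^+ 2
    & (forall x h, nsq (N' x *m h) <= e * nsq h) /\ N' 0 = 0 /\ continuous N'].
Proof.
move=> e0.
(* The 40 is [2 * 16 + 2 * 4]: the Taylor remainder costs [16 * n%:R * r ^+ 2] by the diameter of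
   the image of [rho], the linear term [4 * n%:R * r ^+ 2] by its radius, and [nsqD_le] doubles
   both. *)
pose c : R := 40 * M * n%:R + 1.
have n0 : 0 <= n%:R :> R by [].
have Mn0 : 0 <= M * n%:R by rewrite mulr_ge0.
have c0 : 0 < c by rewrite /c; lra.
pose r := Num.min (r0 / 2) (Num.min 1 (e / c)).
have rp : 0 < r by rewrite !lt_min ltr01 !divr_gt0.
have r1 : r <= 1 by rewrite !ge_min lexx orbT.
have rr0 : 2 * r <= r0.
  have : r <= r0 / 2 by rewrite ge_min lexx.
  lra.
have rc : c * r ^+ 2 <= e.
  have : r <= e / c by rewrite !ge_min lexx !orbT.
  rewrite ler_pdivlMr //; have : r ^+ 2 <= r by rewrite expr2 ler_piMl // ltW.
  by move=> h1 h2; have := ler_wpM2l (ltW c0) h1; lra.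
pose rho (x : 'cV[R]_n) : 'cV[R]_n := \col_i (r * saturation (x i 0 / r)).
pose drho (x : 'cV[R]_n) : 'M[R]_n := diag_mx (\row_i dsaturation (x i 0 / r)).
have rne : r != 0 by rewrite gt_eqF.
have rho_norm x : `|rho x| <= 2 * r.
  apply: norm_le_coord => [|i]; first by rewrite mulr_ge0 // ltW.
  by rewrite mxE normrM gtr0_norm // mulrC ler_wpM2r ?saturation_le // ltW.
have rho_dom x : `|rho x| <= r0 by exact: le_trans rr0.
have rho_id x : `|x| <= r -> rho x = x.
  move=> xr; apply/matrixP => i j; rewrite (ord1 j) mxE saturation_id.
    by rewrite mulrCA divff // mulr1.
  rewrite normrM normfV (gtr0_norm rp) ler_pdivrMr // mul1r.
  exact: le_trans (coord_le_norm _ _ _) xr.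
have rho0 : rho 0 = 0 by rewrite rho_id // normr0 ltW.
have rho_lip x y : nsq (rho x - rho y) <= nsq (x - y).
  rewrite !nsqE; apply: ler_sum => i _; rewrite !mxE -mulrBr.
  rewrite -[leLHS]real_normK ?num_real // -[leRHS]real_normK ?num_real //.
  rewrite lerXn2r ?nnegrE // normrM (gtr0_norm rp).
  have := saturation_lip (x i 0 / r) (y i 0 / r).
  rewrite -mulrBl normrM normfV (gtr0_norm rp) ler_pdivlMr //.
  by rewrite mulrC.
have drhoE x h i : (drho x *m h) i 0 = dsaturation (x i 0 / r) * h i 0.
  by rewrite mul_diag_mx !mxE.
have drho_le x h : nsq (drho x *m h) <= nsq h.
  rewrite !nsqE; apply: ler_sum => i _; rewrite drhoE exprMn.
  rewrite ler_piMl ?sqr_ge0 //.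
  have := dsaturation_le (x i 0 / r); rewrite -[_ ^+ 2]real_normK ?num_real // => h1.
  by rewrite expr_le1.
have rho_taylor x h : nsq (rho (x + h) - rho x - drho x *m h) <= 4 / r ^+ 2 * nsq h ^+ 2.
  have -> : 4 / r ^+ 2 * nsq h ^+ 2 = \sum_i (4 / r ^+ 2 * nsq h) * h i 0 ^+ 2.
    by rewrite -mulr_sumr -nsqE; ring.
  rewrite [leLHS]nsqE; apply: ler_sum => i _.
  have -> : (rho (x + h) - rho x - drho x *m h) i 0 =
    r * (saturation (x i 0 / r + h i 0 / r) - saturation (x i 0 / r)
      - dsaturation (x i 0 / r) * (h i 0 / r)).
    have E (a b c' : 'cV[R]_n) : (a - b - c') i 0 = a i 0 - b i 0 - c' i 0.
      by rewrite !mxE.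
    by rewrite E drhoE !mxE mulrDl; field.
  have := saturation_taylor (x i 0 / r) (h i 0 / r); set A := (X in `|X|) => HA.
  have h2 : A ^+ 2 <= (2 * (h i 0 / r) ^+ 2) ^+ 2.
    rewrite -[leLHS]real_normK ?num_real // lerXn2r ?nnegrE //.
    by rewrite mulr_ge0 // sqr_ge0.
  rewrite exprMn; apply: le_trans (ler_wpM2l (sqr_ge0 r) h2) _.
  have -> : r ^+ 2 * (2 * (h i 0 / r) ^+ 2) ^+ 2 = 4 / r ^+ 2 * h i 0 ^+ 2 * h i 0 ^+ 2.
    by field.
  rewrite ler_wpM2r ?sqr_ge0 // ler_wpM2l ?sqr_le_nsq //.
  by rewrite divr_ge0 // sqr_ge0.
have nsq_rho x : nsq (rho x) <= 4 * n%:R * r ^+ 2.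
  apply: le_trans (nsq_le_norm _) _.
  have -> : 4 * n%:R * r ^+ 2 = n%:R * (2 * r) ^+ 2 by ring.
  by rewrite ler_wpM2l // lerXn2r ?nnegrE // mulr_ge0 // ltW.
have r20 := sqr_ge0 r.
have G'le x h : nsq (G' (rho x) *m h) <= 4 * n%:R * r ^+ 2 * M * nsq h.
  have z0 : `|0 : 'cV[R]_n| <= r0 by rewrite normr0 ltW.
  have := G'lip h (rho_dom x) z0; rewrite G'0 !subr0 => /le_trans; apply.
  rewrite ler_wpM2r ?nsq_ge0 // [leRHS]mulrC ler_wpM2l //.
pose N x := G (rho x).
pose N' x := G' (rho x) *m drho x.
pose B := 2 * M + 2 * (4 * n%:R * r ^+ 2 * M) * (4 / r ^+ 2).
have Ntaylor x h : nsq (N (x + h) - N x - N' x *m h) <= B * nsq h ^+ 2.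
  have -> : N (x + h) - N x - N' x *m h =
     (G (rho (x + h)) - G (rho x) - G' (rho x) *m (rho (x + h) - rho x))
     + G' (rho x) *m (rho (x + h) - rho x - drho x *m h).
    rewrite [G' (rho x) *m (_ - drho x *m h)]mulmxBr mulmxA.
    by rewrite [RHS]addrA subrK.
  apply: le_trans (nsqD_le _ _) _.
  have h1 := Gtaylor (rho_dom (x + h)) (rho_dom x).
  have h2 := G'le x (rho (x + h) - rho x - drho x *m h).
  have h3 := rho_taylor x h.
  have h4 := rho_lip (x + h) x; rewrite addrAC subrr add0r in h4.
  have h5 : nsq (rho (x + h) - rho x) ^+ 2 <= nsq h ^+ 2.
    by rewrite lerXn2r ?nnegrE ?nsq_ge0.
  have k0 : 0 <= 4 * n%:R * r ^+ 2 * M by have := mulr_ge0 Mn0 r20; lra.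
  have h6 := ler_wpM2l k0 h3; have h7 := ler_wpM2l M0 h5.
  rewrite /B; lra.
have B0 : 0 <= B.
  have k0 : 0 <= 4 * n%:R * r ^+ 2 * M by have := mulr_ge0 Mn0 r20; lra.
  have k1 : 0 <= 4 / r ^+ 2 by rewrite divr_ge0.
  by apply: addr_ge0; [exact: mulr_ge0|apply: mulr_ge0 => //; exact: mulr_ge0].
exists r, N, N', B; split=> //.
- by split=> // x xr; rewrite /N rho_id.
- move=> x y.
  have h1 := Gtaylor (rho_dom x) (rho_dom y).
  have h2 := G'le y (rho x - rho y).
  have h4 := rho_lip x y; have h5 := nsq_ge0 (rho x - rho y).
  have h6 : nsq (rho x - rho y) <= 16 * n%:R * r ^+ 2.
    apply: le_trans (nsqB_le _ _) _.
    by have := nsq_rho x; have := nsq_rho y; lra.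
  have -> : N x - N y = (G (rho x) - G (rho y) - G' (rho y) *m (rho x - rho y))
      + G' (rho y) *m (rho x - rho y) by rewrite subrK.
  apply: le_trans (nsqD_le _ _) _.
  have h7 : M * nsq (rho x - rho y) ^+ 2 <= M * (16 * n%:R * r ^+ 2) * nsq (rho x - rho y).
    by rewrite -mulrA ler_wpM2l // expr2 ler_wpM2r.
  have h8 : 40 * M * n%:R * r ^+ 2 <= e.
    by apply: le_trans rc; rewrite ler_wpM2r // /c; lra.
  have h9 := ler_wpM2r h5 h8.
  have h10 := ler_wpM2l (ltW e0) h4.
  lra.
- split; last split.
  + move=> x h; rewrite /N' -mulmxA; apply: le_trans (G'le _ _) _.
    have h8 : 4 * n%:R * r ^+ 2 * M <= e.
      apply: le_trans rc; have := mulr_ge0 Mn0 r20; rewrite /c; lra.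
    have k0 : 0 <= 4 * n%:R * r ^+ 2 * M by have := mulr_ge0 Mn0 r20; lra.
    apply: le_trans (ler_wpM2l k0 (drho_le x h)) _.
    by rewrite ler_wpM2r ?nsq_ge0.
  + by rewrite /N' rho0 G'0 mul0mx.
  (* Continuity of [N'] is a consequence of the uniform Taylor bound just proved, with Hoelder
     exponent 1. *)
  + apply: (@taylor_deriv_continuous R n n N N' B 1 B0 ltr01) => x h.
    by rewrite (_ : 1 + 1 = 2%:R) // powR_mulrn ?nsq_ge0.
Qed.

End Cutoff.

(** * Adapted norms and the spectral splitting *)

Section LyapunovForm.
Variable R : realType.

Lemma fin_pos_min p (f : 'I_p -> R) : (forall i, 0 < f i) ->
  exists2 eta : R, 0 < eta & forall i, eta <= f i.
Proof.
move=> f0; exists (\big[Num.min/1]_i f i).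
  by elim/big_ind : _ => // x y x0 y0; rewrite lt_min x0.
by move=> i; rewrite (bigD1 i) //= ge_min lexx.
Qed.

(** With [z = u + i v] the middle term is the real part of the Hermitian product of [z] with
    [(A + i B) z]. Imaginary parts of diagonal entries drop out, and an off-diagonal entry
    contributes at most [eta] times the sum of the two squared moduli. *)
Lemma near_diagonal_form p (A B : 'M[R]_p) (a b eta : R) : 0 <= eta ->
  (forall i, a + 2 * p%:R * eta <= A i i <= b - 2 * p%:R * eta) ->
  (forall i j, i != j -> `|A i j| <= eta /\ `|B i j| <= eta) ->
  forall u v : 'cV[R]_p,
  a * (nsq u + nsq v) <=
    dot u (A *m u - B *m v) + dot v (A *m v + B *m u) <= b * (nsq u + nsq v).
Proof.
move=> eta0 Ad AB u v.
pose s (i : 'I_p) := u i 0 ^+ 2 + v i 0 ^+ 2.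
have s0 i : 0 <= s i by rewrite addr_ge0 ?sqr_ge0.
have sE : nsq u + nsq v = \sum_i s i by rewrite !nsqE -big_split.
pose S i j := A i j * (u i 0 * u j 0 + v i 0 * v j 0)
  + B i j * (v i 0 * u j 0 - u i 0 * v j 0).
have -> : dot u (A *m u - B *m v) + dot v (A *m v + B *m u) = \sum_i \sum_j S i j.
  rewrite -big_split /=; apply: eq_bigr => i _.
  rewrite !mxE !mulrDr !mulrN !mulr_sumr -!sumrN -!big_split /=.
  by apply: eq_bigr => j _; rewrite /S; ring.
have S_off i j : i != j -> - (eta * (s i + s j)) <= S i j <= eta * (s i + s j).
  move=> /AB []; rewrite !ler_norml => /andP[a1 a2] /andP[b1 b2].
  have H (x y z : R) : - eta <= x -> x <= eta ->
      - (eta * (y ^+ 2 + z ^+ 2)) <= 2 * x * (y * z) <= eta * (y ^+ 2 + z ^+ 2).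
    move=> h1 h2; have p1 := sqr_ge0 (y + z); have p2 := sqr_ge0 (y - z).
    have e1 : 0 <= eta + x by lra.
    have e2 : 0 <= eta - x by lra.
    have q1 := mulr_ge0 e1 p1; have q2 := mulr_ge0 e1 p2.
    have q3 := mulr_ge0 e2 p1; have q4 := mulr_ge0 e2 p2.
    apply/andP; split; lra.
  have /andP[h1 h2] := H _ (u i 0) (u j 0) a1 a2.
  have /andP[h3 h4] := H _ (v i 0) (v j 0) a1 a2.
  have /andP[h5 h6] := H _ (v i 0) (u j 0) b1 b2.
  have /andP[h7 h8] := H _ (u i 0) (v j 0) b1 b2.
  rewrite /S /s; apply/andP; split; lra.
have S_diag i : S i i = A i i * s i by rewrite /S /s; ring.
have tot c : \sum_i \sum_j ((j == i)%:R * (c * s i) + eta * (s i + s j)) =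
    (c + 2 * p%:R * eta) * \sum_i s i.
  set X := \sum_i s i.
  rewrite (eq_bigr (fun i => (c + p%:R * eta) * s i + eta * X)) => [|i _].
    rewrite big_split /= -mulr_sumr sumr_const card_ord -/X.
    by rewrite -[eta * X *+ p]mulr_natl; ring.
  rewrite big_split /= (bigD1 i) //= eqxx mul1r big1 ?addr0; last first.
    by move=> j ij; rewrite (negbTE ij) mul0r.
  rewrite -mulr_sumr big_split /= sumr_const card_ord -/X.
  by rewrite -[s i *+ p]mulr_natl; ring.
rewrite sE; apply/andP; split; rewrite -subr_ge0.
  have -> : a = (a + 2 * p%:R * eta) - 2 * p%:R * eta by ring.
  have -> : \sum_i \sum_j S i j - (a + 2 * p%:R * eta - 2 * p%:R * eta) * \sum_i s i =
     \sum_i \sum_j (S i j + ((j == i)%:R * (- (a + 2 * p%:R * eta) * s i) + eta * (s i + s j))).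
    have dd (f g : 'I_p -> 'I_p -> R) : \sum_i \sum_j (f i j + g i j) =
        \sum_i \sum_j f i j + \sum_i \sum_j g i j.
      by rewrite -big_split; apply: eq_bigr => i _; rewrite -big_split.
    by rewrite (dd S) tot; ring.
  apply: sumr_ge0 => i _; apply: sumr_ge0 => j _.
  have [<-|ij] := eqVneq j i.
    rewrite mul1r S_diag; have /andP[h _] := Ad j.
    have := ler_wpM2r (s0 j) h; have := mulr_ge0 eta0 (s0 j); lra.
  rewrite eq_sym in ij; have /andP[h _] := S_off _ _ ij; rewrite mul0r; lra.
have -> : b = (b - 2 * p%:R * eta) + 2 * p%:R * eta by ring.
rewrite -tot -sumrB; apply: sumr_ge0 => i _; rewrite -sumrB; apply: sumr_ge0 => j _.
have [<-|ij] := eqVneq j i.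
  rewrite mul1r S_diag; have /andP[_ h] := Ad j.
  have := ler_wpM2r (s0 j) h; have := mulr_ge0 eta0 (s0 j); lra.
rewrite eq_sym in ij; have /andP[_ h] := S_off _ _ ij; rewrite mul0r; lra.
Qed.

Lemma ReM (x y : R[i]) : complex.Re (x * y) =
  complex.Re x * complex.Re y - complex.Im x * complex.Im y.
Proof. by case: x => ? ?; case: y. Qed.

Lemma ImM (x y : R[i]) : complex.Im (x * y) =
  complex.Re x * complex.Im y + complex.Im x * complex.Re y.
Proof. by case: x => ? ?; case: y. Qed.

Lemma RemxM m n p (A : 'M[R[i]]_(m, n)) (B : 'M[R[i]]_(n, p)) :
  Remx (A *m B) = Remx A *m Remx B - Immx A *m Immx B.
Proof.
apply/matrixP => i j; rewrite !mxE raddf_sum -sumrN -big_split /=.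
by apply: eq_bigr => l _; rewrite ReM !mxE.
Qed.

Lemma ImmxM m n p (A : 'M[R[i]]_(m, n)) (B : 'M[R[i]]_(n, p)) :
  Immx (A *m B) = Remx A *m Immx B + Immx A *m Remx B.
Proof.
apply/matrixP => i j; rewrite !mxE raddf_sum -big_split /=.
by apply: eq_bigr => l _; rewrite ImM !mxE.
Qed.

Lemma Remx_complexify m n (A : 'M[R]_(m, n)) : Remx (complexify A) = A.
Proof. by apply/matrixP => i j; rewrite !mxE. Qed.

Lemma Immx_complexify m n (A : 'M[R]_(m, n)) : Immx (complexify A) = 0.
Proof. by apply/matrixP => i j; rewrite !mxE. Qed.

(* Conjugation by diag (eps^i) makes the off-diagonal entries small. *)
Lemma triangular_scaling p (T : 'M[R[i]]_p) (eta : R) : 0 < eta ->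
  is_trig_mx T -> exists (D T' : 'M[R[i]]_p),
  [/\ D \in unitmx, D *m T = T' *m D, forall i, T' i i = T i i
    & forall i j, i != j -> `|complex.Re (T' i j)| <= eta /\
                            `|complex.Im (T' i j)| <= eta].
Proof.
move=> eta0 /is_trig_mxP Ttrig.
pose f (ij : 'I_p * 'I_p) := (1 + `|complex.Re (T ij.1 ij.2)| + `|complex.Im (T ij.1 ij.2)|).
have f1 ij : 1 <= f ij by rewrite /f -addrA lerDl addr_ge0.
have [s s0 [s1 Hs]] : exists2 s : R, 0 < s & s <= 1 /\ forall i j, s * f (i, j) <= eta.
  have K0 : 1 <= 1 + \sum_ij f ij.
    by rewrite lerDl sumr_ge0 // => ij _; exact: le_trans (f1 ij).
  have Kp : 0 < 1 + \sum_ij f ij by lra.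
  exists (Num.min 1 (eta / (1 + \sum_ij f ij))).
    by rewrite lt_min ltr01 divr_gt0.
  split=> [|i j]; first by rewrite ge_min lexx.
  have h : Num.min 1 (eta / (1 + \sum_ij f ij)) <= eta / (1 + \sum_ij f ij).
    by rewrite ge_min lexx orbT.
  have h2 : f (i, j) <= 1 + \sum_ij f ij.
    rewrite (bigD1 (i, j)) //= ler_wpDl // lerDl sumr_ge0 // => ij _.
    exact: le_trans (f1 ij).
  have f0 : 0 <= f (i, j) by exact: le_trans (f1 _).
  apply: le_trans (ler_wpM2r f0 h) _.
  by rewrite mulrAC ler_pdivrMr // ler_wpM2l // ltW.
have sne : s != 0 by rewrite gt_eqF.
pose c (x : R) : R[i] := real_complex R x.
have cne n : c (s ^+ n) != 0 by rewrite fmorph_eq0 expf_eq0 (negbTE sne) andbF.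
exists (diag_mx (\row_i c (s ^+ i))),
  (\matrix_(i, j) (c (s ^+ i) / c (s ^+ j) * T i j)); split.
- rewrite unitmxE det_diag unitfE; apply/prodf_neq0 => i _.
  by rewrite mxE cne.
- apply/matrixP => i j; rewrite mul_diag_mx mul_mx_diag !mxE.
  by rewrite [RHS]mulrAC divfK ?cne.
- by move=> i; rewrite mxE divff ?cne // mul1r.
move=> i j ij; rewrite mxE.
have [lt_ij|le_ji] := ltnP i j.
  by rewrite Ttrig // mulr0 /= normr0 ltW.
have lt_ji : (j < i)%N by rewrite ltn_neqAle le_ji andbT eq_sym.
have -> : c (s ^+ i) / c (s ^+ j) = c (s ^+ (i - j)).
  have E : s ^+ i = s ^+ (i - j) * s ^+ j by rewrite -exprD subnK.
  by rewrite E /c rmorphM mulfK //; exact: cne.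
have sij : 0 <= s ^+ (i - j) <= s.
  apply/andP; split; first by apply: exprn_ge0; exact: ltW.
  have ij0 : (0 < i - j)%N by rewrite subn_gt0.
  rewrite -(prednK ij0) exprS ler_piMr //; first exact: ltW.
  by apply: exprn_ile1 => //; exact: ltW.
move/andP: sij => [q0 qs]; rewrite ReM ImM /= !mul0r subr0 addr0.
have := Hs i j; rewrite /f /= => H.
have n1 := normr_ge0 (complex.Re (T i j)); have n2 := normr_ge0 (complex.Im (T i j)).
rewrite !normrM (ger0_norm q0).
have g1 := ler_wpM2r n1 qs; have g2 := ler_wpM2r n2 qs.
have g3 := mulr_ge0 (ltW s0) n1; have g4 := mulr_ge0 (ltW s0) n2.
split; lra.
Qed.

(* J stacks the real and imaginary parts of the coordinates that make M nearly
   diagonal over the complex numbers. *)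
Lemma lyapunov_form p (M : 'M[R]_p) (a b : R) :
  (forall l, eigenvalue (complexify M) l -> a < complex.Re l < b) ->
  exists (J : 'M[R]_(p + p, p)) (J' : 'M[R]_(p, p + p)), J' *m J = 1%:M /\
  forall x : 'cV[R]_p,
    a * nsq (J *m x) <= dot (J *m x) (J *m (M *m x)) <= b * nsq (J *m x).
Proof.
(* Schur triangularization asks for positive size; size 0 occurs when there is no fast direction. *)
move=> Hev; have [p0|p0] := posnP p.
  subst p; exists 0, 0; split; first by apply/matrixP => -[].
  by move=> x; rewrite !mul0mx nsq0 !mulr0 /dot big1 ?lexx // => -[].
have [P Pu] := Schur (complexify M) p0.
have {}Pu := unitarymx_unit Pu.
rewrite /similar_to /conjmx pinvmxE // => Ttrig.
set T := (X in is_trig_mx X) in Ttrig.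
have Tev i : a < complex.Re (T i i) < b.
  apply: Hev; have : eigenvalue T (T i i).
    rewrite eigenvalue_root_char char_poly_trig // /root horner_prod.
    by apply/prodf_eq0; exists i => //; rewrite hornerXsubC subrr.
  move=> /eigenvalueP [v vT v0]; apply/eigenvalueP; exists (v *m P).
    have : v *m T *m P = (T i i *: v) *m P by rewrite vT.
    by rewrite /T !mulmxA mulmxKV // -scalemxAl.
  by rewrite -(mul0mx 1 P) (can_eq (mulmxK Pu)).
have gap i : 0 < Num.min (complex.Re (T i i) - a) (b - complex.Re (T i i)).
  by have /andP[h1 h2] := Tev i; rewrite lt_min !subr_gt0 h1.
have [g g0 Hg] := fin_pos_min gap.
pose eta := g / (2 * p%:R).
have p0' : 0 < p%:R :> R by rewrite ltr0n.
have eta0 : 0 < eta by rewrite divr_gt0 // mulr_gt0.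
have etaE : 2 * p%:R * eta = g by rewrite /eta mulrC divfK // gt_eqF // mulr_gt0.
have [D [T' [Du DT T'd T'o]]] := triangular_scaling eta0 Ttrig.
pose S := D *m P.
have Su : S \in unitmx by rewrite unitmx_mul Du.
have ST : S *m complexify M = T' *m S.
  have TP : T *m P = P *m complexify M by rewrite /T mulmxKV.
  by rewrite /S -[LHS]mulmxA -TP [LHS]mulmxA DT -[LHS]mulmxA.
exists (col_mx (Remx S) (Immx S)), (row_mx (Remx (invmx S)) (- Immx (invmx S))).
split.
  rewrite mul_row_col mulNmx -RemxM mulVmx //.
  by apply/matrixP => i j; rewrite !mxE; case: (i == j).
move=> x.
have dcol q1 q2 (x1 y1 : 'cV[R]_q1) (x2 y2 : 'cV[R]_q2) :
    dot (col_mx x1 x2) (col_mx y1 y2) = dot x1 y1 + dot x2 y2.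
  rewrite /dot big_split_ord /=; congr (_ + _); apply: eq_bigr => i _.
    by rewrite !col_mxEu.
  by rewrite !col_mxEd.
rewrite !mul_col_mx dcol nsq_col_mx.
have ReS (y : 'cV[R]_p) : Remx S *m y = Remx (S *m complexify y).
  by rewrite RemxM Remx_complexify Immx_complexify mulmx0 subr0.
have ImS (y : 'cV[R]_p) : Immx S *m y = Immx (S *m complexify y).
  by rewrite ImmxM Remx_complexify Immx_complexify mulmx0 add0r.
have E : S *m complexify (M *m x) = T' *m (S *m complexify x).
  by rewrite /complexify map_mxM [LHS]mulmxA -/(complexify M) ST -[LHS]mulmxA.
rewrite !ReS !ImS E [Remx (T' *m _)]RemxM [Immx (T' *m _)]ImmxM.
apply: (near_diagonal_form (ltW eta0)).
- move=> i; rewrite etaE mxE T'd; have := Hg i; rewrite le_min => /andP[h1 h2].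
  by apply/andP; split; lra.
- by move=> i j ij; rewrite !mxE; exact: T'o.
Qed.

End LyapunovForm.

(** * Annihilating polynomials of the slow and fast directions *)

Section Annihilators.
Variables (C : fieldType) (n : nat) (M : 'M[C]_n).
Implicit Types (ls : seq C).

(* Polynomials in M with listed roots stand in for generalized eigenspaces:
   splitting by the roots never needs the multiplicities. *)
Definition ann ls : 'M[C]_n := foldr (fun l P => (M - l%:M) *m P) 1%:M ls.

Lemma ann_cat ls ls' : ann (ls ++ ls') = ann ls *m ann ls'.
Proof. by elim: ls => [|l ls IH] /=; rewrite ?mul1mx // IH mulmxA. Qed.

Lemma ann_commM ls : M *m ann ls = ann ls *m M.
Proof.
elim: ls => [|l ls IH] /=; first by rewrite mulmx1 mul1mx.
have c : M *m (M - l%:M) = (M - l%:M) *m M by rewrite mulmxBr mulmxBl scalar_mxC.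
by rewrite mulmxA c -mulmxA IH mulmxA.
Qed.

Lemma ann_comm1 ls l : (M - l%:M) *m ann ls = ann ls *m (M - l%:M).
Proof. by rewrite mulmxBl mulmxBr ann_commM scalar_mxC. Qed.

Lemma ann_comm ls ls' : ann ls *m ann ls' = ann ls' *m ann ls.
Proof.
elim: ls => [|l ls IH] /=; first by rewrite mulmx1 mul1mx.
by rewrite -mulmxA IH mulmxA ann_comm1 mulmxA.
Qed.

Lemma ann_eigen m l (v : 'M[C]_(n, m)) ls : M *m v = l *: v ->
  ann ls *m v = (\prod_(l' <- ls) (l - l')) *: v.
Proof.
move=> Mv; elim: ls => [|l' ls IH] /=; first by rewrite big_nil scale1r mul1mx.
rewrite big_cons -mulmxA IH -scalemxAr mulmxBl Mv mul_scalar_mx -scalerBl.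
by rewrite scalerA mulrC.
Qed.

Lemma ann_eigen_row m l (v : 'M[C]_(m, n)) ls : v *m M = l *: v ->
  v *m ann ls = (\prod_(l' <- ls) (l - l')) *: v.
Proof.
move=> Mv; elim: ls => [|l' ls IH] /=; first by rewrite big_nil scale1r mulmx1.
rewrite big_cons mulmxA mulmxBr Mv mul_mx_scalar -scalerBl -scalemxAl IH.
by rewrite scalerA.
Qed.

Lemma prod_sub_neq0 l ls : l \notin ls -> \prod_(l' <- ls) (l - l') != 0.
Proof.
move=> lls; rewrite prodf_seq_neq0; apply/allP => l' l'ls /=.
by rewrite subr_eq0; apply: contraNneq lls => ->.
Qed.

(** Peeling off a root [l] of [ls] leaves a vector on which [M] acts as [l]; there [ann ls'] is
    multiplication by a product of nonzero differences, so the vector is 0. *)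
Lemma ann_disjoint m (v : 'M[C]_(n, m)) ls ls' :
  (forall l, l \in ls -> l \notin ls') ->
  ann ls *m v = 0 -> ann ls' *m v = 0 -> v = 0.
Proof.
elim: ls => [|l ls IH] /= dis; first by rewrite mul1mx.
rewrite -mulmxA mulmxBl mul_scalar_mx => /eqP; rewrite subr_eq0 => /eqP wE v0.
have w0 : ann ls' *m (ann ls *m v) = 0 by rewrite mulmxA ann_comm -mulmxA v0 mulmx0.
move: w0; rewrite (ann_eigen _ wE) => /eqP.
rewrite scaler_eq0 (negbTE (prod_sub_neq0 (dis _ (mem_head _ _)))) /= => /eqP h.
by apply: IH => // l' l'ls; apply: dis; rewrite inE l'ls orbT.
Qed.

(** Biorthogonality of left and right generalized eigenvectors with disjoint roots. On the kernel of
    [ann ls'] the row [w *m ann ls] behaves as a left eigenvector for [l]; composing it with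
    [ann ls'] gives a nonzero multiple of itself, which must vanish. *)
Lemma ann_pairing m r (w : 'M[C]_(m, n)) ls ls' :
  (forall l, l \in ls -> l \notin ls') -> w *m ann ls = 0 ->
  forall v : 'M[C]_(n, r), ann ls' *m v = 0 -> w *m v = 0.
Proof.
move=> dis wls.
have : forall v : 'M[C]_(n, r), ann ls' *m v = 0 -> w *m ann ls *m v = 0.
  by move=> v _; rewrite wls mul0mx.
elim: ls {wls} dis => [|l ls IH] /= dis H v v0.
  by have := H v v0; rewrite mulmx1.
apply: IH => // [l' l'ls|{v v0} v v0]; first by apply: dis; rewrite inE l'ls orbT.
have E (u : 'M[C]_(n, r)) : ann ls' *m u = 0 ->
    w *m ann ls *m (M *m u) = l *: (w *m ann ls *m u).
  move=> u0; have := H u u0.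
  rewrite ann_comm1 !mulmxA mulmxBr mulmxBl mul_mx_scalar -scalemxAl.
  by move/eqP; rewrite subr_eq0 -!mulmxA => /eqP.
have stab (u : 'M[C]_(n, r)) : ann ls' *m u = 0 -> ann ls' *m (M *m u) = 0.
  by move=> u0; rewrite mulmxA -ann_commM -mulmxA u0 mulmx0.
have E2 ms (u : 'M[C]_(n, r)) : ann ls' *m u = 0 ->
    ann ls' *m (ann ms *m u) = 0 /\
    w *m ann ls *m (ann ms *m u) = (\prod_(l' <- ms) (l - l')) *: (w *m ann ls *m u).
  move=> u0; elim: ms => [|l' ms [IH1 IH2]] /=.
    by rewrite big_nil scale1r mul1mx.
  rewrite -mulmxA mulmxBl mul_scalar_mx; split.
    by rewrite mulmxBr stab // -scalemxAr IH1 scaler0 subr0.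
  by rewrite mulmxBr E // -scalemxAr -scalerBl IH2 scalerA big_cons.
have [_] := E2 ls' v v0; rewrite v0 mulmx0 => /esym/eqP.
by rewrite scaler_eq0 (negbTE (prod_sub_neq0 (dis _ (mem_head _ _)))) /= => /eqP.
Qed.

Lemma ann_nseq l j : ann (nseq j l) = (M - l%:M) ^+ j.
Proof. by elim: j => [|j IH] /=; rewrite ?expr0 // exprS -IH mulmxE. Qed.

End Annihilators.

Lemma ann_conj (C : fieldType) n r (M : 'M[C]_n) (L : 'M[C]_r) (S : 'M[C]_(n, r)) ls :
  M *m S = S *m L -> ann M ls *m S = S *m ann L ls.
Proof.
move=> MS; elim: ls => [|l ls IH] /=; first by rewrite mul1mx mulmx1.
by rewrite -mulmxA IH !mulmxA mulmxBl mulmxBr MS scalar_mxC.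
Qed.

Section RealAnn.
Variables (R : realType) (n : nat) (A : 'M[R]_n).
Local Notation Ac := (complexify A).

Lemma conj_ann (v : 'cV[R[i]]_n) ls : ann Ac ls *m v = 0 ->
  ann Ac (map conjc ls) *m map_mx conjc v = 0.
Proof.
move=> H; have -> : ann Ac (map conjc ls) = map_mx conjc (ann Ac ls).
  elim: ls {H} => [|l ls IH] /=; first by rewrite map_mx1.
  rewrite map_mxM IH map_mxB map_scalar_mx; congr ((_ - _) *m _).
  by apply/matrixP => i j; rewrite !mxE /= oppr0.
by rewrite -map_mxM H map_mx0.
Qed.

Lemma complexify_Re (v : 'M[R[i]]_(n, 1)) :
  complexify (Remx v) = 2^-1 *: (v + map_mx conjc v).
Proof.
by apply/matrixP => i j; rewrite !mxE ReJ_add mulrC.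
Qed.

Lemma complexify_Im (v : 'M[R[i]]_(n, 1)) :
  complexify (Immx v) = (2^-1 * 'i%C) *: (map_mx conjc v - v).
Proof.
by apply/matrixP => i j; rewrite !mxE ImJ_sub; ring.
Qed.
End RealAnn.

Lemma unitmx_inj (F : fieldType) p (M : 'M[F]_p) :
  (forall a : 'cV[F]_p, M *m a = 0 -> a = 0) -> M \in unitmx.
Proof.
move=> H; rewrite -unitmx_tr -row_free_unit -kermx_eq0.
apply/rowV0P => v /sub_kermxP vM; apply: trmx_inj; rewrite trmx0; apply: H.
by apply: trmx_inj; rewrite trmx_mul trmxK vM trmx0.
Qed.

Section RealImaginary.
Variable R : realType.

Lemma complexify_inj m n : injective (@complexify R m n).
Proof.
by move=> A B /matrixP H; apply/matrixP => i j; have := H i j; rewrite !mxE => -[].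
Qed.

Lemma complexify0 m n : complexify (0 : 'M[R]_(m, n)) = 0.
Proof. by rewrite /complexify map_mx0. Qed.

Lemma complexifyM m n p (A : 'M[R]_(m, n)) (B : 'M[R]_(n, p)) :
  complexify (A *m B) = complexify A *m complexify B.
Proof. by rewrite /complexify map_mxM. Qed.

Lemma complexify_free m n (T : 'M[R]_(m, n)) :
  (forall a : 'cV[R]_n, T *m a = 0 -> a = 0) ->
  forall q (y : 'M[R[i]]_(n, q)), complexify T *m y = 0 -> y = 0.
Proof.
move=> Tinj q y H; apply/matrixP => i j.
have Hj : complexify T *m col j y = 0.
  by rewrite colE mulmxA H mul0mx.
have re : Remx (col j y) = 0.
  apply: Tinj; have := congr1 (@Remx R _ _) Hj.
  rewrite RemxM Remx_complexify Immx_complexify mul0mx subr0 => ->.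
  by apply/matrixP => ? ?; rewrite !mxE.
have im : Immx (col j y) = 0.
  apply: Tinj; have := congr1 (@Immx R _ _) Hj.
  rewrite ImmxM Remx_complexify Immx_complexify mul0mx addr0 => ->.
  by apply/matrixP => ? ?; rewrite !mxE.
move/matrixP/(_ i 0): re; move/matrixP/(_ i 0): im; rewrite !mxE.
by case: (y i j) => a b /= -> ->.
Qed.

Lemma trmx_ann (C : fieldType) n (M : 'M[C]_n) ls : (ann M ls)^T = ann M^T ls.
Proof.
elim: ls => [|l ls IH] /=; first by rewrite trmx1.
by rewrite trmx_mul IH linearB /= tr_scalar_mx ann_comm1.
Qed.

Lemma ann_flatten (C : fieldType) n q (M : 'M[C]_n) (ss : seq (seq C)) s
  (v : 'M[C]_(n, q)) : s \in ss -> ann M s *m v = 0 -> ann M (flatten ss) *m v = 0.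
Proof.
elim: ss => [//|s' ss IH] /=; rewrite inE => /orP[/eqP <-|sss] H.
  by rewrite ann_cat ann_comm -mulmxA H mulmx0.
by rewrite ann_cat -mulmxA IH // mulmx0.
Qed.

(** [Remx v] and [Immx v] mix [v] with its conjugate, which for real [A] is annihilated by the
    conjugate roots; both kinds of roots are listed. Only real parts are tracked, because
    conjugation preserves them and the gap separates by them. *)
Lemma ann_re_im n p q (A : 'M[R]_n) (mu : 'I_q -> R[i]) (T : 'M[R]_(n, p)) :
  (forall j, exists i v, gen_eigenvector A (mu i) v /\
    (col j T = Remx v \/ col j T = Immx v)) ->
  exists ls : seq R[i], (forall l, l \in ls -> exists i, complex.Re l = complex.Re (mu i)) /\
    ann (complexify A) ls *m complexify T = 0.
Proof.
move=> H.
have Hj j : exists ls, (forall l, l \in ls -> exists i, complex.Re l = complex.Re (mu i)) /\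
    ann (complexify A) ls *m complexify (col j T) = 0.
  have [i [v [[_ [r Hr]] TE]]] := H j.
  have a1 : ann (complexify A) (nseq r (mu i)) *m v = 0 by rewrite ann_nseq.
  have a2 := conj_ann a1.
  exists (nseq r (mu i) ++ map conjc (nseq r (mu i))); split.
    move=> l; rewrite mem_cat map_nseq !mem_nseq => /orP[] /andP[_ /eqP ->];
      by exists i => //; case: (mu i).
  have k1 : ann (complexify A) (nseq r (mu i) ++ map conjc (nseq r (mu i))) *m v = 0.
    by rewrite ann_cat ann_comm -mulmxA a1 mulmx0.
  have k2 : ann (complexify A) (nseq r (mu i) ++ map conjc (nseq r (mu i)))
      *m map_mx conjc v = 0 by rewrite ann_cat -mulmxA a2 mulmx0.
  case: TE => ->.
    by rewrite complexify_Re -scalemxAr mulmxDr k1 k2 addr0 scaler0.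
  by rewrite complexify_Im -scalemxAr mulmxBr k1 k2 subr0 scaler0.
pose f j := projT1 (cid (Hj j)).
have fP j := projT2 (cid (Hj j)).
exists (flatten [seq f j | j <- enum 'I_p]); split.
  by move=> l /flattenP [s /mapP [j _ ->]]; exact: (fP j).1.
apply/matrixP => i j; rewrite [RHS]mxE.
have : ann (complexify A) (flatten [seq f j | j <- enum 'I_p]) *m complexify (col j T) = 0.
  apply: (@ann_flatten _ _ _ _ _ (f j)); last exact: (fP j).2.
  by apply: map_f; rewrite mem_enum.
move=> /matrixP /(_ i 0); rewrite [RHS]mxE => <-.
by rewrite !mxE; apply: eq_bigr => l _; rewrite !mxE.
Qed.

Lemma ann_re_im_row n p q (A : 'M[R]_n) (mu : 'I_q -> R[i]) (P : 'M[R]_(p, n)) :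
  (forall j, exists i w, gen_left_eigenvector A (mu i) w /\
    (row j P = Remx w \/ row j P = Immx w)) ->
  exists ls : seq R[i], (forall l, l \in ls -> exists i, complex.Re l = complex.Re (mu i)) /\
    complexify P *m ann (complexify A) ls = 0.
Proof.
have cT m' n' (B : 'M[R]_(m', n')) : (complexify B)^T = complexify B^T.
  by apply/matrixP => i j; rewrite !mxE.
move=> H; have [|ls [h1 h2]] := @ann_re_im n p q A^T mu P^T.
  move=> j; have [i [w [[w0 [r Hr]] Pw]]] := H j.
  exists i, w^T; split.
    split; first by apply: contraNneq w0 => w0; rewrite -(trmxK w) w0 trmx0.
    exists r; rewrite -ann_nseq; apply: trmx_inj; rewrite trmx_mul trmx_ann trmxK trmx0.
    by rewrite cT !trmxK ann_nseq.
  by rewrite -tr_row; case: Pw => ->; [left|right]; apply/matrixP => a b; rewrite !mxE.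
exists ls; split=> //; apply: trmx_inj; rewrite trmx_mul trmx_ann trmx0 -h2.
by rewrite !cT.
Qed.

Lemma mulmx_cols n p (T : 'M[R]_(n, p)) (a : 'cV[R]_p) :
  T *m a = \sum_j a j 0 *: col j T.
Proof.
apply/matrixP => i j; rewrite (ord1 j) mxE summxE; apply: eq_bigr => l _.
by rewrite !mxE mulrC.
Qed.

Lemma free_cols n p (T : 'M[R]_(n, p)) :
  free [seq col j T | j <- enum 'I_p] -> forall a : 'cV[R]_p, T *m a = 0 -> a = 0.
Proof.
move=> fr a; rewrite mulmx_cols => Ha.
have sz : size [seq col j T | j <- enum 'I_p] == p.
  by rewrite size_map size_enum_ord.
have nthE (i : 'I_p) : (Tuple sz)`_i = col i T.
  by rewrite /= (nth_map i) ?size_enum_ord // nth_ord_enum.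
have /freeP H : free (Tuple sz) by [].
apply/matrixP => i j; rewrite (ord1 j) mxE; apply: (H (fun i => a i 0)).
by under eq_bigr do rewrite nthE.
Qed.

Lemma span_cols n p (T : 'M[R]_(n, p)) (v : 'cV[R]_n) :
  v \in <<[seq col j T | j <- enum 'I_p]>>%VS <-> exists u, v = T *m u.
Proof.
have sz : size [seq col j T | j <- enum 'I_p] == p.
  by rewrite size_map size_enum_ord.
have nthE (i : 'I_p) : (Tuple sz)`_i = col i T.
  by rewrite /= (nth_map i) ?size_enum_ord // nth_ord_enum.
split=> [vE|[u ->]]; last first.
  rewrite mulmx_cols; apply: memv_suml => j _; apply/memvZ/memv_span.
  by apply: map_f; rewrite mem_enum.
have : v \in <<Tuple sz>>%VS by [].
move=> /coord_span E; exists (\col_i coord (Tuple sz) i v).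
rewrite mulmx_cols [LHS]E; apply: eq_bigr => i _.
by rewrite mxE nthE.
Qed.

Lemma cjacobian_mulmx p q (g : 'cV[R]_p -> 'cV[R]_q) (x v : 'cV[R]_p) :
  cjacobian g x *m v = 'd g x v.
Proof.
rewrite mulmx_cols {2}(_ : v = \sum_j v j 0 *: delta_mx j 0); last first.
  by apply/matrixP => i j; rewrite (ord1 j) summxE (bigD1 i) //= !mxE !eqxx mulr1
    big1 ?addr0 // => l li; rewrite !mxE eq_sym (negbTE li) mulr0.
rewrite linear_sum; apply: eq_bigr => j _; rewrite linearZ; congr (_ *: _).
by apply/matrixP => i l; rewrite (ord1 l) !mxE.
Qed.

Lemma image_dim_unit n p (f : {linear 'cV[R]_n -> 'cV[R]_p}) (M : 'M[R]_(p, n))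
  (T : 'M[R]_(n, p)) (E : {vspace 'cV[R]_n}) :
  (forall v, M *m v = f v) -> basis_of E [seq col j T | j <- enum 'I_p] ->
  \dim (linfun f @: E) = p -> M *m T \in unitmx.
Proof.
move=> Mf /andP[/eqP <- _] dimE; apply: unitmx_inj; apply: free_cols.
rewrite (_ : [seq col j (M *m T) | j <- enum 'I_p] =
   map (linfun f) [seq col j T | j <- enum 'I_p]); last first.
  by rewrite -[RHS]map_comp; apply: eq_map => j /=; rewrite lfunE /= -Mf !colE mulmxA.
by rewrite /free -limg_span dimE 2!size_map size_enum_ord.
Qed.

End RealImaginary.

Section SpectralSplitting.
Variables (R : realType) (d k : nat).
Variables (A : 'M[R]_(d + k)) (lam : 'I_(d + k) -> R[i]).
Hypotheses (hd : (0 < d)%N) (gap : stable_spectral_gap d lam).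

(** [mu] is half the slowest decay rate. [b'] merely lies below all fast real parts, for the
    two-sided interval in [lyapunov_form]. *)
Lemma gap_constants : exists al be mu b' : R,
  [/\ 0 < mu, mu <= be, 0 < al, al < be &
    (forall i : 'I_d, - al < complex.Re (lam (lshift k i)) < - mu) /\
    (forall j : 'I_k, b' < complex.Re (lam (rshift d j)) < - be)].
Proof.
have [sorted gp neg] := gap.
pose i1 : 'I_d := Ordinal (_ : (d.-1 < d)%N).
have pd : (d.-1 < d)%N by rewrite prednK.
pose il := lshift k (Ordinal pd); pose i0 := lshift k (Ordinal hd).
pose r := complex.Re (lam il); pose s := complex.Re (lam i0).
have r0 : r < 0 by exact: neg.
have s0 : s < 0 by exact: neg.
have rs : r <= s by exact: sorted.
have slow (i : 'I_d) : r <= complex.Re (lam (lshift k i)) <= s.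
  by rewrite !sorted //= -ltnS prednK.
pose b' := - 1 - \sum_(j < k) `|complex.Re (lam (rshift d j))|.
have b'P (j : 'I_k) : b' < complex.Re (lam (rshift d j)).
  have h1 : 0 <= \sum_(i < k | i != j) `|complex.Re (lam (rshift d i))| by exact: sumr_ge0.
  have h2 := ler_norm (- complex.Re (lam (rshift d j))); rewrite normrN in h2.
  by rewrite /b' [X in _ - X < _](bigD1 j) //=; lra.
have [k0|k0] := posnP k.
  (* Without fast eigenvalues there is no gap to respect, and [be] is just some number above
     [al]. *)
  exists (- r + 1), (- r + 2), (- s / 2), b'; split; try lra.
  split=> [i|j]; first by have /andP[] := slow i; lra.
  by have := ltn_ord j; rewrite {2}k0.
pose jf := rshift d (Ordinal k0); pose r' := complex.Re (lam jf).
have rr' : r' < r by apply: gp => //=; rewrite ?addn0.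
have fast (j : 'I_k) : complex.Re (lam (rshift d j)) <= r'.
  by apply: sorted; rewrite /= addn0 leq_addr.
(* [- al] and [- be] divide the gap between [r'] and [r] into thirds. *)
exists (- (2 * r + r') / 3), (- (r + 2 * r') / 3), (- s / 2), b'; split; try lra.
split=> [i|j]; first by have /andP[] := slow i; lra.
by rewrite b'P /=; have := fast j; lra.
Qed.

Variables (E Fsp : {vspace 'cV[R]_(d + k)}).
Variables (TE : 'M[R]_(d + k, d)) (TF : 'M[R]_(d + k, k)).
Hypothesis hTE : right_basis A (fun i : 'I_d => lam (lshift k i)) E TE.
Hypothesis hTF : right_basis A (fun i : 'I_k => lam (rshift d i)) Fsp TF.
Variables (PE : 'M[R]_(d, d + k)) (PF : 'M[R]_(k, d + k)).
Hypothesis hPE : left_basis A (fun i : 'I_d => lam (lshift k i)) PE.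
Hypothesis hPF : left_basis A (fun i : 'I_k => lam (rshift d i)) PF.
Variable LambdaE : 'M[R]_d.
Hypothesis hLambdaE : LambdaE = ulsubmx (invmx (row_mx TE TF) *m A *m row_mx TE TF).

(** An injective [T] intertwining [L] with [A] transfers the annihilating polynomial to [L], and an
    eigenvalue of [L] must be one of its roots. *)
Lemma eigen_in_list p (T : 'M[R]_(d + k, p)) (L : 'M[R]_p) ls l :
  (forall a : 'cV[R]_p, T *m a = 0 -> a = 0) -> A *m T = T *m L ->
  ann (complexify A) ls *m complexify T = 0 -> eigenvalue (complexify L) l -> l \in ls.
Proof.
move=> Tf AT lsT /eigenvalueP [v vL v0].
have L0 : ann (complexify L) ls = 0.
  apply: (complexify_free Tf); rewrite -(ann_conj ls (M := complexify A)) //.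
  by rewrite -!complexifyM AT.
apply: contraT => lls; have := ann_eigen_row ls vL; rewrite L0 mulmx0 => /esym/eqP.
by rewrite scaler_eq0 (negbTE (prod_sub_neq0 lls)) (negbTE v0).
Qed.

(** The slow and fast annihilators have disjoint root lists, so their kernels meet only in 0. As [T]
    is square, this already gives its invertibility, then the block form of [A]; the mixed products
    vanish by [ann_pairing]. No dimensions of eigenspaces are compared. *)
Lemma spectral_splitting : exists (LF : 'M[R]_k),
  let T := row_mx TE TF in
  [/\ T \in unitmx, A *m T = T *m block_mx LambdaE 0 0 LF,
      PE *m TF = 0 /\ PF *m TE = 0, PE *m TE \in unitmx /\ PF *m TF \in unitmx
    & exists al be mu : R,
      [/\ 0 < mu, mu <= be, 0 < al, al < be &
       (exists (JE : 'M[R]_(d + d, d)) (JE' : 'M[R]_(d, d + d)), JE' *m JE = 1%:M /\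
         forall x : 'cV[R]_d, - al * nsq (JE *m x) <= dot (JE *m x) (JE *m (LambdaE *m x))
            <= - mu * nsq (JE *m x)) /\
       (exists (JF : 'M[R]_(k + k, k)) (JF' : 'M[R]_(k, k + k)), JF' *m JF = 1%:M /\
         forall x : 'cV[R]_k, dot (JF *m x) (JF *m (LF *m x)) <= - be * nsq (JF *m x))]].
Proof.
have [al [be [mu [b' [mu0 mube al0 albe [slow fast]]]]]] := gap_constants.
have [bTE gTE] := hTE; have [bTF gTF] := hTF.
have fTE : forall a : 'cV[R]_d, TE *m a = 0 -> a = 0.
  by apply: free_cols; exact: basis_free bTE.
have fTF : forall a : 'cV[R]_k, TF *m a = 0 -> a = 0.
  by apply: free_cols; exact: basis_free bTF.
have [ls [lsP lsT]] := ann_re_im gTE.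
have [lf [lfP lfT]] := ann_re_im gTF.
have [us [usP usT]] := ann_re_im_row hPE.2.
have [uf [ufP ufT]] := ann_re_im_row hPF.2.
have slowP (ms : seq R[i]) :
    (forall l, l \in ms -> exists i, complex.Re l = complex.Re (lam (lshift k i))) ->
    forall l, l \in ms -> - al < complex.Re l < - mu.
  by move=> H l /H [i ->].
have fastP (ms : seq R[i]) :
    (forall l, l \in ms -> exists i, complex.Re l = complex.Re (lam (rshift d i))) ->
    forall l, l \in ms -> b' < complex.Re l < - be.
  by move=> H l /H [i ->].
have dis (ms mf : seq R[i]) : (forall l, l \in ms -> - al < complex.Re l < - mu) ->
    (forall l, l \in mf -> b' < complex.Re l < - be) ->
    forall l, l \in ms -> l \notin mf.
  move=> h1 h2 l lms; apply/negP => lmf.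
  by have /andP[? ?] := h1 l lms; have /andP[? ?] := h2 l lmf; lra.
have {}lsP := slowP _ lsP; have {}lfP := fastP _ lfP.
have {}usP := slowP _ usP; have {}ufP := fastP _ ufP.
have both q (y : 'M[R]_(d + k, q)) : ann (complexify A) ls *m complexify y = 0 ->
    ann (complexify A) lf *m complexify y = 0 -> y = 0.
  move=> h1 h2; apply: complexify_inj; rewrite complexify0.
  exact: (ann_disjoint (dis _ _ lsP lfP) h1 h2).
pose T := row_mx TE TF.
have kTE q (a : 'M[R]_(d, q)) : ann (complexify A) ls *m complexify (TE *m a) = 0.
  by rewrite complexifyM mulmxA lsT mul0mx.
have kTF q (a : 'M[R]_(k, q)) : ann (complexify A) lf *m complexify (TF *m a) = 0.
  by rewrite complexifyM mulmxA lfT mul0mx.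
have Tu : T \in unitmx.
  apply: unitmx_inj => a; rewrite -[a]vsubmxK mul_row_col => /eqP.
  rewrite addr_eq0 => /eqP Eab.
  have h0 : TE *m usubmx a = 0.
    by apply: both; [exact: kTE|rewrite Eab -mulmxN; exact: kTF].
  move/eqP: Eab; rewrite h0 eq_sym oppr_eq0 => /eqP h1.
  by rewrite (fTE _ h0) (fTF _ h1) col_mx0.
pose Z := invmx T *m A *m T.
have AT : A *m T = T *m Z by rewrite /Z !mulmxA mulmxV // mul1mx.
have ATE : A *m TE = TE *m ulsubmx Z + TF *m dlsubmx Z.
  have := congr1 lsubmx AT; rewrite /T mul_mx_row row_mxKl => ->.
  rewrite -[Z in LHS]submxK -[row_mx TE TF in LHS]/(row_mx TE TF) mul_row_block.
  by rewrite row_mxKl.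
have ATF : A *m TF = TE *m ursubmx Z + TF *m drsubmx Z.
  have := congr1 rsubmx AT; rewrite /T mul_mx_row row_mxKr => ->.
  rewrite -[Z in LHS]submxK mul_row_block.
  by rewrite row_mxKr.
have kA ms q (y : 'M[R]_(d + k, q)) : ann (complexify A) ms *m complexify y = 0 ->
    ann (complexify A) ms *m complexify (A *m y) = 0.
  by move=> h; rewrite complexifyM mulmxA -ann_commM -mulmxA h mulmx0.
have cB p q (x y : 'M[R]_(p, q)) : complexify (x - y) = complexify x - complexify y.
  by rewrite /complexify map_mxB.
have inj_mx p q (S : 'M[R]_(d + k, p)) (y : 'M[R]_(p, q)) :
    (forall a : 'cV[R]_p, S *m a = 0 -> a = 0) -> S *m y = 0 -> y = 0.
  move=> Sf Sy; apply: complexify_inj; rewrite complexify0.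
  by apply: (complexify_free Sf); rewrite -complexifyM Sy complexify0.
(* [TF *m dlsubmx Z] lies in the fast kernel and, being a combination of the columns of [A *m TE]
   and [TE], also in the slow one. *)
have Zdl : dlsubmx Z = 0.
  apply: (inj_mx _ _ _ _ fTF); apply: both; last exact: kTF.
  have -> : TF *m dlsubmx Z = A *m TE - TE *m ulsubmx Z by rewrite ATE addrC addKr.
  by rewrite cB mulmxBr kTE subr0 kA // -[TE]mulmx1 kTE.
have Zur : ursubmx Z = 0.
  apply: (inj_mx _ _ _ _ fTE); apply: both; first exact: kTE.
  have -> : TE *m ursubmx Z = A *m TF - TF *m drsubmx Z by rewrite ATF addrK.
  by rewrite cB mulmxBr kTF subr0 kA // -[TF]mulmx1 kTF.
have ZE : Z = block_mx LambdaE 0 0 (drsubmx Z).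
  by rewrite -[LHS]submxK Zdl Zur hLambdaE.
rewrite Zdl mulmx0 addr0 in ATE; rewrite Zur mulmx0 add0r in ATF.
have dis2 l : l \in uf -> l \notin ls.
  by apply: contraL; exact: (dis _ _ lsP ufP).
have PETF : PE *m TF = 0.
  apply: complexify_inj; rewrite complexifyM complexify0.
  exact: (ann_pairing (dis _ _ usP lfP) usT lfT).
have PFTE : PF *m TE = 0.
  apply: complexify_inj; rewrite complexifyM complexify0.
  exact: (ann_pairing dis2 ufT lsT).
(* [P *m T] has full row rank and one zero block, so its other, square block is invertible. *)
have unitP p (P : 'M[R]_(p, d + k)) (S : 'M[R]_p) (X : 'M[R]_(p, d + k)) :
    row_free P -> P *m T = X -> \rank X = \rank S -> S \in unitmx.
  move=> Pf PT rX; rewrite -row_free_unit /row_free -rX -PT mxrankMfree //.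
  by rewrite row_free_unit.
exists (drsubmx Z); split=> //.
- by rewrite -/T AT -ZE.
- split.
    apply: (unitP _ PE _ (row_mx (PE *m TE) 0) hPE.1).
      by rewrite /T mul_mx_row PETF.
    by rewrite rank_row_mx0.
  apply: (unitP _ PF _ (row_mx 0 (PF *m TF)) hPF.1).
    by rewrite /T mul_mx_row PFTE.
  by rewrite rank_row_0mx.
exists al, be, mu; split => //; split.
- apply: lyapunov_form => l ev; apply: lsP; apply: (eigen_in_list fTE _ lsT ev).
  by rewrite ATE hLambdaE.
- have [l ev|JF [JF' [h1 h2]]] := @lyapunov_form R k (drsubmx Z) b' (- be).
    by apply: lfP; apply: (eigen_in_list fTF _ lfT ev).
  by exists JF, JF'; split => // x; have /andP[] := h2 x.
Qed.

End SpectralSplitting.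

(** * Quadratic Taylor estimates and the local normal form *)

Section QuadraticRemainder.
Variables (R : realType) (p q : nat).
Implicit Types (x y v : 'cV[R]_p).

Lemma is_derive_segment x v (t : R) :
  is_derive t 1 (fun s => x + s *: v) v.
Proof.
apply/is_derive_mxP => i j.
rewrite (_ : (fun s => _) = fun s : R => x i j + s * v i j); last first.
  by apply/funext => s; rewrite !mxE.
by apply: is_derive_eq; rewrite /GRing.scale /=; ring.
Qed.

Lemma is_derive_along_segment m (g : 'cV[R]_p -> 'cV[R]_m) x v (t : R) :
  differentiable g (x + t *: v) ->
  is_derive t 1 (fun s => g (x + s *: v)) (cjacobian g (x + t *: v) *m v).
Proof.
move=> gd; apply: (is_derive_comp_diff gd _ (is_derive_segment x v t)).
by apply/funext => w; rewrite cjacobian_mulmx.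
Qed.

Lemma segment_norm_le x y (r t : R) : `|x| <= r -> `|y| <= r -> 0 <= t -> t <= 1 ->
  `|y + t *: (x - y)| <= r.
Proof.
move=> xr yr t0 t1; have -> : y + t *: (x - y) = (1 - t) *: y + t *: x.
  by apply/matrixP => i j; rewrite !mxE; ring.
apply: le_trans (ler_normD _ _) _; rewrite !normrZ ger0_norm ?subr_ge0 //.
rewrite (ger0_norm t0); have t1' : 0 <= 1 - t by lra.
by have := ler_wpM2l t1' yr; have := ler_wpM2l t0 xr; lra.
Qed.

Lemma coord_MVT m (g : 'cV[R]_p -> 'cV[R]_m) x y (r : R) (i : 'I_m) :
  (forall z, `|z| <= r -> differentiable g z) -> `|x| <= r -> `|y| <= r ->
  exists t : R, [/\ 0 <= t, t <= 1 & (g x - g y) i 0 =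
    (cjacobian g (y + t *: (x - y)) *m (x - y)) i 0].
Proof.
move=> gd xr yr.
pose z (t : R) := y + t *: (x - y).
have zr (t : R) : t \in `[0, 1] -> `|z t| <= r.
  by rewrite in_itv /= => /andP[t0 t1]; exact: segment_norm_le.
have d (t : R) : t \in `[0, 1] ->
    is_derive t 1 (fun s => g (z s) i 0) ((cjacobian g (z t) *m (x - y)) i 0).
  by move=> /zr /gd /is_derive_along_segment /is_derive_mxP /(_ i 0).
have c : {within `[0, 1], continuous (fun s => g (z s) i 0)}.
  by apply: derivable_within_continuous => t /d[].
have d' (t : R) : t \in `]0, 1[ ->
    is_derive t 1 (fun s => g (z s) i 0) ((cjacobian g (z t) *m (x - y)) i 0).
  by move=> /subset_itv_oo_cc; exact: d.
have [t t01 E] := MVT_segment ler01 d' c.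
move: t01; rewrite in_itv /= => /andP[t0 t1]; exists t; split=> //.
rewrite -/(z t) -[RHS]mulr1 -[X in _ * X](subr0 1) -E /z scale1r scale0r addr0.
by rewrite [y + _]addrC subrK !mxE.
Qed.

Lemma nsq_segment x y (t : R) : 0 <= t -> t <= 1 ->
  nsq (y + t *: (x - y) - y) <= nsq (x - y).
Proof.
move=> t0 t1; rewrite addrAC subrr add0r nsqZ ler_piMl ?nsq_ge0 //.
by rewrite expr_le1.
Qed.

Lemma lt_sum2 (m : nat) (a : 'I_m -> 'I_m -> R) (j l : 'I_m) :
  (forall i i', 0 <= a i i') -> a j l < \sum_i \sum_i' a i i' + 1.
Proof.
move=> a0; rewrite (bigD1 j) //= (bigD1 l) //=.
have s1 : 0 <= \sum_(i < m | i != l) a j i by exact: sumr_ge0.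
have s2 : 0 <= \sum_(i < m | i != j) \sum_l0 a i l0.
  by apply: sumr_ge0 => i _; exact: sumr_ge0.
by lra.
Qed.

(** Second partial derivatives are continuous at 0, hence bounded by some [K] on a ball, so the
    Jacobian is Lipschitz there. A second mean value argument, for [g] minus its linearization at
    [y], then gives the quadratic remainder. *)
Lemma C2_quadratic (U : set 'cV[R]_p) (g : 'cV[R]_p -> 'cV[R]_q) :
  open_nbhs (0 : 'cV[R]_p) U -> C2_on U g ->
  exists r M : R, [/\ 0 < r, 0 <= M, forall x, `|x| <= r -> differentiable g x,
    forall x y, `|x| <= r -> `|y| <= r ->
      nsq (g x - g y - cjacobian g y *m (x - y)) <= M * nsq (x - y) ^+ 2
  & forall x y (h : 'cV[R]_p), `|x| <= r -> `|y| <= r ->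
      nsq ((cjacobian g x - cjacobian g y) *m h) <= M * nsq (x - y) * nsq h].
Proof.
move=> [Uo U0] [g1 g2].
pose e (j : 'I_p) : 'cV[R]_p := delta_mx j 0.
pose H j l x := 'D_(e l) (fun y => 'D_(e j) g y) x.
pose K : R := \sum_j \sum_l `|H j l 0| + 1.
have HK j l : `|H j l 0| < K.
  by apply: (lt_sum2 (a := fun j l => `|H j l 0|)) => ? ?; exact: normr_ge0.
have K0 : 0 < K.
  by rewrite /K ltr_wpDl // sumr_ge0 // => i _; exact: sumr_ge0.
have nearK : \forall x \near (0 : 'cV[R]_p), forall jl : 'I_p * 'I_p, `|H jl.1 jl.2 x| < K.
  apply: (@filter_forall _ ('I_p * 'I_p)%type (fun jl x => `|H jl.1 jl.2 x| < K)
    (nbhs (0 : 'cV[R]_p))) => -[j l] /=.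
  have [_ /(_ (e l)) Hc] := g2 (e j) 0 U0.
  exact: (cvgr_lt _ (cvg_norm Hc) _ (HK j l)).
have nearU : \forall x \near (0 : 'cV[R]_p), U x by exact: open_nbhs_nbhs.
have /nbhs_ballP [r0 /= r00 Hr] : nbhs (0 : 'cV[R]_p)
    ([set x | U x] `&` [set x | forall jl : 'I_p * 'I_p, `|H jl.1 jl.2 x| < K]).
  exact: filterI nearU nearK.
pose r := r0 / 2.
have rp : 0 < r by rewrite divr_gt0.
have inr x : `|x| <= r -> U x /\ forall j l, `|H j l x| < K.
  move=> xr; have xb : ball (0 : 'cV[R]_p) r0 x.
    by rewrite -ball_normE /= sub0r normrN (le_lt_trans xr) // /r; lra.
  have [h1 h2] := Hr x xb.
  exact: (conj h1 (fun j l => h2 (j, l))).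
have gd x : `|x| <= r -> differentiable g x by move=> /inr [/g1 []].
have jE x i j : `|x| <= r -> cjacobian g x i j = 'D_(e j) g x i 0.
  by move=> xr; rewrite mxE deriveE; last exact: gd.
have ed x j : `|x| <= r -> differentiable (fun y => 'D_(e j) g y) x.
  by move=> /inr [Ux _]; have [] := g2 (e j) x Ux.
have jlip x y i j : `|x| <= r -> `|y| <= r ->
    (cjacobian g x i j - cjacobian g y i j) ^+ 2 <= (p%:R * K ^+ 2) * nsq (x - y).
  move=> xr yr.
  have -> : cjacobian g x i j - cjacobian g y i j =
      'D_(e j) g x i 0 - 'D_(e j) g y i 0.
    exact: (congr2 (fun a b : R => a - b) (jE x i j xr) (jE y i j yr)).
  have [t [t0 t1 E]] := coord_MVT i (fun z zr => ed z j zr) xr yr.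
  have -> : 'D_(e j) g x i 0 - 'D_(e j) g y i 0 =
      ('D_(e j) g x - 'D_(e j) g y) i 0.
    by rewrite [RHS]mxE [X in _ = _ + X]mxE.
  rewrite E.
  pose z := y + t *: (x - y).
  have zr : `|z| <= r by exact: segment_norm_le.
  set M := cjacobian _ _.
  have -> : (M *m (x - y)) i 0 = dot (row i M)^T (x - y).
    by rewrite mxE; apply: eq_bigr => l _; rewrite !mxE.
  apply: le_trans (dot_sqr_le _ _) _; rewrite ler_wpM2r ?nsq_ge0 // nsqE.
  apply: (@le_trans _ _ (\sum_(l < p) K ^+ 2)); last first.
    by rewrite sumr_const card_ord mulr_natl.
  apply: ler_sum => l _; rewrite !mxE -deriveE; last exact: ed.
  rewrite -[leLHS]real_normK ?num_real // lerXn2r ?nnegrE ?(ltW K0) //.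
  apply: le_trans (coord_le_norm _ _ _) _; apply/ltW.
  exact: (inr _ zr).2.
pose M := (q%:R * p%:R) * (p%:R * K ^+ 2).
have M0 : 0 <= M by rewrite !mulr_ge0 ?sqr_ge0 ?ler0n ?(ltW K0).
have jM x y (h : 'cV[R]_p) : `|x| <= r -> `|y| <= r ->
    nsq ((cjacobian g x - cjacobian g y) *m h) <= M * nsq (x - y) * nsq h.
  move=> xr yr; apply: le_trans (nsq_mulmx _ _) _; rewrite ler_wpM2r ?nsq_ge0 //.
  apply: (@le_trans _ _ (\sum_(i < q) \sum_(j < p) (p%:R * K ^+ 2 * nsq (x - y)))).
    apply: ler_sum => i _; apply: ler_sum => j _.
    have -> : (cjacobian g x - cjacobian g y) i j =
        cjacobian g x i j - cjacobian g y i j.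
      by rewrite [LHS]mxE [X in _ + X = _]mxE.
    exact: jlip.
  rewrite !sumr_const !card_ord -[leLHS]mulr_natl -(mulr_natl _ p).
  by rewrite le_eqVlt; apply/orP; left; apply/eqP; rewrite /M; ring.
(* The factor [q.+1%:R] covers both estimates: the remainder sums over [q] coordinates, and the
   Jacobian bound asks for at least 1. *)
exists r, (q.+1%:R * M); split; [exact: rp|by rewrite mulr_ge0|exact: gd| |].
  move=> x y xr yr.
  pose G z := g z - cjacobian g y *m z.
  have lc : continuous (mulmx (cjacobian g y) : 'cV[R]_p -> 'cV[R]_q).
    exact: mulmx_continuous.
  have ld z : differentiable (mulmx (cjacobian g y) : 'cV[R]_p -> 'cV[R]_q) z.
    exact: linear_differentiable.
  have Gd z : `|z| <= r -> differentiable G z.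
    by move=> /gd gz; apply: differentiableB.
  have GJ z v : `|z| <= r ->
      cjacobian G z *m v = (cjacobian g z - cjacobian g y) *m v.
    move=> zr; have gz := gd z zr.
    have E1 := congr1 (fun h : 'cV[R]_p -> 'cV[R]_q => h v) (diffB gz (ld z)).
    have E2 := congr1 (fun h : 'cV[R]_p -> 'cV[R]_q => h v) (diff_lin z lc).
    apply: (etrans (cjacobian_mulmx G z v)); apply: (etrans E1).
    apply: (etrans (congr2 (fun a b : 'cV[R]_q => a - b)
      (esym (cjacobian_mulmx g z v)) E2)).
    exact: esym (mulmxBl _ _ _).
  have -> : g x - g y - cjacobian g y *m (x - y) = G x - G y.
    by rewrite /G mulmxBr; apply/matrixP => i j; rewrite !mxE; ring.
  rewrite nsqE.
  apply: (@le_trans _ _ (\sum_(i < q) M * nsq (x - y) ^+ 2)); last first.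
    rewrite sumr_const card_ord -mulrA mulr_natl ler_wpMn2l //.
    by rewrite mulr_ge0 // sqr_ge0.
  apply: ler_sum => i _.
  have [t [t0 t1 ->]] := coord_MVT i Gd xr yr.
  have zr := segment_norm_le xr yr t0 t1.
  apply: le_trans (sqr_le_nsq _ _ _) _; rewrite GJ //.
  apply: le_trans (jM _ _ _ zr yr) _; rewrite expr2 mulrA.
  by rewrite ler_wpM2r ?nsq_ge0 // ler_wpM2l // nsq_segment.
move=> x y h xr yr; apply: le_trans (jM _ _ _ xr yr) _.
have MM : 0 <= M * nsq (x - y) * nsq h.
  by apply: mulr_ge0 (nsq_ge0 _); exact: mulr_ge0 (nsq_ge0 _).
have -> : q.+1%:R * M * nsq (x - y) * nsq h = q.+1%:R * (M * nsq (x - y) * nsq h).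
  by rewrite !mulrA.
by apply: ler_peMl => //; rewrite ler1n.
Qed.

End QuadraticRemainder.

Section LocalNormalForm.
Variable R : realType.

Lemma nbhs0_closed_ball n (A : set 'cV[R]_n) : nbhs (0 : 'cV[R]_n) A ->
  exists2 r : R, 0 < r & forall x : 'cV[R]_n, `|x| <= r -> A x.
Proof.
move=> /nbhs_ballP [r /= r0 Hr]; exists (r / 2) => [|x xr]; first exact: divr_gt0.
by apply: Hr; rewrite -ball_normE /= sub0r normrN; lra.
Qed.

Lemma nbhs0_mulmx m n (M : 'M[R]_(m, n)) (A : set 'cV[R]_m) :
  nbhs (0 : 'cV[R]_m) A -> nbhs (0 : 'cV[R]_n) [set x | A (M *m x)].
Proof. by move=> A0; apply: mulmx_continuous; rewrite mulmx0. Qed.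

Lemma nbhs_norm_ler n (r : R) : 0 < r -> nbhs (0 : 'cV[R]_n) [set x | `|x| <= r].
Proof.
move=> r0; apply/nbhs_ballP; exists r => // x.
by rewrite -ball_normE /= sub0r normrN => /ltW.
Qed.

Variables (d k mE mF : nat).
Variables (JE : 'M[R]_(mE, d)) (JE' : 'M[R]_(d, mE)).
Variables (JF : 'M[R]_(mF, k)) (JF' : 'M[R]_(k, mF)).
Hypotheses (JE'J : JE' *m JE = 1%:M) (JF'J : JF' *m JF = 1%:M).
Variables (LE : 'M[R]_d) (LF : 'M[R]_k) (mu : R).
Hypothesis mu0 : 0 < mu.
Hypothesis hE : forall x, dot (JE *m x) (JE *m (LE *m x)) <= - mu * nsq (JE *m x).
Hypothesis hF : forall x, dot (JF *m x) (JF *m (LF *m x)) <= - mu * nsq (JF *m x).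
Local Notation V := 'cV[R]_(d + k).
Local Notation q := (adapted JE JF).
Local Notation Lam := (block_lin LE LF).
Variables (A T : 'M[R]_(d + k)).
Hypotheses (Tu : T \in unitmx) (AT : A *m T = T *m block_mx LE 0 0 LF).
Variables (f : V -> V) (U : set V).
Hypotheses (f0 : f 0 = 0) (fA : cjacobian f 0 = A).
Hypotheses (U0 : open_nbhs (0 : V) U) (fC2 : C2_on U f).
Local Notation iT := (invmx T).

Lemma block_linE x : Lam x = iT *m (A *m (T *m x)).
Proof.
rewrite (mulmxA A) AT !mulmxA mulVmx // mul1mx -[in RHS](vsubmxK x).
by rewrite mul_block_col !mul0mx addr0 add0r.
Qed.

Lemma nonlinearity_taylor : exists (r M : R) (G : V -> V) (G' : V -> 'M[R]_(d + k)),
  [/\ 0 < r /\ 0 <= M, forall z, iT *m f (T *m z) = Lam z + G z, G 0 = 0 /\ G' 0 = 0,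
    forall x y, `|x| <= r -> `|y| <= r ->
      nsq (G x - G y - G' y *m (x - y)) <= M * nsq (x - y) ^+ 2
  & forall x y h, `|x| <= r -> `|y| <= r ->
      nsq ((G' x - G' y) *m h) <= M * nsq (x - y) * nsq h].
Proof.
have [r1 [M1 [r10 M10 _ ft fl]]] := C2_quadratic U0 fC2.
have [r r0 rr] := nbhs0_closed_ball (nbhs0_mulmx T (nbhs_norm_ler _ r10)).
have [a a0 Ha] := nsq_mulmx_bound iT.
have [b b0 Hb] := nsq_mulmx_bound T.
exists r, (a * M1 * b ^+ 2), (fun z => iT *m f (T *m z) - Lam z),
  (fun z => iT *m (cjacobian f (T *m z) - A) *m T); split.
- by split => //; rewrite !mulr_ge0 ?exprn_ge0 // ltW.
- by move=> z; rewrite addrC subrK.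
- by rewrite !mulmx0 f0 fA block_linE !mulmx0 !subr0 subrr mulmx0 mul0mx.
- move=> x y /rr xr /rr yr.
  set J := cjacobian f (T *m y).
  have -> : iT *m f (T *m x) - Lam x - (iT *m f (T *m y) - Lam y) -
      iT *m (J - A) *m T *m (x - y) =
      iT *m (f (T *m x) - f (T *m y) - J *m (T *m x - T *m y)).
    rewrite !block_linE -!mulmxA -[T *m x - T *m y]mulmxBr.
    rewrite mulmxBl !mulmxBr -!addrA; congr (_ + _).
    by rewrite !opprD !opprK; apply/matrixP => i j; rewrite !mxE; ring.
  apply: le_trans (Ha _) _.
  rewrite (_ : a * M1 * b ^+ 2 * nsq (x - y) ^+ 2 =
    a * (M1 * (b * nsq (x - y)) ^+ 2)); last by ring.
  rewrite ler_wpM2l ?(ltW a0) //.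
  apply: le_trans (ft _ _ xr yr) _; rewrite ler_wpM2l //.
  by rewrite lerXn2r ?nnegrE ?nsq_ge0 ?mulr_ge0 ?nsq_ge0 ?(ltW b0) // -mulmxBr.
move=> x y h /rr xr /rr yr.
rewrite -mulmxBl -mulmxBr opprB addrA subrK -!mulmxA.
apply: le_trans (Ha _) _.
have h1 := fl _ _ (T *m h) xr yr.
have h2 : nsq (T *m x - T *m y) * nsq (T *m h) <= (b * nsq (x - y)) * (b * nsq h).
  by apply: ler_pM; rewrite ?nsq_ge0 // -mulmxBr.
rewrite (_ : a * M1 * b ^+ 2 * nsq (x - y) * nsq h =
  a * (M1 * ((b * nsq (x - y)) * (b * nsq h)))); last by ring.
rewrite ler_wpM2l ?(ltW a0) //; apply: le_trans h1 _.
by rewrite -mulrA ler_wpM2l.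
Qed.

Variables (N : set V) (F : R -> V -> V).
Hypotheses (hN : open_nbhs (0 : V) N) (hF' : flow_on f N F).

(** Small sublevel sets of [q] are forward invariant, which norm balls in general are not. Below a
    level where points lie in [N] and the truncation is inactive, the true flow therefore solves the
    truncated equation for all positive times. *)
Lemma local_normal_form (e : R) : 0 < e -> e <= mu ^+ 2 / 12 ->
  exists (r B : R) (G : V -> V) (G' : V -> 'M[R]_(d + k)),
  [/\ 0 < r /\ 0 <= B, G 0 = 0 /\ G' 0 = 0 /\ continuous G',
    forall x y, q (G x - G y) <= e * q (x - y),
    (forall x h, q (G (x + h) - G x - G' x *m h) <= B * q h ^+ 2) /\
    (forall x h, q (G' x *m h) <= e * q h)
  & forall x, q (iT *m x) < r -> let z t := iT *m F t x in
    [/\ N x, z 0 = iT *m x, {within `[0, +oo[, continuous z},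
      forall t : R, 0 < t -> is_derive t 1 z (Lam (z t) + G (z t))
    & forall t, 0 <= t -> q (z t) < r]].
Proof.
move=> e0 ele.
have [r1 [M [G1 [G1' [[r10 M0] fG [G10 G1'0] Gt Gl]]]]] := nonlinearity_taylor.
have [c1 c10 H1] := nsq_le_adapted JE'J JF'J.
have [c2 c20 H2] := adapted_le_nsq JE JF.
have cc : 0 < c2 * c1 by rewrite mulr_gt0.
(* Lipschitz bounds are proved for [nsq] and wanted for [q]; the two comparison constants are paid
   in advance. *)
have e2 : 0 < e / (c2 * c1) by rewrite divr_gt0.
have [r2 [G [G' [B [[r20 GE] B0 Glip Gtay [G'le [G'0 G'c]]]]]]] :=
  cutoff r10 M0 G1'0 Gt Gl e2.
have [r3 r30 Hr3] := nbhs0_closed_ball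
  (filterI (nbhs0_mulmx T (open_nbhs_nbhs hN)) (nbhs_norm_ler _ r20)).
have rle x : q x < r3 ^+ 2 / c1 -> `|x| <= r3.
  move=> xr; apply: le_of_sqr (ltW r30) _; apply: le_trans (norm_le_nsq _) _.
  by apply: le_trans (H1 _) _; rewrite mulrC -ler_pdivlMr // ltW.
have small x : q x < r3 ^+ 2 / c1 -> N (T *m x) /\ `|x| <= r2 by move=> /rle /Hr3.
have qe a b : nsq a <= e / (c2 * c1) * nsq b -> q a <= e * q b.
  move=> ab; apply: le_trans (H2 _) _.
  have -> : e * q b = c2 * (e / (c2 * c1) * (c1 * q b)).
    by field; rewrite !gt_eqF.
  rewrite ler_wpM2l ?(ltW c20) //; apply: le_trans ab _.
  by rewrite ler_wpM2l ?(ltW e2).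
have r0 : 0 < r3 ^+ 2 / c1 by rewrite divr_gt0 // exprn_gt0.
have G0 : G 0 = 0 by rewrite GE ?normr0 ?(ltW r20).
have Gq x y : q (G x - G y) <= e * q (x - y) by apply: qe; exact: Glip.
exists (r3 ^+ 2 / c1), (c2 * B * c1 ^+ 2), G, G'; split=> //.
- by split=> //; rewrite !mulr_ge0 ?exprn_ge0 // ltW.
- split=> x h; last by apply: qe; exact: G'le.
  apply: le_trans (H2 _) _.
  rewrite (_ : c2 * B * c1 ^+ 2 * q h ^+ 2 = c2 * (B * (c1 * q h) ^+ 2)); last by ring.
  rewrite ler_wpM2l ?(ltW c20) //.
  apply: le_trans (Gtay _ _) _; rewrite ler_wpM2l //.
  by rewrite lerXn2r ?nnegrE ?nsq_ge0 ?mulr_ge0 ?adapted_ge0 ?(ltW c10).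
move=> x xr z; have [Nx _] := small _ xr.
have {Nx} Nx : N x by move: Nx; rewrite mulmxA mulmxV // mul1mx.
have [F0 Fc Fd] := hF' Nx.
have z0 : z 0 = iT *m x by rewrite /z F0.
have zc : {within `[0, +oo[, continuous z}.
  exact: (within_comp Fc (@mulmx_continuous _ _ _ _ iT)).
have zd (t : R) : 0 < t -> is_derive t 1 z (iT *m f (T *m z t)).
  move=> t0; have := is_derive_mulmxr iT (Fd t t0).
  by rewrite /z mulmxA mulmxV // mul1mx.
have fz y : q y < r3 ^+ 2 / c1 -> iT *m f (T *m y) = Lam y + G y.
  by move=> /small [_ yr]; rewrite fG GE.
have zr t : 0 <= t -> q (z t) < r3 ^+ 2 / c1.
  have zx : q (z 0) < r3 ^+ 2 / c1 by rewrite z0.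
  exact: (adapted_trapped (G := fun y => iT *m f (T *m y))
    mu0 hE hF ele G0 Gq zc zd fz zx).
split=> // t t0; rewrite -fz; [exact: zd|exact: zr (ltW t0)].
Qed.

End LocalNormalForm.

(** * Dynamic mode decomposition *)

Section EuclideanNorm.
Variable R : realType.

Lemma enorm_ge0 p q (M : 'M[R]_(p, q)) : 0 <= enorm M.
Proof. exact: sqrtr_ge0. Qed.

Lemma enorm_sqr p q (M : 'M[R]_(p, q)) : enorm M ^+ 2 = \sum_j nsq (col j M).
Proof.
rewrite sqr_sqrtr; last by do 2 (apply: sumr_ge0 => ? _); exact: sqr_ge0.
rewrite exchange_big; apply: eq_bigr => j _; rewrite nsqE.
by apply: eq_bigr => i _; rewrite mxE.
Qed.

Lemma enorm_cV p (x : 'cV[R]_p) : enorm x ^+ 2 = nsq x.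
Proof. by rewrite enorm_sqr big_ord1 col_id. Qed.

Lemma nsq_mulmx_enorm p q (M : 'M[R]_(p, q)) x : nsq (M *m x) <= enorm M ^+ 2 * nsq x.
Proof.
rewrite sqr_sqrtr; first exact: nsq_mulmx.
by do 2 (apply: sumr_ge0 => ? _); exact: sqr_ge0.
Qed.

Lemma enorm_mulmx p q r (M : 'M[R]_(p, q)) (N : 'M[R]_(q, r)) :
  enorm (M *m N) <= enorm M * enorm N.
Proof.
apply: le_of_sqr; first by rewrite mulr_ge0 ?enorm_ge0.
rewrite exprMn (enorm_sqr (M *m N)) (enorm_sqr N) mulr_sumr; apply: ler_sum => j _.
by rewrite colE -mulmxA -colE; exact: nsq_mulmx_enorm.
Qed.

Lemma enorm_eq0 p q (M : 'M[R]_(p, q)) : enorm M = 0 -> M = 0.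
Proof.
move=> M0; have /eqP := enorm_sqr M; rewrite M0 expr0n eq_sym psumr_eq0 => [|j _]; last exact: nsq_ge0.
move=> /allP cM; apply/matrixP => i j; rewrite mxE.
have /eqP/nsq_eq0/matrixP/(_ i 0) := cM j (mem_index_enum j).
by rewrite !mxE.
Qed.

Lemma col_map_cols p q m (g : 'cV[R]_p -> 'cV[R]_q) (X : 'M[R]_(p, m)) j :
  col j (map_cols g X) = g (col j X).
Proof. by apply/matrixP => i l; rewrite !mxE (ord1 l). Qed.

Lemma col_mulmx p q m (M : 'M[R]_(p, q)) (X : 'M[R]_(q, m)) j :
  col j (M *m X) = M *m col j X.
Proof. by rewrite !colE mulmxA. Qed.

End EuclideanNorm.

Section PseudoInverse.
Variable R : realType.

Lemma mp_inverseP p q (M : 'M[R]_(p, q)) (Y : 'M[R]_(q, p)) :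
  moore_penrose M Y -> moore_penrose M (mp_inverse M).
Proof. by move=> MY; rewrite /mp_inverse; case: xgetP => [y -> //|/(_ Y)]. Qed.

Lemma gram_unit d m (Phi : 'M[R]_(d, m)) : \rank Phi = d -> Phi *m Phi^T \in unitmx.
Proof.
move=> rk; have /row_freeP [B PB] : row_free Phi by rewrite /row_free rk.
apply: unitmx_inj => a a0; have h : nsq (Phi^T *m a) = 0.
  have -> : nsq (Phi^T *m a) = (a^T *m (Phi *m Phi^T *m a)) 0 0.
    have -> : a^T *m (Phi *m Phi^T *m a) = (Phi^T *m a)^T *m (Phi^T *m a).
      by rewrite trmx_mul trmxK !mulmxA.
    by rewrite [RHS]mxE; apply: eq_bigr => i _; rewrite [X in _ = X * _]mxE.
  by rewrite a0 mulmx0 mxE.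
by rewrite -[a]mul1mx -trmx1 -PB trmx_mul -mulmxA (nsq_eq0 h) mulmx0.
Qed.

Lemma mp_inverse_unit p (G : 'M[R]_p) : G \in unitmx -> mp_inverse G = invmx G.
Proof.
move=> Gu; have [|h _ _ _] := @mp_inverseP _ _ G (invmx G).
  by split; rewrite ?mulmxV ?mulVmx ?mul1mx ?trmx1.
by rewrite -[LHS](mulKmx Gu) -[G *m _](mulmxK Gu) h mulmxV // mulmx1.
Qed.

(** The Penrose identities force this formula: [Phi *m Y] is the identity, and the symmetry of
    [Y *m Phi] puts [Y] in the form [Phi^T] times a matrix. *)
Lemma mp_inverse_row_free d m (Phi : 'M[R]_(d, m)) : \rank Phi = d ->
  mp_inverse Phi = Phi^T *m invmx (Phi *m Phi^T).
Proof.
move=> /gram_unit; set G := Phi *m Phi^T => Gu.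
have GT : (invmx G)^T = invmx G by rewrite trmx_inv trmx_mul trmxK.
have [|h1 h2 _ h4] := @mp_inverseP _ _ Phi (Phi^T *m invmx G).
  have e : Phi *m (Phi^T *m invmx G) = 1%:M by rewrite mulmxA mulmxV.
  split; rewrite ?e ?mul1mx ?trmx1 //; first by rewrite -mulmxA e mulmx1.
  by rewrite !trmx_mul GT trmxK mulmxA.
set Y := mp_inverse Phi in h1 h2 h4 *.
have PY : Phi *m Y = 1%:M.
  by rewrite -[LHS](mulmxK Gu) /G [_ *m (Phi *m _)]mulmxA h1 mulmxV.
have YE : Y = Phi^T *m (Y^T *m Y) by rewrite -[LHS]h2 -{1}h4 trmx_mul mulmxA.
rewrite [LHS]YE; congr (_ *m _); rewrite -[LHS](mulKmx Gu) /G.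
by rewrite -mulmxA -YE PY mulmx1.
Qed.

(** Writing the error through [mp_inverse Phi] rather than the inverse Gram matrix lets the
    condition number of [Phi] enter only to the first power. *)
Lemma dmd_error d m (Phi Phihat : 'M[R]_(d, m)) (D0 : 'M[R]_d) : \rank Phi = d ->
  dmd Phi Phihat - D0 = (Phihat - D0 *m Phi) *m mp_inverse Phi.
Proof.
move=> rk; have Gu := gram_unit rk; rewrite /dmd mp_inverse_unit //.
rewrite mp_inverse_row_free // mulmxBl !mulmxA; congr (_ - _).
by rewrite -!mulmxA (mulmxA Phi) mulmxV // mulmx1.
Qed.

End PseudoInverse.

Section DMDEstimate.
Variable R : realType.

Lemma sum_sqr_le (I : finType) (g : I -> R) : (forall i, 0 <= g i) ->
  \sum_i g i ^+ 2 <= (\sum_i g i) ^+ 2.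
Proof.
move=> g0; rewrite [leRHS]expr2 mulr_suml; apply: ler_sum => i _.
rewrite expr2 ler_wpM2l // (bigD1 i) //= lerDl.
by apply: sumr_ge0 => j _.
Qed.

Variables (n d l : nat) (hd : (0 < d)%N).
Variables (phi : 'cV[R]_n -> 'cV[R]_d) (Fd : 'cV[R]_n -> 'cV[R]_n).
Variables (PE : 'M[R]_(d, n)) (PF : 'M[R]_(l, n)) (D0 : 'M[R]_d).
Variables (beta r0 C : R).
Hypotheses (b0 : 0 < beta) (b1 : beta <= 1) (r00 : 0 < r0) (C0 : 0 < C).
Local Notation a x := (nsq (PE *m x)).
Local Notation b x := (nsq (PF *m x)).
Hypothesis Herr : forall x, a x + b x <= r0 ->
  nsq (phi (Fd x) - D0 *m phi x) <= C * ((a x + b x) ^+ 2 + b x + b (Fd x)).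
Hypothesis Hlow : forall x, a x + b x <= r0 ->
  a x <= C * (nsq (phi x) + b x + (a x + b x) ^+ 2).
(* Excludes PE X = 0, which (A4) turns into PF X = 0 since 0 `^ (1 + beta) = 0. *)
Hypothesis H0 : forall x, PE *m x = 0 -> PF *m x = 0 -> phi x = 0.

Lemma dmd_estimate (kappa : R) : 0 < kappa ->
  exists C1 delta : R, [/\ 0 < C1, 0 < delta
   & forall (m : nat) (X : 'M[R]_(n, m)),
     let Xhat := map_cols Fd X in
     let Phi := map_cols phi X in
     let Phihat := map_cols phi Xhat in
     \rank Phi = d ->
     enorm Phi * enorm (mp_inverse Phi) <= kappa ->
     enorm (PF *m X) <= enorm (PE *m X) `^ (1 + beta) ->
     enorm (PF *m Xhat) <= enorm (PE *m X) `^ (1 + beta) ->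
     enorm (PE *m X) < delta ->
     enorm (dmd Phi Phihat - D0) <= C1 * enorm (PE *m X) `^ beta].
Proof.
move=> k0.
have C10 : 0 <= 10 * C by rewrite mulr_ge0 // ltW.
(* For [s <= eta] the corrections in the lower bound for [Phi] absorb at most half of [s ^+ 2]. *)
have [eta eta0 Heta] := powR_small b0 C10 ltr01.
(* The squared sizes of all data columns add up to at most [2 * s ^+ 2], so this keeps every column
   in the range of the pointwise estimates. *)
have [rho rho0 rhor] : exists2 rho : R, 0 < rho & 2 * rho ^+ 2 <= r0.
  exists (Num.min 1 (r0 / 2)); first by rewrite lt_min ltr01 divr_gt0.
  set rho := Num.min _ _.
  have h0 : 0 < rho by rewrite lt_min ltr01 divr_gt0.
  have h1 : rho <= 1 by rewrite ge_min lexx.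
  have h2 : rho <= r0 / 2 by rewrite ge_min lexx orbT.
  have : rho * rho <= rho * 1 by rewrite ler_wpM2l // ltW.
  by rewrite expr2; lra.
exists (4 * C * kappa), (Num.min 1 (Num.min eta rho)); split.
- by rewrite !mulr_gt0.
- by rewrite !lt_min ltr01 eta0.
move=> m X Xhat Phi Phihat rk cond hF hFh; rewrite !lt_min => /andP[s1 /andP[seta srho]].
set s := enorm (PE *m X) in hF hFh s1 seta srho *.
have s_ge0 : 0 <= s := enorm_ge0 _.
set sb := s `^ beta.
have sb0 : 0 <= sb by exact: powR_ge0.
have tE : s `^ (1 + beta) = s * sb.
  have [->|sn0] := eqVneq s 0; first by rewrite mul0r powR0 ?gt_eqF ?addr_gt0.
  by rewrite powRD ?powRr1 //; apply/implyP => _.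
rewrite tE in hF hFh.
pose x j := col j X.
have sum_a : \sum_j a (x j) = s ^+ 2.
  by rewrite enorm_sqr; apply: eq_bigr => j _; rewrite col_mulmx.
have sum_b : \sum_j b (x j) <= (s * sb) ^+ 2.
  rewrite -(eq_bigr _ (fun j _ => congr1 (@nsq R l) (col_mulmx PF X j))) -enorm_sqr.
  by rewrite lerXn2r ?nnegrE ?enorm_ge0 ?mulr_ge0.
have sum_bh : \sum_j b (Fd (x j)) <= (s * sb) ^+ 2.
  have -> : \sum_j b (Fd (x j)) = enorm (PF *m Xhat) ^+ 2.
    by rewrite enorm_sqr; apply: eq_bigr => j _; rewrite col_mulmx col_map_cols.
  by rewrite lerXn2r ?nnegrE ?enorm_ge0 ?mulr_ge0.
have sb1 : sb <= 1.
  have := ge0_ler_powR (ltW b0) (_ : s \is Num.nneg) (_ : 1 \is Num.nneg) (ltW s1).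
  by rewrite powR1; apply; rewrite nnegrE.
(* Here [beta <= 1] enters: errors quadratic in the data are no worse than the fast-mode error
   [s * sb]. *)
have ssb : s <= sb.
  have [->|sn0] := eqVneq s 0; first exact: powR_ge0.
  rewrite -[leLHS]powRr1 // /sb; apply: ger_powR => //.
  by rewrite lt_def sn0 s_ge0 (ltW s1).
have t2 : (s * sb) ^+ 2 <= s ^+ 2.
  by rewrite exprMn ler_piMr ?sqr_ge0 // expr_le1.
have s4 : (s ^+ 2) ^+ 2 <= (s * sb) ^+ 2.
  rewrite lerXn2r ?nnegrE ?mulr_ge0 ?sqr_ge0 // expr2.
  by rewrite ler_wpM2l.
pose S := \sum_j (a (x j) + b (x j)).
have SE : S = \sum_j a (x j) + \sum_j b (x j) by rewrite /S big_split.
have S0 j : 0 <= a (x j) + b (x j) by rewrite addr_ge0 ?nsq_ge0.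
have S2 : S <= 2 * s ^+ 2 by rewrite SE sum_a; lra.
have xr j : a (x j) + b (x j) <= r0.
  have h : a (x j) + b (x j) <= S.
    by rewrite /S (bigD1 j) //= lerDl; apply: sumr_ge0 => i _; exact: S0.
  have : s ^+ 2 <= rho ^+ 2 by rewrite lerXn2r ?nnegrE ?(ltW srho) ?(ltW rho0).
  by lra.
have Sq : \sum_j (a (x j) + b (x j)) ^+ 2 <= 4 * (s * sb) ^+ 2.
  apply: le_trans (sum_sqr_le S0) _; rewrite -/S.
  have : S ^+ 2 <= (2 * s ^+ 2) ^+ 2.
    rewrite lerXn2r ?nnegrE ?mulr_ge0 ?sqr_ge0 //.
    by apply: sumr_ge0 => j _; exact: S0.
  by rewrite exprMn; lra.
have err : enorm (Phihat - D0 *m Phi) ^+ 2 <= C * (6 * (s * sb) ^+ 2).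
  rewrite enorm_sqr.
  apply: (@le_trans _ _ (\sum_j C * ((a (x j) + b (x j)) ^+ 2 + b (x j) + b (Fd (x j))))).
    apply: ler_sum => j _; apply: le_trans (Herr (xr j)).
    by rewrite linearB /= col_mulmx /Phihat /Phi /Xhat !col_map_cols.
  rewrite -mulr_sumr ler_wpM2l ?(ltW C0) // !big_split /=; lra.
have low : s ^+ 2 <= C * (enorm Phi ^+ 2 + 5 * (s * sb) ^+ 2).
  rewrite -sum_a.
  have sum_phi : \sum_j nsq (phi (x j)) = enorm Phi ^+ 2.
    by rewrite enorm_sqr; apply: eq_bigr => j _; rewrite /Phi col_map_cols.
  apply: (@le_trans _ _ (\sum_j C * (nsq (phi (x j)) + b (x j) + (a (x j) + b (x j)) ^+ 2))).
    by apply: ler_sum => j _; exact: Hlow.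
  rewrite -mulr_sumr ler_wpM2l ?(ltW C0) // !big_split /=.
  by rewrite sum_phi; lra.
have P0 : 0 < enorm Phi.
  rewrite lt_def enorm_ge0 andbT; apply/eqP => /enorm_eq0 PhiE.
  by move: rk hd; rewrite PhiE mxrank0 => <-.
have low' : s ^+ 2 <= 2 * C * enorm Phi ^+ 2.
  have h : 10 * C * sb <= 1 by apply: Heta; [|exact: ltW].
  have h2 : (s * sb) ^+ 2 <= s ^+ 2 * sb.
    by rewrite exprMn ler_wpM2l ?sqr_ge0 // expr2 ler_piMr.
  have h3 : s ^+ 2 * (10 * C * sb) <= s ^+ 2 by rewrite ler_piMr ?sqr_ge0.
  have h4 : C * (s * sb) ^+ 2 <= C * (s ^+ 2 * sb) by rewrite ler_wpM2l ?(ltW C0).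
  have : s ^+ 2 * (10 * C * sb) = 10 * (C * (s ^+ 2 * sb)) by ring.
  by move: low; rewrite mulrDr (mulrCA C 5); lra.
have sn0 : s != 0.
  apply/eqP => sz; have /eqP := sum_a; rewrite sz expr0n.
  rewrite psumr_eq0 => [/allP ca|j _]; last exact: nsq_ge0.
  have := sum_b; rewrite sz mul0r expr0n => sb_le.
  have sbz : \sum_j b (x j) = 0.
    by apply/eqP; rewrite eq_le sb_le; apply: sumr_ge0 => j _; exact: nsq_ge0.
  have /eqP := sbz; rewrite psumr_eq0 => [/allP cb|j _]; last exact: nsq_ge0.
  have Phi0 : enorm Phi ^+ 2 = 0.
    rewrite enorm_sqr big1 // => j _; rewrite /Phi col_map_cols -/(x j) H0 ?nsq0 //.
    - by apply: nsq_eq0; apply/eqP; exact: (ca j (mem_index_enum j)).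
    - by apply: nsq_eq0; apply/eqP; exact: (cb j (mem_index_enum j)).
  by have := exprn_gt0 2 P0; rewrite Phi0 ltxx.
have sp : 0 < s by rewrite lt_def sn0.
rewrite dmd_error //; apply: le_trans (enorm_mulmx _ _) _.
set Er := enorm (Phihat - _) in err *; set mp := enorm (mp_inverse _) in cond *.
have mp0 : 0 <= mp := enorm_ge0 _.
have Er0 : 0 <= Er := enorm_ge0 _.
apply: le_of_sqr; first by rewrite !mulr_ge0 // ltW.
(* Both sides are multiplied by [s ^+ 2], which [low'] trades for [enorm Phi ^+ 2]; its product with
   the squared pseudo-inverse norm is then bounded by [kappa ^+ 2]. *)
suff : (Er * mp) ^+ 2 * s ^+ 2 <= (4 * C * kappa * sb) ^+ 2 * s ^+ 2.
  by rewrite ler_pM2r // exprn_gt0.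
have c2 : (enorm Phi * mp) ^+ 2 <= kappa ^+ 2.
  by rewrite lerXn2r ?nnegrE ?mulr_ge0 ?(ltW P0) ?(ltW k0).
have i1 : (Er * mp) ^+ 2 * s ^+ 2 <= C * (6 * (s * sb) ^+ 2) * (2 * C * kappa ^+ 2).
  have -> : (Er * mp) ^+ 2 * s ^+ 2 = Er ^+ 2 * (mp ^+ 2 * s ^+ 2) by ring.
  apply: ler_pM; rewrite ?mulr_ge0 ?sqr_ge0 //.
  apply: (@le_trans _ _ (mp ^+ 2 * (2 * C * enorm Phi ^+ 2))).
    by rewrite ler_wpM2l ?sqr_ge0.
  have -> : mp ^+ 2 * (2 * C * enorm Phi ^+ 2) = 2 * C * (enorm Phi * mp) ^+ 2 by ring.
  by rewrite ler_wpM2l // mulr_ge0 // ltW.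
apply: le_trans i1 _.
have -> : (4 * C * kappa * sb) ^+ 2 * s ^+ 2 = 16 * (C ^+ 2 * kappa ^+ 2 * (s * sb) ^+ 2).
  by ring.
have -> : C * (6 * (s * sb) ^+ 2) * (2 * C * kappa ^+ 2) =
  12 * (C ^+ 2 * kappa ^+ 2 * (s * sb) ^+ 2) by ring.
by rewrite ler_wpM2r ?mulr_ge0 ?sqr_ge0 //; lra.
Qed.

End DMDEstimate.

(** * From the flow to the observables *)

Section FlowEstimate.
Variables (R : realType) (d k mE mF : nat).
Variables (JE : 'M[R]_(mE, d)) (JE' : 'M[R]_(d, mE)).
Variables (JF : 'M[R]_(mF, k)) (JF' : 'M[R]_(k, mF)).
Hypotheses (JE'J : JE' *m JE = 1%:M) (JF'J : JF' *m JF = 1%:M).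
Variables (LE : 'M[R]_d) (LF : 'M[R]_k) (mu : R).
Hypothesis mu0 : 0 < mu.
Hypothesis hE : forall x, dot (JE *m x) (JE *m (LE *m x)) <= - mu * nsq (JE *m x).
Hypothesis hF : forall x, dot (JF *m x) (JF *m (LF *m x)) <= - mu * nsq (JF *m x).
Local Notation V := 'cV[R]_(d + k).
Local Notation q := (adapted JE JF).
Local Notation Lam := (block_lin LE LF).
Variables (A T : 'M[R]_(d + k)).
Hypotheses (Tu : T \in unitmx) (AT : A *m T = T *m block_mx LE 0 0 LF).
Variables (f : V -> V) (U : set V).
Hypotheses (f0 : f 0 = 0) (fA : cjacobian f 0 = A).
Hypotheses (U0 : open_nbhs (0 : V) U) (fC2 : C2_on U f).
Variables (N : set V) (F : R -> V -> V).
Hypotheses (hN : open_nbhs (0 : V) N) (hF' : flow_on f N F).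
Local Notation iT := (invmx T).

(** The truncation used here is independent of the one that defines the manifold: the estimates
    concern the true flow, and [mu ^+ 2 / 12] is the largest smallness constant that the forward
    estimates admit. *)
Lemma flow_estimate (t : R) : 0 <= t -> exists r K : R, [/\ 0 < r, 0 <= K
  & forall x, nsq (iT *m x) <= r ->
    nsq (iT *m F t x) <= K * nsq (iT *m x) /\
    nsq (usubmx (iT *m F t x) - mexp (t *: LE) *m usubmx (iT *m x)) <=
      K * nsq (iT *m x) ^+ 2].
Proof.
move=> t0; have e0 : 0 < mu ^+ 2 / 12 by rewrite divr_gt0 // exprn_gt0.
have [r [B [G [G' [[r0 B0] [G0 [G'0 _]] Glip [Gt _] flow]]]]] :=
  local_normal_form JE'J JF'J mu0 hE hF Tu AT f0 fA U0 fC2 hN hF' e0 (lexx _).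
have [c1 c10 H1] := nsq_le_adapted JE'J JF'J.
have [c2 c20 H2] := adapted_le_nsq JE JF.
have [c3 c30 H3] := left_inverse_bound JE'J.
have GB x : q (G x) <= B * q x ^+ 2.
  by have := Gt 0 x; rewrite add0r G0 subr0 G'0 mul0mx subr0.
have Bm : 0 <= B / mu ^+ 2 by rewrite divr_ge0 // sqr_ge0.
exists (r / 2 / c2), (c1 * c2 + c3 * (B / mu ^+ 2 * c2 ^+ 2)); split.
- by rewrite !divr_gt0.
- apply: addr_ge0; first by rewrite mulr_ge0 // ltW.
  exact: mulr_ge0 (ltW c30) (mulr_ge0 Bm (sqr_ge0 c2)).
move=> x xr; have qx := H2 (iT *m x).
have zr : q (iT *m x) < r.
  apply: le_lt_trans qx _; move: xr; rewrite ler_pdivlMr // mulrC => xr.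
  by have := r0; lra.
have [Nx z0 zc zd _] := flow x zr.
have k1 : 0 <= c1 * c2 by rewrite mulr_ge0 // ltW.
have k2 : 0 <= c3 * (B / mu ^+ 2 * c2 ^+ 2).
  exact: mulr_ge0 (ltW c30) (mulr_ge0 Bm (sqr_ge0 c2)).
have z2 := sqr_ge0 (nsq (iT *m x)); have z1 := nsq_ge0 (iT *m x).
split; rewrite mulrDl.
  have := adapted_decay mu0 hE hF (lexx _) G0 Glip zc zd t0; rewrite z0 => qt.
  have h : c1 * q (iT *m F t x) <= c1 * c2 * nsq (iT *m x).
    by rewrite -mulrA ler_wpM2l ?(ltW c10) // (le_trans qt).
  have := H1 (iT *m F t x); have := mulr_ge0 k2 z1; lra.
have := usub_linearization mu0 hE hF (lexx _) G0 Glip zc zd B0 GB t0.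
rewrite z0; set y := usubmx _ - _ => yq.
have h : c3 * nsq (JE *m y) <= c3 * (B / mu ^+ 2 * c2 ^+ 2) * nsq (iT *m x) ^+ 2.
  rewrite -[leRHS]mulrA ler_wpM2l ?(ltW c30) //; apply: le_trans yq _.
  rewrite -[leRHS]mulrA ler_wpM2l // -exprMn lerXn2r ?nnegrE ?adapted_ge0 //.
  by rewrite mulr_ge0 ?nsq_ge0 // ltW.
have := H3 y; have := mulr_ge0 k1 z2; lra.
Qed.

End FlowEstimate.

Section Pointwise.
Variables (R : realType) (d k : nat).
Local Notation V := 'cV[R]_(d + k).
Variables (TE : 'M[R]_(d + k, d)) (TF : 'M[R]_(d + k, k)).
Variables (PE : 'M[R]_(d, d + k)) (PF : 'M[R]_(k, d + k)).
Local Notation T := (row_mx TE TF).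
Local Notation iT := (invmx T).
Hypotheses (Tu : T \in unitmx) (PETF : PE *m TF = 0) (PFTE : PF *m TE = 0).
Hypotheses (PEu : PE *m TE \in unitmx) (PFu : PF *m TF \in unitmx).
Variables (phi : V -> 'cV[R]_d) (Fd : V -> V) (Lw : 'M[R]_d) (r K : R).
Hypotheses (r0 : 0 < r) (K0 : 0 <= K).
Hypothesis Fest : forall x, nsq (iT *m x) <= r ->
    nsq (iT *m Fd x) <= K * nsq (iT *m x) /\
    nsq (usubmx (iT *m Fd x) - Lw *m usubmx (iT *m x)) <= K * nsq (iT *m x) ^+ 2.
Hypotheses (phiC2 : C2_on setT phi) (phi0 : phi 0 = 0).
Local Notation J := (cjacobian phi 0).
Local Notation S := (J *m TE).
Hypothesis Su : S \in unitmx.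
Local Notation D0 := (S *m Lw *m invmx S).

Implicit Types x : V.

Lemma lin3_le (k1 k2 k3 C a b c : R) : 0 <= a -> 0 <= b -> 0 <= c ->
  k1 <= C -> k2 <= C -> k3 <= C -> k1 * a + k2 * b + k3 * c <= C * (a + b + c).
Proof.
by move=> a0 b0 c0 h1 h2 h3; rewrite !mulrDr !lerD // ler_wpM2r.
Qed.

Lemma split_coord x : x = TE *m usubmx (iT *m x) + TF *m dsubmx (iT *m x).
Proof. by rewrite -mul_row_col vsubmxK mulmxA mulmxV // mul1mx. Qed.

Lemma coord_eqE x : usubmx (iT *m x) = invmx (PE *m TE) *m (PE *m x).
Proof.
rewrite {2}(split_coord x) mulmxDr mulmxA (mulmxA PE TF) PETF mul0mx addr0.
by rewrite mulKmx.
Qed.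

Lemma coord_eqF x : dsubmx (iT *m x) = invmx (PF *m TF) *m (PF *m x).
Proof.
rewrite {2}(split_coord x) mulmxDr mulmxA (mulmxA PF TF) PFTE mul0mx add0r.
by rewrite mulKmx.
Qed.

Lemma coord_zero x : PE *m x = 0 -> PF *m x = 0 -> phi x = 0.
Proof.
move=> xE xF; rewrite (split_coord x) coord_eqE coord_eqF xE xF.
by rewrite !mulmx0 addr0.
Qed.

Local Notation a x := (nsq (PE *m x)).
Local Notation b x := (nsq (PF *m x)).

(** Before and after the time step, the observable is [S] applied to the slow coordinates plus a
    fast term and a quadratic remainder; the slow terms match through [D0 *m S = S *m Lw] up to the
    flow estimate. Solving the same expansion for the slow coordinates gives the lower bound. *)
Lemma observable_pointwise : exists rho C : R, [/\ 0 < rho, 0 < C,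
  forall x, a x + b x <= rho ->
  nsq (phi (Fd x) - D0 *m phi x) <= C * ((a x + b x) ^+ 2 + b x + b (Fd x))
& forall x, a x + b x <= rho ->
  a x <= C * (nsq (phi x) + b x + (a x + b x) ^+ 2)].
Proof.
have TT0 : open_nbhs (0 : V) setT by split=> //; exact: openT.
have [r1 [M [r10 M0 _ tay _]]] := C2_quadratic TT0 phiC2.
have {tay} tay x : `|x| <= r1 -> nsq (phi x - J *m x) <= M * nsq x ^+ 2.
  have n0 : `|(0 : V)| <= r1 by rewrite normr0 ltW.
  by move=> xr; have := tay x 0 xr n0; rewrite phi0 !subr0.
have [cu cu0 Hu] := nsq_mulmx_bound (invmx (PE *m TE)).
have [cv cv0 Hv] := nsq_mulmx_bound (invmx (PF *m TF)).
have [cT cT0 HT] := nsq_mulmx_bound T.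
have [cS cS0 HS] := nsq_mulmx_bound S.
have [cJ cJ0 HJ] := nsq_mulmx_bound (J *m TF).
have [cD cD0 HD] := nsq_mulmx_bound D0.
have [cP cP0 HP] := nsq_mulmx_bound (PE *m TE *m invmx S).
pose c1 := cu + cv; have c10 : 0 < c1 by rewrite addr_gt0.
have ze x : nsq (iT *m x) <= c1 * (a x + b x).
  rewrite -[iT *m x]vsubmxK nsq_col_mx coord_eqE coord_eqF.
  have := Hu (PE *m x); have := Hv (PF *m x).
  have := mulr_ge0 (ltW cu0) (nsq_ge0 (PF *m x)).
  have := mulr_ge0 (ltW cv0) (nsq_ge0 (PE *m x)).
  by rewrite /c1; lra.
have ve x : nsq (dsubmx (iT *m x)) <= cv * b x by rewrite coord_eqF.
have xe x : nsq x <= cT * nsq (iT *m x).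
  by rewrite -[x in leLHS](mulKVmx Tu).
have xsmall x : cT * nsq (iT *m x) <= r1 ^+ 2 -> `|x| <= r1.
  move=> xr; apply: le_of_sqr (ltW r10) _.
  by apply: le_trans (norm_le_nsq _) _; exact: le_trans (xe x) xr.
(* As [K1] dominates both 1 and [K], one [rho] puts [x] and its image [Fd x] in the ball of the
   Taylor estimate. *)
pose K1 := K + 1; have K10 : 0 < K1 by rewrite ltr_wpDl.
pose rho := Num.min r (r1 ^+ 2 / (cT * K1)) / c1.
have rho0 : 0 < rho.
  by rewrite divr_gt0 // lt_min r0 divr_gt0 ?exprn_gt0 ?mulr_gt0.
have small x : a x + b x <= rho ->
    [/\ nsq (iT *m x) <= r, `|x| <= r1 & `|Fd x| <= r1].
  move=> xr; have : nsq (iT *m x) <= Num.min r (r1 ^+ 2 / (cT * K1)).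
    by apply: le_trans (ze x) _; rewrite mulrC -ler_pdivlMr.
  rewrite le_min => /andP[zr]; rewrite ler_pdivlMr ?mulr_gt0 // => zr1.
  have zr2 : cT * (K1 * nsq (iT *m x)) <= r1 ^+ 2.
    by rewrite mulrA mulrC.
  have zK : nsq (iT *m x) <= K1 * nsq (iT *m x).
    by rewrite ler_peMl ?nsq_ge0 // lerDr.
  split=> //; apply: xsmall; apply: le_trans zr2; rewrite ler_wpM2l ?(ltW cT0) //.
  have [h _] := Fest zr; apply: le_trans h _.
  by rewrite ler_wpM2r ?nsq_ge0 // lerDl.
pose m1 := M * (cT * K1) ^+ 2 * c1 ^+ 2.
pose m2 := cS * K * c1 ^+ 2.
pose m3 := cD * m1.
have m10 : 0 <= m1 := mulr_ge0 (mulr_ge0 M0 (sqr_ge0 _)) (sqr_ge0 _).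
have m20 : 0 <= m2 := mulr_ge0 (mulr_ge0 (ltW cS0) K0) (sqr_ge0 _).
have m30 : 0 <= m3 := mulr_ge0 (ltW cD0) m10.
have z2 x : nsq (iT *m x) ^+ 2 <= c1 ^+ 2 * (a x + b x) ^+ 2.
  rewrite -exprMn lerXn2r ?nnegrE ?nsq_ge0 //.
  exact: mulr_ge0 (ltW c10) (addr_ge0 (nsq_ge0 _) (nsq_ge0 _)).
have rem x y : `|y| <= r1 -> nsq (iT *m y) <= K1 * nsq (iT *m x) ->
    nsq (phi y - J *m y) <= m1 * (a x + b x) ^+ 2.
  move=> yr yx; apply: le_trans (tay _ yr) _; rewrite /m1 -[leRHS]mulrA -[leRHS]mulrA ler_wpM2l //.
  apply: (@le_trans _ _ ((cT * K1) ^+ 2 * nsq (iT *m x) ^+ 2)); last first.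
    by rewrite ler_wpM2l ?sqr_ge0.
  rewrite -exprMn lerXn2r ?nnegrE ?nsq_ge0 //.
    by rewrite !mulr_ge0 ?nsq_ge0 ?(ltW cT0) ?(ltW K10).
  by apply: le_trans (xe y) _; rewrite -mulrA ler_wpM2l // ltW.
have K11 : 1 <= K1 by rewrite lerDr.
have KK : K <= K1 by rewrite lerDl.
have JE x : J *m x = S *m usubmx (iT *m x) + J *m TF *m dsubmx (iT *m x).
  by rewrite {1}(split_coord x) mulmxDr !mulmxA.
have Jv x : nsq (J *m TF *m dsubmx (iT *m x)) <= cJ * cv * b x.
  by apply: le_trans (HJ _) _; rewrite -mulrA ler_wpM2l ?(ltW cJ0).
pose C := 16 * (m1 + m2 + m3 + cJ * cv + cD * (cJ * cv)) + cP * (4 + 4 * m1 + 4 * (cJ * cv)).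
have cv1 : 0 <= cJ * cv := mulr_ge0 (ltW cJ0) (ltW cv0).
have cv2 : 0 <= cD * (cJ * cv) := mulr_ge0 (ltW cD0) cv1.
have cPm : 0 <= cP * m1 := mulr_ge0 (ltW cP0) m10.
have cPv : 0 <= cP * (cJ * cv) := mulr_ge0 (ltW cP0) cv1.
exists rho, C; split=> //; first by rewrite /C !mulrDr; lra.
  move=> x xr; have [zr x1 Fx1] := small x xr; have [Fz Fu] := Fest zr.
  set y := Fd x in Fz Fu Fx1 *.
  have -> : phi y - D0 *m phi x =
    (phi y - J *m y) + S *m (usubmx (iT *m y) - Lw *m usubmx (iT *m x))
    + J *m TF *m dsubmx (iT *m y) - D0 *m (phi x - J *m x)
    - D0 *m (J *m TF *m dsubmx (iT *m x)).
    rewrite (mulmxBr D0) (JE x) (mulmxDr D0) -[D0 *m (S *m _)]mulmxA mulKmx //.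
    rewrite (JE y) (mulmxBr S) (mulmxA S).
    set e1 := S *m _; set e2 := J *m TF *m _; set e3 := S *m _ *m _.
    set e4 := D0 *m phi x; set e5 := D0 *m _.
    by apply/matrixP => i j; rewrite !mxE; ring.
  have h1 := rem x y Fx1 (le_trans Fz (ler_wpM2r (nsq_ge0 _) KK)).
  have h3 : nsq (phi x - J *m x) <= m1 * (a x + b x) ^+ 2.
    by apply: rem => //; rewrite ler_peMl ?nsq_ge0.
  have h2 : nsq (S *m (usubmx (iT *m y) - Lw *m usubmx (iT *m x))) <= m2 * (a x + b x) ^+ 2.
    apply: le_trans (HS _) _; rewrite /m2 -[leRHS]mulrA -[leRHS]mulrA ler_wpM2l ?(ltW cS0) //.
    by apply: le_trans Fu _; rewrite ler_wpM2l.
  have {}h3 : nsq (D0 *m (phi x - J *m x)) <= m3 * (a x + b x) ^+ 2.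
    by apply: le_trans (HD _) _; rewrite /m3 -mulrA ler_wpM2l ?(ltW cD0).
  have h4 : nsq (D0 *m (J *m TF *m dsubmx (iT *m x))) <= cD * (cJ * cv) * b x.
    by apply: le_trans (HD _) _; rewrite -mulrA ler_wpM2l ?(ltW cD0).
  have h5 := Jv y.
  set e1 := phi y - _ in h1 *; set e2 := S *m (_ - _) in h2 *.
  set e3 := J *m TF *m _ in h5 *; set e4 := D0 *m (_ - _) in h3 *.
  set e5 := D0 *m (_ *m _) in h4 *.
  (* Separating five terms by four successive splittings costs at most [2 ^+ 4]; this is the 16 in
     [C]. *)
  have g1 := nsqB_le (e1 + e2 + e3 - e4) e5.
  have g2 := nsqB_le (e1 + e2 + e3) e4.
  have g3 := nsqD_le (e1 + e2) e3.
  have g4 := nsqD_le e1 e2.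
  have A0 := sqr_ge0 (a x + b x); have b0 := nsq_ge0 (PF *m x).
  have bh0 := nsq_ge0 (PF *m y).
  apply: le_trans (lin3_le (k1 := 16 * (m1 + m2 + m3)) (k2 := 16 * (cD * (cJ * cv)))
    (k3 := 16 * (cJ * cv)) A0 b0 bh0 _ _ _).
  - have t1 := mulr_ge0 m30 A0; have t2 := mulr_ge0 cv2 b0; have t3 := mulr_ge0 cv1 bh0.
    lra.
  - by rewrite /C !mulrDr; lra.
  - by rewrite /C !mulrDr; lra.
  - by rewrite /C !mulrDr; lra.
move=> x xr; have [zr x1 _] := small x xr.
have h3 : nsq (phi x - J *m x) <= m1 * (a x + b x) ^+ 2.
  by apply: rem => //; rewrite ler_peMl ?nsq_ge0.
have h4 := Jv x.
have E : PE *m x = PE *m TE *m invmx S *m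
    (phi x - (phi x - J *m x) - J *m TF *m dsubmx (iT *m x)).
  rewrite (_ : phi x - (phi x - J *m x) = J *m x); last by rewrite opprB addrC subrK.
  rewrite (JE x) addrK.
  by rewrite -[_ *m (S *m _)]mulmxA mulKmx // coord_eqE mulKVmx.
have := HP (phi x - (phi x - J *m x) - J *m TF *m dsubmx (iT *m x)); rewrite -E => HE.
set e1 := phi x - J *m x in h3 HE; set e2 := J *m TF *m _ in h4 HE.
have g1 := nsqB_le (phi x - e1) e2; have g2 := nsqB_le (phi x) e1.
have A0 := sqr_ge0 (a x + b x); have b0 := nsq_ge0 (PF *m x).
have p0 := nsq_ge0 (phi x).
apply: le_trans HE _.
have : nsq (phi x - e1 - e2) <= 4 * nsq (phi x) + 4 * (cJ * cv) * b x + 4 * m1 * (a x + b x) ^+ 2.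
  have := mulr_ge0 cv1 b0; lra.
move=> /(ler_wpM2l (ltW cP0)) g; apply: le_trans g _.
apply: le_trans (lin3_le (k1 := cP * 4) (k2 := cP * (4 * (cJ * cv)))
    (k3 := cP * (4 * m1)) p0 b0 A0 _ _ _).
- by rewrite le_eqVlt; apply/orP; left; apply/eqP; ring.
- by rewrite /C !mulrDr; lra.
- by rewrite /C !mulrDr; lra.
- by rewrite /C !mulrDr; lra.
Qed.

End Pointwise.

(** * The attracting spectral submanifold *)

Section Manifold.
Variables (R : realType) (d k mE mF : nat).
Variables (JE : 'M[R]_(mE, d)) (JE' : 'M[R]_(d, mE)).
Variables (JF : 'M[R]_(mF, k)) (JF' : 'M[R]_(k, mF)).
Hypotheses (JE'J : JE' *m JE = 1%:M) (JF'J : JF' *m JF = 1%:M).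
Local Notation V := 'cV[R]_(d + k).
Local Notation q := (adapted JE JF).
Variables (TE : 'M[R]_(d + k, d)) (TF : 'M[R]_(d + k, k)).
Local Notation T := (row_mx TE TF).
Local Notation iT := (invmx T).
Hypothesis Tu : T \in unitmx.
Variables (w : 'cV[R]_d -> 'cV[R]_k) (L : 'cV[R]_d -> 'M[R]_(k, d)).
Hypotheses (w0 : w 0 = 0) (L0 : L 0 = 0).
Hypothesis wlip : forall u1 u2, nsq (JF *m (w u1 - w u2)) <= nsq (JE *m (u1 - u2)).
Hypothesis wC1 : C1_on setT w.
Hypothesis wd : forall u, differentiable w u /\
        ('d w u : 'cV[R]_d -> 'cV[R]_k) = mulmx (L u).
Variable rho : R.
Hypothesis rho0 : 0 < rho.

Definition slow_disk : set 'cV[R]_d := [set u | nsq (JE *m u) < rho].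
Definition graph_param (u : 'cV[R]_d) : V := TE *m u + TF *m w u.
(** Membership is an equation in the coordinates of [T], so that invariance becomes the vanishing of
    the offset controlled by [graph_attracts]. *)
Definition graph_manifold : set V :=
  [set x | slow_disk (usubmx (iT *m x)) /\ dsubmx (iT *m x) = w (usubmx (iT *m x))].

Lemma slow_disk_open : open slow_disk.
Proof.
rewrite openE => u uB.
have c : nsq (JE *m x) @[x --> u] --> nsq (JE *m u).
  exact: (@cvg_nsqJ _ _ (nbhs u) _ _ _ JE id u (@cvg_id _ _)).
exact: (cvgr_lt _ c _ uB).
Qed.

Lemma coords_graph u : iT *m graph_param u = col_mx u (w u).
Proof. by rewrite /graph_param -mul_row_col mulKmx. Qed.

Lemma graph_param_in u : slow_disk u -> graph_manifold (graph_param u).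
Proof. by move=> uB; rewrite /graph_manifold /= coords_graph col_mxKu col_mxKd. Qed.

Lemma graph_manifoldE x : graph_manifold x -> x = graph_param (usubmx (iT *m x)).
Proof.
move=> [_ xw]; rewrite /graph_param -xw -mul_row_col vsubmxK mulmxA mulmxV //.
by rewrite mul1mx.
Qed.

Lemma graph_param0 : graph_param 0 = 0.
Proof. by rewrite /graph_param w0 !mulmx0 addr0. Qed.

Lemma is_diff_mulmx m n (M : 'M[R]_(m, n)) (x : 'cV[R]_n) :
  is_diff x (mulmx M : 'cV[R]_n -> 'cV[R]_m) (mulmx M).
Proof.
have c : continuous (mulmx M : 'cV[R]_n -> 'cV[R]_m) by exact: mulmx_continuous.
split; first exact: linear_differentiable.
exact: diff_lin.
Qed.

Lemma is_diff_chart u0 u : is_diff u (fun y => graph_param (u0 + y))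
  (fun v => TE *m v + TF *m (L (u0 + u) *m v)).
Proof.
have h1 : is_diff u ((cst u0 + id) : 'cV[R]_d -> 'cV[R]_d) (0 + id).
  exact: is_diffD (is_diff_cst _ _) (is_diff_id _).
have h2 : is_diff (u0 + u) w (mulmx (L (u0 + u))).
  by have [h3 h4] := wd (u0 + u); split.
have h3 := is_diff_comp h1 h2.
have h4 := is_diff_comp h3 (is_diff_mulmx TF _).
have h5 := is_diff_comp h1 (is_diff_mulmx TE _).
apply: is_diff_eq (is_diffD h5 h4) _.
by apply/funext => v /=; rewrite /= add0r.
Qed.

Lemma mulmx_cV_inj m n (M N : 'M[R]_(m, n)) :
  (forall v : 'cV[R]_n, M *m v = N *m v) -> M = N.
Proof.
move=> MN; apply/matrixP => i j; have /matrixP/(_ i 0) := MN (delta_mx j 0).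
by rewrite -!colE !mxE.
Qed.

Lemma chart_jacobian u0 u :
  cjacobian (fun y => graph_param (u0 + y)) u = T *m col_mx 1%:M (L (u0 + u)).
Proof.
apply: mulmx_cV_inj => v; rewrite cjacobian_mulmx mul_row_col mulmx1 mulmxDl -mulmxA.
by have [_ ->] := is_diff_chart u0 u.
Qed.

Lemma chart_C1 u0 (B : set 'cV[R]_d) : C1_on B (fun y => graph_param (u0 + y)).
Proof.
move=> x _; split=> [|v]; first by case: (is_diff_chart u0 x).
have -> : (fun y => 'D_v (fun y => graph_param (u0 + y)) y) =
    fun y => TE *m v + TF *m 'D_v w (u0 + y).
  apply/funext => y; have [cd cE] := is_diff_chart u0 y.
  have [wdy wE] := wd (u0 + y).
  by rewrite !deriveE // cE wE.
have [_ /(_ v) Dc] := wC1 (I : setT (u0 + x)).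
have c1 : (fun y : 'cV[R]_d => u0 + y) @ x --> u0 + x.
  by apply: (@cvgD _ _ _ (nbhs x)); [exact: cvg_cst|exact: cvg_id].
have c2 := (@cvg_comp _ _ _ (fun y : 'cV[R]_d => u0 + y) (fun y => 'D_v w y) _ _ _ c1 Dc).
apply: (@cvgD _ _ _ (nbhs x)); first exact: cvg_cst.
exact: (@cvg_comp _ _ _ _ (mulmx TF) _ _ _ c2 (@mulmx_continuous _ _ _ _ TF _)).
Qed.

(** Charts must send 0 to the point considered, hence the translation by [u0]. Projection to the
    E-coordinates is a global left inverse, so the whole space serves as the neighborhood. *)
Lemma graph_chart u0 : slow_disk u0 ->
  C1_param graph_manifold [set u | slow_disk (u0 + u)] (fun u => graph_param (u0 + u)).
Proof.
move=> u0B; split.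
- apply: (open_comp (f := fun u => u0 + u) _ slow_disk_open) => u _.
  by apply: (@cvgD _ _ _ (nbhs u)); [exact: cvg_cst|exact: cvg_id].
- by rewrite /= addr0.
- exact: chart_C1.
- move=> u _; rewrite chart_jacobian; apply/eqP; rewrite eqn_leq rank_leq_col /=.
  set J := T *m _; have JK : (row_mx 1%:M 0 *m iT) *m J = 1%:M :> 'M[R]_d.
    by rewrite -mulmxA mulKmx // mul_row_col mul0mx addr0 mulmx1.
  by rewrite -{1}(@mxrank1 R d) -JK mxrankM_maxr.
exists setT, (fun y => usubmx (iT *m y) - u0); split.
- exact: openT.
- apply/seteqP; split=> [y [u uB <-]|y [yW _]].
    by split=> //; exact: graph_param_in.
  exists (usubmx (iT *m y) - u0); first by rewrite /= addrC subrK; case: yW.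
  by rewrite addrC subrK -graph_manifoldE.
- by move=> u _; rewrite coords_graph col_mxKu addrC addKr.
apply: continuous_subspaceT => y; apply: (@cvgB _ _ _ (nbhs y)); last exact: cvg_cst.
have c1 := @mulmx_continuous R _ _ 1 iT y.
exact: (@cvg_comp _ _ _ (mulmx iT) usubmx _ _ _ c1 (@usubmx_continuous _ _ _ _ _)).
Qed.

Lemma slow_disk0 : slow_disk 0.
Proof. by rewrite /slow_disk /= mulmx0 nsq0. Qed.

Lemma graph_submanifold : C1_submanifold d graph_manifold.
Proof.
move=> x xW; have [uB _] := xW.
exists [set u | slow_disk (usubmx (iT *m x) + u)],
  (fun u => graph_param (usubmx (iT *m x) + u)).
by split; [exact: graph_chart|rewrite addr0 -graph_manifoldE].
Qed.

Lemma graph_tangent (E : {vspace V}) :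
  (forall v, v \in E <-> exists u, v = TE *m u) -> tangent_at0 d graph_manifold E.
Proof.
move=> hE; exists [set u | slow_disk (0 + u)], (fun u => graph_param (0 + u)).
split; [exact: graph_chart slow_disk0|by rewrite addr0 graph_param0|].
by move=> v; rewrite chart_jacobian addr0 L0 mul_row_col mulmx1 mulmx0 addr0.
Qed.

Variables (LE : 'M[R]_d) (LF : 'M[R]_k) (mu : R).
Hypothesis mu0 : 0 < mu.
Hypothesis hE : forall x, dot (JE *m x) (JE *m (LE *m x)) <= - mu * nsq (JE *m x).
Hypothesis hF : forall x, dot (JF *m x) (JF *m (LF *m x)) <= - mu * nsq (JF *m x).
Local Notation Lam := (block_lin LE LF).
Variables (G : V -> V) (e : R).
Hypotheses (ele : e <= mu ^+ 2 / 12) (G0 : G 0 = 0).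
Hypothesis Glip : forall x y, q (G x - G y) <= e * q (x - y).
Hypothesis Lle : forall u h, nsq (JF *m (L u *m h)) <= 2 * nsq (JE *m h).
Hypothesis inv : forall u, let x := col_mx u (w u) in
        dsubmx (Lam x + G x) = L u *m usubmx (Lam x + G x).
Variables (N : set V) (F : R -> V -> V).
Hypothesis flow : forall x, q (iT *m x) < 2 * rho -> let z t := iT *m F t x in
    [/\ N x, z 0 = iT *m x, {within `[0, +oo[, continuous z},
      forall t : R, 0 < t -> is_derive t 1 z (Lam (z t) + G (z t))
    & forall t, 0 <= t -> q (z t) < 2 * rho].

(** The disk keeps the E-part over the base of the graph; the level [2 * rho] is what a graph of
    slope at most 1 over the disk requires, and it matches [usub_trapped]. *)
Definition slow_tube : set V :=
  [set x | slow_disk (usubmx (iT *m x)) /\ q (iT *m x) < 2 * rho].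

Lemma graph_in_tube : graph_manifold `<=` slow_tube.
Proof.
move=> x [xB xw]; split=> //; rewrite /adapted xw.
have := wlip (usubmx (iT *m x)) 0; rewrite w0 !subr0.
by move: xB; rewrite /slow_disk /=; lra.
Qed.

Lemma slow_tube_open : open slow_tube.
Proof.
have c : continuous (mulmx iT : V -> V) := @mulmx_continuous R _ _ 1 iT.
apply: openI.
  apply: (open_comp (f := fun x => usubmx (iT *m x)) _ slow_disk_open) => x _.
  exact: (@cvg_comp _ _ _ (mulmx iT) usubmx _ _ _ (c x) (@usubmx_continuous _ _ _ _ _)).
rewrite openE => x xq.
have c1 : q (iT *m y) @[y --> x] --> q (iT *m x).
  exact: (@cvg_comp _ _ _ (mulmx iT) q _ _ _ (c x) (@adapted_continuous _ _ _ _ _ JE JF _)).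
exact: (cvgr_lt _ c1 _ xq).
Qed.

Lemma slow_tube_forward x t : slow_tube x -> 0 <= t ->
  slow_disk (usubmx (iT *m F t x)) /\
  nsq (JF *m (dsubmx (iT *m F t x) - w (usubmx (iT *m F t x)))) <=
    expR (- (mu / 2) * t) * nsq (JF *m (dsubmx (iT *m x) - w (usubmx (iT *m x)))).
Proof.
move=> [xB xq] t0; have [_ z0 zc zd _] := flow xq; split.
  apply: (usub_trapped mu0 hE hF ele G0 Glip zc zd rho0 _ _ t0).
    by rewrite z0.
  by rewrite z0.
have := graph_attracts mu0 hF ele Glip zc zd wd Lle inv t0.
by rewrite z0.
Qed.

Lemma graph_invariant x t : graph_manifold x -> 0 <= t -> graph_manifold (F t x).
Proof.
move=> xW t0; have [zB] := slow_tube_forward (graph_in_tube xW) t0.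
case: xW => _ ->; rewrite subrr mulmx0 nsq0 mulr0 => z0; split=> //.
apply/eqP; rewrite -subr_eq0; apply/eqP; set y := _ - _ in z0 *.
have /nsq_eq0 Jy : nsq (JF *m y) = 0 by apply/eqP; rewrite eq_le z0 nsq_ge0.
by rewrite -[y]mul1mx -JF'J -mulmxA Jy mulmx0.
Qed.

(** The distance at time [t] is at most that to the graph point with the same E-coordinates;
    conversely, by [wlip], the initial offset is at most a constant times the distance to any point
    of the graph. Squared offsets decay at rate [mu / 2], hence distances at rate [mu / 4]. *)
Lemma graph_exp_attracting : exp_attracting F N graph_manifold.
Proof.
exists slow_tube; split; [exact: slow_tube_open|exact: graph_in_tube| |].
  by move=> x [_ /flow []].
have [cT cT0 HT] := nsq_mulmx_bound TF.
have [cF cF0 HF] := left_inverse_bound JF'J.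
have [cq cq0 Hq] := adapted_le_nsq JE JF.
have [ci ci0 Hi] := nsq_mulmx_bound iT.
pose K := cT * (cF * (2 * (cq * ci))).
have K0 : 0 < K by rewrite /K !mulr_gt0.
exists (Num.sqrt K), (mu / 4); split; rewrite ?sqrtr_gt0 ?divr_gt0 //.
move=> x t xV t0; have [zB za] := slow_tube_forward xV t0.
pose z := iT *m F t x.
have lbd y : has_lbound [set enorm (y - y') | y' in graph_manifold].
  by exists 0 => _ [y' _ <-]; exact: enorm_ge0.
have dist_le : euclidean_dist (F t x) graph_manifold <=
    enorm (F t x - graph_param (usubmx z)).
  by apply: (ge_inf (lbd _)); exists (graph_param (usubmx z)) => //; exact: graph_param_in.
have Fz : F t x - graph_param (usubmx z) = TF *m (dsubmx z - w (usubmx z)).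
  have {1}-> : F t x = TE *m usubmx z + TF *m dsubmx z.
    by rewrite -mul_row_col vsubmxK /z mulKVmx.
  by rewrite /graph_param opprD addrACA subrr add0r mulmxBr.
pose c := Num.sqrt K * expR (- (mu / 4) * t).
have c0 : 0 < c by rewrite mulr_gt0 ?sqrtr_gt0 ?expR_gt0.
(* Dividing by [c] turns the claim into a lower bound for an infimum, so a single point [y] of the
   graph can be fixed. *)
rewrite -/c mulrC -ler_pdivrMr //; apply: lb_le_inf.
  by exists (enorm (x - graph_param 0)), (graph_param 0) => //;
    exact: graph_param_in slow_disk0.
move=> _ [y yW <-]; rewrite ler_pdivrMr // mulrC.
apply: le_trans dist_le _; apply: le_of_sqr.
  by rewrite mulr_ge0 ?enorm_ge0 // ltW.
rewrite exprMn !enorm_cV Fz /c exprMn sqr_sqrtr ?(ltW K0) //.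
rewrite (_ : expR _ ^+ 2 = expR (- (mu / 2) * t)); last first.
  by rewrite expr2 -expRD; congr expR; field.
have h1 := HT (dsubmx z - w (usubmx z)); have h2 := HF (dsubmx z - w (usubmx z)).
have h3 : nsq (JF *m (dsubmx (iT *m x) - w (usubmx (iT *m x)))) <=
    2 * (cq * (ci * nsq (x - y))).
  have -> : dsubmx (iT *m x) - w (usubmx (iT *m x)) =
    dsubmx (iT *m (x - y)) - (w (usubmx (iT *m x)) - w (usubmx (iT *m y))).
    by case: yW => _ <-; rewrite mulmxBr linearB /= opprB addrA subrK.
  rewrite mulmxBr; apply: le_trans (nsqB_le _ _) _.
  have := wlip (usubmx (iT *m x)) (usubmx (iT *m y)).
  have -> : usubmx (iT *m x) - usubmx (iT *m y) = usubmx (iT *m (x - y)).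
    by rewrite mulmxBr linearB.
  have q1 : q (iT *m (x - y)) <= cq * (ci * nsq (x - y)).
    by apply: le_trans (Hq _) _; rewrite ler_wpM2l ?(ltW cq0).
  by move: q1; rewrite /adapted; lra.
apply: le_trans h1 _; rewrite /K -[cT * _ * _]mulrA -[leRHS]mulrA ler_wpM2l ?(ltW cT0) //.
apply: le_trans h2 _; rewrite -[cF * _ * _]mulrA -[leRHS]mulrA ler_wpM2l ?(ltW cF0) //.
apply: le_trans za _.
rewrite (_ : _ * _ * nsq (x - y) = expR (- (mu / 2) * t) * (2 * (cq * (ci * nsq (x - y))))).
  by rewrite ler_wpM2l ?expR_ge0.
by ring.
Qed.

Lemma graph_attracting_SSM (E : {vspace V}) :
  (forall v, v \in E <-> exists u, v = TE *m u) -> attracting_SSM d F N E graph_manifold.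
Proof.
move=> hTE; split.
- split; last by move=> x /graph_in_tube [_ /flow []].
  by have := graph_param_in slow_disk0; rewrite graph_param0.
- exact: graph_submanifold.
- exact: graph_tangent.
- exact: graph_invariant.
- exact: graph_exp_attracting.
Qed.

(** In the chart the map is the E-coordinate of the flow over the graph. Its derivative at 0 is read
    off the quadratic flow estimate, without differentiating the flow in its initial value. *)
Lemma graph_linearization (t r K : R) (Lw : 'M[R]_d) : 0 <= t -> 0 < r -> 0 <= K ->
  (forall x, nsq (iT *m x) <= r ->
    nsq (usubmx (iT *m F t x) - Lw *m usubmx (iT *m x)) <= K * nsq (iT *m x) ^+ 2) ->
  linearization_on graph_manifold (F t) Lw.
Proof.
move=> t0 r0 K0 Fest.
have [cE cE0 HE] := nsq_mulmx_bound JE.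
have [cF cF0 HF] := left_inverse_bound JF'J.
pose c := 1 + cF * cE; have c0 : 0 < c by rewrite ltr_wpDr // mulr_ge0 // ltW.
have zu u : nsq (col_mx u (w u)) <= c * nsq u.
  rewrite nsq_col_mx /c mulrDl mul1r lerD2l; apply: le_trans (HF _) _.
  rewrite -mulrA ler_wpM2l ?(ltW cF0) //; apply: le_trans (HE _).
  by have := wlip u 0; rewrite w0 !subr0.
pose g u := usubmx (iT *m F t (graph_param (0 + u))).
have gest u : nsq u <= r / c -> nsq (g u - Lw *m u) <= K * c ^+ 2 * nsq u ^+ 2.
  rewrite ler_pdivlMr // mulrC => ur.
  have zr : nsq (iT *m graph_param u) <= r.
    by rewrite coords_graph; apply: le_trans (zu u) ur.
  have := Fest _ zr; rewrite coords_graph col_mxKu => h.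
  rewrite /g add0r; apply: le_trans h _; rewrite -mulrA ler_wpM2l // -exprMn.
  by rewrite lerXn2r ?nnegrE ?nsq_ge0 ?mulr_ge0 ?nsq_ge0 ?(ltW c0).
have g0 : g 0 = 0.
  have h0 : nsq (0 : 'cV[R]_d) <= r / c by rewrite nsq0 divr_ge0 // ltW.
  have := gest 0 h0; rewrite mulmx0 subr0 nsq0 expr0n mulr0 => gz.
  by apply: nsq_eq0; apply/eqP; rewrite eq_le gz nsq_ge0.
have Kc : 0 <= K * c ^+ 2 by rewrite mulr_ge0 ?sqr_ge0.
have [gd gE] : differentiable g 0 /\ ('d g (0 : 'cV[R]_d) : 'cV[R]_d -> 'cV[R]_d) = mulmx Lw.
  apply: (near_taylor_differentiable Kc ltr01).
  have rc : 0 < r / c by rewrite divr_gt0.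
  near=> h; rewrite g0 add0r subr0.
  rewrite (_ : 1 + 1 = 2%:R) // powR_mulrn ?nsq_ge0 //.
  by apply: gest; near: h; exact: nsq_le_near0.
exists [set u | slow_disk (0 + u)], (fun u => graph_param (0 + u)), g; split.
- by split; [exact: graph_chart slow_disk0|rewrite addr0 graph_param0].
- have B0 : nbhs (0 : 'cV[R]_d) slow_disk by apply: open_nbhs_nbhs; split; [exact: slow_disk_open|exact: slow_disk0].
  near=> u; have uB : slow_disk u by near: u.
  have xW := graph_invariant (graph_param_in uB) t0.
  rewrite /g /= !add0r; split; first by case: xW.
  by rewrite -graph_manifoldE.
- exact: gd.
by apply: mulmx_cV_inj => v; rewrite cjacobian_mulmx gE.
Unshelve. all: by end_near. Qed.

End Manifold.

Lemma similar_conjugate (R : realType) d (S L : 'M[R]_d) : S \in unitmx ->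
  locally_conjugate (mulmx L) (mulmx (S *m L *m invmx S)).
Proof.
move=> Su; exists setT, (mulmx S), (mulmx (invmx S)).
have im : [set S *m u | u in setT] = (setT : set 'cV[R]_d).
  by apply/seteqP; split=> // x _; exists (invmx S *m x) => //; rewrite mulKVmx.
split.
- split; [exact: openT|by []|exact: mulmx0|].
  by rewrite im; exact: openT.
- exact: continuous_subspaceT (@mulmx_continuous _ _ _ _ S).
- exact: continuous_subspaceT (@mulmx_continuous _ _ _ _ (invmx S)).
- by move=> u _; rewrite mulKmx.
by move=> u _ _; rewrite -!mulmxA mulKmx.
Qed.

(* The phase space dimension is n = d + k, so that 1 <= d <= n. *)
Theorem theorem1 (R : realType) (d k : nat) (hd : (0 < d)%N)
  (* the dynamical system and its flow map *)
  (f ftilde : 'cV[R]_(d + k) -> 'cV[R]_(d + k)) (A : 'M[R]_(d + k))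
  (hf : forall x, f x = A *m x + ftilde x)
  (hf0 : f 0 = 0) (hdf0 : differentiable f 0) (hA : cjacobian f 0 = A)
  (hftilde : ftilde =o_ (0 : 'cV[R]_(d + k)) id)
  (N : set 'cV[R]_(d + k)) (hN : open_nbhs (0 : 'cV[R]_(d + k)) N)
  (F : R -> 'cV[R]_(d + k) -> 'cV[R]_(d + k)) (hF : flow_on f N F)
  (* spectral notation *)
  (lam : 'I_(d + k) -> R[i]) (hlam : eigenvalues A lam)
  (e : 'I_(d + k) -> 'cV[R[i]]_(d + k)) (he : gen_eigenbasis A lam e)
  (E Fsp : {vspace 'cV[R]_(d + k)})
  (hE : E = re_im_span (fun i : 'I_d => e (lshift k i)))
  (hFsp : Fsp = re_im_span (fun i : 'I_k => e (rshift d i)))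
  (TE : 'M[R]_(d + k, d)) (TF : 'M[R]_(d + k, k))
  (hTE : right_basis A (fun i : 'I_d => lam (lshift k i)) E TE)
  (hTF : right_basis A (fun i : 'I_k => lam (rshift d i)) Fsp TF)
  (PE : 'M[R]_(d, d + k)) (PF : 'M[R]_(k, d + k))
  (hPE : left_basis A (fun i : 'I_d => lam (lshift k i)) PE)
  (hPF : left_basis A (fun i : 'I_k => lam (rshift d i)) PF)
  (LambdaE : 'M[R]_d)
  (hLambdaE : LambdaE = ulsubmx (invmx (row_mx TE TF) *m A *m row_mx TE TF))
  (* (A1) *)
  (hA1 : stable_spectral_gap d lam)
  (* (A2) *)
  (hA2 : exists U : set 'cV[R]_(d + k), open_nbhs (0 : 'cV[R]_(d + k)) U /\ C2_on U f)
  (* (A3) *)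
  (phi : 'cV[R]_(d + k) -> 'cV[R]_d) (hphi : C2_on setT phi)
  (hphi0 : phi 0 = 0)
  (hA3 : \dim (linfun ('d phi (0 : 'cV[R]_(d + k))) @: E) = d)
  (* time step and the exponent of (A4) *)
  (dt : R) (hdt : 0 < dt) (beta : R) (hbeta : 0 < beta <= 1) :
  let D0 := cjacobian phi 0 *m TE *m mexp (dt *: LambdaE)
              *m invmx (cjacobian phi 0 *m TE) in
  (exists (W : set 'cV[R]_(d + k)) (LambdaW : 'M[R]_d),
    [/\ attracting_SSM d F N E W,
        linearization_on W (F dt) LambdaW
      & locally_conjugate (mulmx LambdaW) (mulmx D0)]) /\
  (* D = D0 + O(|PE X|^beta), with constants that depend on the data only
     through a bound kappa on the condition number of Phi *)
  (forall kappa : R, 0 < kappa ->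
   exists C delta : R, [/\ 0 < C, 0 < delta
   & forall (m : nat) (X : 'M[R]_(d + k, m)),
     let Xhat := map_cols (F dt) X in
     let Phi := map_cols phi X in
     let Phihat := map_cols phi Xhat in
     \rank Phi = d ->
     enorm Phi * enorm (mp_inverse Phi) <= kappa ->
     enorm (PF *m X) <= enorm (PE *m X) `^ (1 + beta) ->
     enorm (PF *m Xhat) <= enorm (PE *m X) `^ (1 + beta) ->
     enorm (PE *m X) < delta ->
     enorm (dmd Phi Phihat - D0) <= C * enorm (PE *m X) `^ beta]).
Proof.
have [LF [Tu AT [PETF PFTE] [PEu PFu]]] :=
  spectral_splitting hd hA1 hTE hTF hPE hPF hLambdaE.
move=> [al [be [mu [mu0 mube al0 albe [[JE [JE' [JE'J hJE]]] [JF [JF' [JF'J hJF]]]]]]]].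
have hE1 x : - al * nsq (JE *m x) <= dot (JE *m x) (JE *m (LambdaE *m x)).
  by case/andP: (hJE x).
have hE2 x : dot (JE *m x) (JE *m (LambdaE *m x)) <= - mu * nsq (JE *m x).
  by case/andP: (hJE x).
have hF2 x : dot (JF *m x) (JF *m (LF *m x)) <= - mu * nsq (JF *m x).
  by apply: le_trans (hJF x) _; rewrite ler_wpM2r ?nsq_ge0 // lerN2.
have [U [U0 fC2]] := hA2.
have [/andP[/eqP TEspan _] _] := hTE.
(* [hA3] gives the derivative full rank on E; in the basis [TE] this is invertibility of a square
   matrix. *)
have Su : cjacobian phi 0 *m TE \in unitmx.
  by apply: (image_dim_unit _ hTE.1 hA3) => v; rewrite cjacobian_mulmx.
move=> D0; split.
  have [e1 e10 He1] := slow_manifold JE'J JF'J hE1 hJF al0 albe.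
  (* [e1] is what the construction of the graph asks, [mu ^+ 2 / 12] what the forward estimates
     ask. *)
  pose eps := Num.min e1 (mu ^+ 2 / 12).
  have eps0 : 0 < eps by rewrite lt_min e10 divr_gt0 // exprn_gt0.
  have [ee1 ele] : eps <= e1 /\ eps <= mu ^+ 2 / 12.
    by split; rewrite ge_min lexx ?orbT.
  have [r [B [G [G' [[r0 B0] [G0 [G'0 G'c]] Glip [Gt G'le] flow]]]]] :=
    local_normal_form JE'J JF'J mu0 hE2 hF2 Tu AT hf0 hA U0 fC2 hN hF eps0 ele.
  have [w [L [[w0 L0] wlip [Lle wC1] wd inv]]] :=
    He1 G G' eps B (ltW eps0) ee1 B0 G0 Glip Gt G'le G'0 G'c.
  have [r2 [K [r20 K0 Fest]]] := flow_estimate JE'J JF'J mu0 hE2 hF2 Tu AT hf0 hA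
    U0 fC2 hN hF (ltW hdt).
  (* With [r / 2] as level of the disk, the tube [q < 2 * (r / 2)] fits the region where the normal
     form holds. *)
  have rho0 : 0 < r / 2 by rewrite divr_gt0.
  have rE : r = 2 * (r / 2) by rewrite mulrC divfK.
  rewrite rE in flow.
  have TEs v : v \in E <-> exists u, v = TE *m u.
    by rewrite -TEspan; exact: span_cols.
  (* The linearization is the exponential of [dt *: LambdaE], and [cjacobian phi 0 *m TE] conjugates
     it to [D0]. *)
  exists (graph_manifold JE TE TF w (r / 2)), (mexp (dt *: LambdaE)); split.
  - exact: (graph_attracting_SSM JF'J Tu w0 L0 wlip (wC1 setT) wd rho0 mu0 hE2 hF2
      ele G0 Glip Lle inv flow TEs).
  - apply: (graph_linearization JF'J Tu w0 wlip (wC1 setT) wd rho0 mu0 hE2 hF2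
      ele G0 Glip Lle inv flow (ltW hdt) r20 K0) => x xr.
    by have [] := Fest x xr.
  - exact: similar_conjugate.
move=> kappa k0; have [b0 b1] := andP hbeta.
have [r2 [K [r20 K0 Fest]]] := flow_estimate JE'J JF'J mu0 hE2 hF2 Tu AT hf0 hA
  U0 fC2 hN hF (ltW hdt).
have [rho [C [rho0 C0 Herr Hlow]]] :=
  observable_pointwise Tu PETF PFTE PEu PFu r20 K0 Fest hphi hphi0 Su.
exact: (dmd_estimate hd b0 b1 rho0 C0 Herr Hlow
  (coord_zero Tu PETF PFTE PEu PFu hphi0) k0).
Qed.
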